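(* Let $k \geqslant 4$ be an integer with $4 \mid k$. Then all of the zeros of $E_{k,5}^{*}(z)$ in $\mathbb{F}^{*}(5)$ are on the arc $A_5^{*}$.
   Context: $\mathbb{H} = \{z \in \mathbb{C} : \mathrm{Im}(z) > 0\}$. For an even integer $k \geqslant 4$ and $z \in \mathbb{H}$ put $E_k(z) = \frac12 \sum_{(c,d)=1} (cz+d)^{-k}$ (sum over all pairs of coprime integers) and $$E_{k,5}^{*}(z) = \frac{1}{5^{k/2}+1}\left(5^{k/2} E_k(5z) + E_k(z)\right),$$ the Eisenstein series associated with the Fricke group $\Gamma_0^{*}(5)$. The set $\mathbb{F}^{*}(5)$ is the following subset of $\mathbb{H}$ (a fundamental domain for $\Gamma_0^*(5)$): $$\mathbb{F}^{*}(5) = \{|z| \geqslant 1/\sqrt5,\ |z+1/2| \geqslant 1/(2\sqrt5),\ -1/2 \leqslant \mathrm{Re}(z) \leqslant 0\} \cup \{|z| > 1/\sqrt5,\ |z-1/2| > 1/(2\sqrt5),\ 0 \leqslant \mathrm{Re}(z) < 1/2\}.$$ The arc is $A_5^{*} = \mathbb{F}^{*}(5) \cap \{z \in \mathbb{C} : |z| = 1/\sqrt5 \text{ or } |z+1/2| = 1/(2\sqrt5) \text{ or } |z-1/2| = 1/(2\sqrt5)\}$. *)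

(* Defs.v *)
From Stdlib Require Export Reals ZArith.
From Coquelicot Require Export Coquelicot.
From Stdlib Require Export List.

Open Scope R_scope.

(** Unconditional summation of a complex family over [D]: the limit of the
    finite partial sums along the finite subsets of [D] directed by inclusion,
    a finite subset being represented by a duplicate-free list. *)

Definition finite_subsets {T : Type} (D : T -> Prop) (P : list T -> Prop) : Prop :=
  exists l0 : list T, Forall D l0 /\
    forall l : list T, NoDup l -> Forall D l -> incl l0 l -> P l.

Definition Csum_list {T : Type} (f : T -> C) (l : list T) : C :=
  fold_right Cplus (RtoC 0) (map f l).

Definition is_Csum {T : Type} (D : T -> Prop) (f : T -> C) (s : C) : Prop :=
  filterlim (Csum_list f) (finite_subsets D) (locally s).

(** Meaningful only when the family is summable, like [Series] and [RInt]. *)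
Definition Csum {T : Type} (D : T -> Prop) (f : T -> C) : C :=
  iota (T := C_CompleteNormedModule) (is_Csum D f).

Definition upper_half_plane (z : C) : Prop := 0 < Im z.

Definition coprime_pair (p : Z * Z) : Prop := Z.gcd (fst p) (snd p) = 1%Z.

(** Used only for even [k >= 4] and [z] in the upper half plane, where the
    series converges absolutely and no denominator vanishes. *)
Definition Eisenstein (k : nat) (z : C) : C :=
  (/ 2 * Csum coprime_pair
           (fun p => / (IZR (fst p) * z + IZR (snd p)) ^ k))%C.

Definition Eisenstein_Fricke5 (k : nat) (z : C) : C :=
  (1 / (5 ^ (k / 2)%nat + 1)
   * (5 ^ (k / 2)%nat * Eisenstein k (5 * z) + Eisenstein k z))%C.

Definition Fricke5_domain (z : C) : Prop :=
  upper_half_plane z /\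
  ((Cmod z >= 1 / sqrt 5 /\ Cmod (z + 1 / 2)%C >= 1 / (2 * sqrt 5) /\
    - (1 / 2) <= Re z <= 0)
   \/
   (Cmod z > 1 / sqrt 5 /\ Cmod (z - 1 / 2)%C > 1 / (2 * sqrt 5) /\
    0 <= Re z < 1 / 2)).

Definition Fricke5_arc (z : C) : Prop :=
  Fricke5_domain z /\
  (Cmod z = 1 / sqrt 5 \/
   Cmod (z + 1 / 2)%C = 1 / (2 * sqrt 5) \/
   Cmod (z - 1 / 2)%C = 1 / (2 * sqrt 5)).

(* Main.v *)
Require Import Defs.
From Stdlib Require Import Permutation Lra Lia Psatz Bool Classical ClassicalEpsilon.

(** Write [f] for the series of weight [k = 2 h], with [h] even. Splitting the
    coprime pairs by divisibility by 5 gives [f = (A + 5^(-h) B) / 2], where [A]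
    sums [(5 b z + a)^(-k)] and [B] sums [(a z + b)^(-k)] over the coprime pairs
    [(a, b)] with [a] prime to 5. On each arc conjugation exchanges the terms of
    [A] and [B] up to a factor of modulus one: there [conj f = U f], with
    [U = (sqrt 5 z)^k] on [|z| = 1/sqrt 5] and [U = (sqrt 5 (2 z + 1))^k] on
    [|z + 1/2| = 1/(2 sqrt 5)].

    Suppose that [f] is holomorphic on a compact region
    and that its boundary values avoid the negative real axis, zeros being allowed
    provided that near them the values also avoid a sector around this axis:
    [|f + d| >= c d] for all [d > 0]. Then [f], unless identically 0, has no zero inside
    ([interior_zero_spreads], [zero_free_from_above]). Indeed the maximum modulus
    principle for [1 / (f + d)] first shows that [f] takes no negative value
    inside; an interior zero would then give an open map missing a sector at 0,
    which is again refuted by the maximum modulus principle. Only second order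
    Taylor expansions and compactness enter.

    The region is bounded by the lines [Re z = 0], [Re z = -1], the horizontal
    line at height 2, the two arcs and the mirror image of the first arc in
    [Re z = -1/2]. On the lines [Re f > 0], by direct estimates
    ([Fricke5_pos_imaginary_axis], [Fricke5_near_cusp]). On an arc the relation
    [conj f = U f] confines [f(z)] to a line through 0, which is the real axis
    only where [U = 1]; at these points [f = Re A], and what has to be shown is
    [Re A > 0]. This includes the neighbourhood of the corner [-2/5 + i/5], where the terms
    [1] and [(5 z + 2)^(-k)] of [A] have equal modulus and could cancel: in fact
    [Re (5 z + 2)^(-k) >= -10/17] all along the arcs ([Re_inv_pow_ge]), because
    the argument of [(5 z + 2)^k] turns no faster than its modulus grows. The
    other terms are bounded by sums over a lattice that is nearly the lattice of
    Gaussian integers ([Re_first_series_pos], and [Re_first_series_pos_weight4]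
    for the single point that matters when [k = 4]).

    Hence [f] vanishes nowhere in the half strip [-1 < Re z < 0] above the arcs,
    and the other half of the fundamental domain follows from
    [f (- conj z) = conj (f z)]. *)

(** * Unconditional sums *)

Definition Rsum_list {T : Type} (w : T -> R) (l : list T) : R :=
  fold_right Rplus 0 (map w l).

Lemma Rsum_list_app {T} (w : T -> R) l l' :
  Rsum_list w (l ++ l') = Rsum_list w l + Rsum_list w l'.
Proof.
  unfold Rsum_list; induction l; simpl; [ring|]. rewrite IHl; ring.
Qed.

Lemma Csum_list_app {T} (f : T -> C) l l' :
  Csum_list f (l ++ l') = (Csum_list f l + Csum_list f l')%C.
Proof.
  unfold Csum_list; induction l; simpl; [ring|]. rewrite IHl; ring.
Qed.

Lemma Rsum_list_perm {T} (w : T -> R) l l' :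
  Permutation l l' -> Rsum_list w l = Rsum_list w l'.
Proof.
  unfold Rsum_list; induction 1; simpl; lra.
Qed.

Lemma Csum_list_perm {T} (f : T -> C) l l' :
  Permutation l l' -> Csum_list f l = Csum_list f l'.
Proof.
  unfold Csum_list; induction 1; simpl; trivial.
  - now rewrite IHPermutation.
  - ring.
  - congruence.
Qed.

Lemma Rsum_list_ge0 {T} (w : T -> R) l :
  (forall x, In x l -> 0 <= w x) -> 0 <= Rsum_list w l.
Proof.
  unfold Rsum_list; induction l; simpl; intros H; [lra|].
  assert (0 <= w a) by (apply H; auto).
  assert (0 <= fold_right Rplus 0 (map w l)) by (apply IHl; auto). lra.
Qed.

Lemma Rsum_list_le {T} (w w' : T -> R) l :
  (forall x, In x l -> w x <= w' x) -> Rsum_list w l <= Rsum_list w' l.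
Proof.
  unfold Rsum_list; induction l; simpl; intros H; [lra|].
  assert (w a <= w' a) by (apply H; auto).
  assert (fold_right Rplus 0 (map w l) <= fold_right Rplus 0 (map w' l))
    by (apply IHl; auto). lra.
Qed.

Lemma Rsum_list_plus {T} (w w' : T -> R) l :
  Rsum_list (fun x => w x + w' x) l = Rsum_list w l + Rsum_list w' l.
Proof. unfold Rsum_list; induction l; simpl; [ring|]. rewrite IHl; ring. Qed.

Lemma Rsum_list_scal {T} (c : R) (w : T -> R) l :
  Rsum_list (fun x => c * w x) l = c * Rsum_list w l.
Proof. unfold Rsum_list; induction l; simpl; [ring|]. rewrite IHl; ring. Qed.

Lemma Rsum_list_map {T T'} (g : T -> T') (w : T' -> R) l :
  Rsum_list w (map g l) = Rsum_list (fun x => w (g x)) l.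
Proof. unfold Rsum_list; now rewrite map_map. Qed.

Lemma Csum_list_map {T T'} (g : T -> T') (f : T' -> C) l :
  Csum_list f (map g l) = Csum_list (fun x => f (g x)) l.
Proof. unfold Csum_list; now rewrite map_map. Qed.

Lemma Csum_list_ext {T} (f g : T -> C) l :
  (forall x, In x l -> f x = g x) -> Csum_list f l = Csum_list g l.
Proof.
  unfold Csum_list; intros H; f_equal; now apply map_ext_in.
Qed.

Lemma Csum_list_Cmod_le {T} (f : T -> C) l :
  Cmod (Csum_list f l) <= Rsum_list (fun x => Cmod (f x)) l.
Proof.
  unfold Csum_list, Rsum_list; induction l; simpl.
  - rewrite Cmod_0; lra.
  - eapply Rle_trans; [apply Cmod_triangle|]. lra.
Qed.

Lemma NoDup_incl_Permutation_app {T} (l0 l : list T) :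
  NoDup l0 -> incl l0 l -> exists r, Permutation l (l0 ++ r).
Proof.
  revert l; induction l0 as [|x l0 IH]; intros l Hn Hi.
  - exists l; apply Permutation_refl.
  - destruct (in_split x l) as (l1 & l2 & ->); [apply Hi; now left|].
    inversion Hn; subst.
    destruct (IH (l1 ++ l2)) as [r Hr]; trivial.
    + intros y Hy. assert (Hy' : In y (l1 ++ x :: l2)) by (apply Hi; now right).
      apply in_app_or in Hy'. apply in_or_app.
      destruct Hy' as [?|[->|?]]; auto. contradiction.
    + exists r. rewrite <- Permutation_middle. simpl. now constructor.
Qed.

Lemma classical_nodup {T} (l : list T) :
  exists l', NoDup l' /\ incl l l' /\ incl l' l.
Proof.
  induction l as [|x l (l' & H1 & H2 & H3)].
  - exists nil; repeat split; try constructor; intros y [].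
  - destruct (classic (In x l')) as [Hx|Hx].
    + exists l'; split; [trivial|]; split.
      * intros y [->|Hy]; auto.
      * intros y Hy; right; auto.
    + exists (x :: l'); split; [now constructor|]; split;
        intros y [->|Hy]; simpl; auto.
Qed.

Lemma Forall_incl {T} (D : T -> Prop) l l' : Forall D l -> incl l' l -> Forall D l'.
Proof. rewrite !Forall_forall; intros H Hi x Hx; auto. Qed.

Lemma Rsum_list_incl {T} (w : T -> R) l l' :
  NoDup l -> incl l l' -> (forall x, In x l' -> 0 <= w x) ->
  Rsum_list w l <= Rsum_list w l'.
Proof.
  intros Hn Hi Hw. destruct (NoDup_incl_Permutation_app l l' Hn Hi) as [r Hr].
  rewrite (Rsum_list_perm w _ _ Hr), Rsum_list_app.
  enough (0 <= Rsum_list w r) by lra.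
  apply Rsum_list_ge0; intros x Hx; apply Hw.
  eapply Permutation_in; [symmetry; apply Hr|]. apply in_or_app; now right.
Qed.

Global Instance finite_subsets_filter {T} (D : T -> Prop) :
  ProperFilter (finite_subsets D).
Proof.
  split.
  - intros P (l0 & H0 & HP).
    destruct (classical_nodup l0) as (l & Hn & H1 & H2).
    exists l; apply HP; trivial. now apply (Forall_incl D l0).
  - split.
    + exists nil; split; auto.
    + intros P Q (l0 & H0 & HP) (l1 & H1 & HQ).
      exists (l0 ++ l1); split; [now apply Forall_app|].
      intros l Hn Hl Hi; split; [apply HP|apply HQ]; trivial;
        intros x Hx; apply Hi, in_or_app; auto.
    + intros P Q HPQ (l0 & H0 & HP). exists l0; split; auto.
Qed.

(** The explicit form of unconditional convergence, in terms of the modulus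
    rather than of the filters of the product uniform structure. *)
Definition has_Csum {T} (D : T -> Prop) (f : T -> C) (s : C) : Prop :=
  forall eps, 0 < eps -> exists l0, NoDup l0 /\ Forall D l0 /\
    forall l, NoDup l -> Forall D l -> incl l0 l -> Cmod (Csum_list f l - s) < eps.

Lemma is_Csum_iff_has_Csum {T} (D : T -> Prop) f s : is_Csum D f s <-> has_Csum D f s.
Proof.
  unfold is_Csum, has_Csum. rewrite filterlim_locally. split.
  - intros H eps He.
    assert (He' : 0 < eps / 2) by lra.
    destruct (H (mkposreal _ He')) as (l0 & H0 & HP).
    destruct (classical_nodup l0) as (l1 & Hn & H1 & H2).
    exists l1; split; [trivial|]; split; [now apply (Forall_incl D l0)|].
    intros l Hl HD Hi.
    assert (Hb := HP l Hl HD (incl_tran H1 Hi)).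
    apply C_NormedModule_mixin_compat2 in Hb. simpl in Hb.
    assert (sqrt 2 < 2).
    { rewrite <- (sqrt_square 2) at 2 by lra. apply sqrt_lt_1; lra. }
    unfold minus, plus, opp in Hb; simpl in Hb. unfold Cminus.
    eapply Rlt_le_trans; [apply Hb|]. nra.
  - intros H eps. destruct (H eps (cond_pos eps)) as (l0 & Hn & H0 & HP).
    exists l0; split; [trivial|]. intros l Hl HD Hi.
    apply C_NormedModule_mixin_compat1. now apply HP.
Qed.

Lemma has_Csum_Csum {T} (D : T -> Prop) f s : has_Csum D f s -> Csum D f = s.
Proof.
  intros H. apply is_Csum_iff_has_Csum in H.
  apply (iota_filterlim_locally (V := C_CompleteNormedModule)
           (F := finite_subsets D) (Csum_list f) s H).
Qed.

Definition abs_bounded {T} (D : T -> Prop) (f : T -> C) (M : R) : Prop :=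
  forall l, NoDup l -> Forall D l -> Rsum_list (fun x => Cmod (f x)) l <= M.

Lemma has_Csum_of_abs_bounded {T} (D : T -> Prop) f M :
  abs_bounded D f M -> has_Csum D f (Csum D f).
Proof.
  intros HM.
  assert (Hex : exists s, is_Csum D f s).
  { apply (proj1 (filterlim_locally_cauchy (U := C_CompleteNormedModule)
                    (F := finite_subsets D) (Csum_list f))).
    intros eps.
    pose (E := fun x => exists l, NoDup l /\ Forall D l /\
                        x = Rsum_list (fun x => Cmod (f x)) l).
    destruct (completeness E) as [S [HS1 HS2]].
    - exists M; intros x (l & H1 & H2 & ->); now apply HM.
    - exists 0; exists nil; repeat split; constructor.
    - assert (Hl : exists l, NoDup l /\ Forall D l /\
                    S - eps / 2 < Rsum_list (fun x => Cmod (f x)) l).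
      { apply NNPP; intros Hc.
        assert (S <= S - eps / 2).
        { apply HS2. intros x (l & H1 & H2 & ->).
          apply Rnot_lt_le; intros Hlt; apply Hc; now exists l. }
        destruct eps as [e He]; simpl in *; lra. }
      destruct Hl as (l0 & Hn0 & HD0 & Hl0).
      assert (Hclose : forall l, NoDup l -> Forall D l -> incl l0 l ->
                Cmod (Csum_list f l - Csum_list f l0) < eps / 2).
      { intros l Hn HD Hi.
        destruct (NoDup_incl_Permutation_app l0 l Hn0 Hi) as [r Hr].
        rewrite (Csum_list_perm f _ _ Hr), Csum_list_app.
        replace (_ - _)%C with (Csum_list f r) by ring.
        eapply Rle_lt_trans; [apply Csum_list_Cmod_le|].
        assert (Rsum_list (fun x => Cmod (f x)) l <= S)
          by (apply HS1; now exists l).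
        rewrite (Rsum_list_perm _ _ _ Hr), Rsum_list_app in H. lra. }
      exists (fun l => Cmod (Csum_list f l - Csum_list f l0) < eps / 2).
      split.
      + exists l0; split; trivial.
      + intros u v Hu Hv. apply C_NormedModule_mixin_compat1.
        unfold minus, plus, opp; simpl.
        replace (Csum_list f v + - Csum_list f u)%C with
          ((Csum_list f v - Csum_list f l0) + - (Csum_list f u - Csum_list f l0))%C
          by ring.
        eapply Rle_lt_trans; [apply Cmod_triangle|]. rewrite Cmod_opp. lra. }
  destruct Hex as [s Hs]. apply is_Csum_iff_has_Csum in Hs.
  now rewrite (has_Csum_Csum _ _ _ Hs).
Qed.

Lemma has_Csum_unique {T} (D : T -> Prop) f s t :
  has_Csum D f s -> has_Csum D f t -> s = t.
Proof. intros H1 H2. rewrite <- (has_Csum_Csum _ _ _ H1). now apply has_Csum_Csum. Qed.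

Lemma has_Csum_ext {T} (D : T -> Prop) f g s :
  (forall x, D x -> f x = g x) -> has_Csum D f s -> has_Csum D g s.
Proof.
  intros Hfg H eps He. destruct (H eps He) as (l0 & H1 & H2 & H3).
  exists l0; repeat split; trivial. intros l Hn HD Hi.
  rewrite <- (Csum_list_ext f g); [now apply H3|].
  intros x Hx; apply Hfg; rewrite Forall_forall in HD; auto.
Qed.

Lemma has_Csum_plus {T} (D : T -> Prop) f g s t :
  has_Csum D f s -> has_Csum D g t -> has_Csum D (fun x => f x + g x)%C (s + t)%C.
Proof.
  intros Hf Hg eps He.
  destruct (Hf (eps/2)) as (l1 & H1 & H2 & H3); [lra|].
  destruct (Hg (eps/2)) as (l2 & H4 & H5 & H6); [lra|].
  destruct (classical_nodup (l1 ++ l2)) as (l0 & Hn & Hi1 & Hi2).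
  exists l0; split; [trivial|]; split.
  { apply (Forall_incl D (l1 ++ l2)); trivial. now apply Forall_app. }
  intros l Hnl HD Hi.
  assert (E : Csum_list (fun x => f x + g x)%C l = (Csum_list f l + Csum_list g l)%C).
  { clear. unfold Csum_list; induction l; simpl; [ring|]. rewrite IHl; ring. }
  rewrite E.
  replace (_ - _)%C with ((Csum_list f l - s) + (Csum_list g l - t))%C by ring.
  eapply Rle_lt_trans; [apply Cmod_triangle|].
  assert (Cmod (Csum_list f l - s) < eps/2).
  { apply H3; trivial. intros x Hx; apply Hi, Hi1, in_or_app; auto. }
  assert (Cmod (Csum_list g l - t) < eps/2).
  { apply H6; trivial. intros x Hx; apply Hi, Hi1, in_or_app; auto. }
  lra.
Qed.

Lemma has_Csum_scal {T} (D : T -> Prop) c f s :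
  has_Csum D f s -> has_Csum D (fun x => c * f x)%C (c * s)%C.
Proof.
  intros Hf eps He.
  assert (Hc : 0 <= Cmod c) by apply Cmod_ge_0.
  destruct (Hf (eps/(Cmod c + 1))) as (l1 & H1 & H2 & H3).
  { apply Rdiv_lt_0_compat; lra. }
  exists l1; repeat split; trivial. intros l Hnl HD Hi.
  assert (E : Csum_list (fun x => c * f x)%C l = (c * Csum_list f l)%C).
  { clear. unfold Csum_list; induction l; simpl; [ring|]. rewrite IHl; ring. }
  rewrite E.
  replace (_ - _)%C with (c * (Csum_list f l - s))%C by ring.
  rewrite Cmod_mult. specialize (H3 l Hnl HD Hi).
  assert (0 <= Cmod (Csum_list f l - s)) by apply Cmod_ge_0.
  apply Rmult_lt_compat_r with (r := Cmod c + 1) in H3; [|lra].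
  unfold Rdiv in H3. rewrite Rmult_assoc, Rinv_l in H3 by lra. lra.
Qed.

Lemma has_Csum_conj {T} (D : T -> Prop) f s :
  has_Csum D f s -> has_Csum D (fun x => Cconj (f x)) (Cconj s).
Proof.
  intros Hf eps He. destruct (Hf eps He) as (l1 & H1 & H2 & H3).
  exists l1; repeat split; trivial. intros l Hnl HD Hi.
  assert (E : Csum_list (fun x => Cconj (f x)) l = Cconj (Csum_list f l)).
  { clear. unfold Csum_list; induction l; simpl.
    - apply injective_projections; simpl; ring.
    - now rewrite IHl, Cplus_conj. }
  rewrite E, <- Cminus_conj, Cmod_conj. auto.
Qed.

Lemma has_Csum_reindex {T T'} (D : T -> Prop) (D' : T' -> Prop)
  (phi : T -> T') (psi : T' -> T) (f : T' -> C) s :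
  (forall x, D x -> D' (phi x)) -> (forall y, D' y -> D (psi y)) ->
  (forall x, D x -> psi (phi x) = x) -> (forall y, D' y -> phi (psi y) = y) ->
  has_Csum D' f s -> has_Csum D (fun x => f (phi x)) s.
Proof.
  intros H1 H2 H3 H4 H eps He.
  destruct (H eps He) as (l0 & Hn0 & HD0 & HP).
  assert (Hinj : forall l, Forall D l -> NoDup l -> NoDup (map phi l)).
  { intros l; induction l; simpl; intros HD Hn; [constructor|].
    apply Forall_cons_iff in HD. destruct HD as [Ha HD].
    apply NoDup_cons_iff in Hn. destruct Hn as [Hna Hn]. constructor; auto.
    intros Hx. apply in_map_iff in Hx. destruct Hx as (y & Hy1 & Hy2).
    rewrite Forall_forall in HD.
    assert (y = a) by (rewrite <- (H3 y), <- (H3 a); auto; congruence).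
    congruence. }
  destruct (classical_nodup (map psi l0)) as (l1 & Hn1 & Hi1 & Hi2).
  exists l1; split; [trivial|]; split.
  { apply (Forall_incl D (map psi l0)); trivial.
    rewrite Forall_map. eapply Forall_impl; [|apply HD0]. auto. }
  intros l Hn HD Hi.
  rewrite <- (Csum_list_map phi f). apply HP.
  - auto.
  - rewrite Forall_map. eapply Forall_impl; [|apply HD]. auto.
  - intros y Hy. rewrite <- (H4 y) by (rewrite Forall_forall in HD0; auto).
    apply in_map, Hi, Hi1, in_map, Hy.
Qed.

Lemma partition_list {T} (D D1 D2 : T -> Prop) l :
  (forall x, D x -> D1 x \/ D2 x) -> Forall D l ->
  exists l1 l2, Permutation l (l1 ++ l2) /\ Forall D1 l1 /\ Forall D2 l2.
Proof.
  intros H; induction l as [|x l IH]; intros HD.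
  - exists nil, nil; repeat split; auto.
  - inversion HD; subst. destruct IH as (l1 & l2 & Hp & H4 & H5); trivial.
    destruct (H x H2).
    + exists (x :: l1), l2; repeat split; auto. simpl; now constructor.
    + exists l1, (x :: l2); repeat split; auto.
      rewrite <- Permutation_middle. now constructor.
Qed.

Lemma has_Csum_union {T} (D D1 D2 : T -> Prop) f s1 s2 :
  (forall x, D x <-> D1 x \/ D2 x) -> (forall x, D1 x -> D2 x -> False) ->
  has_Csum D1 f s1 -> has_Csum D2 f s2 -> has_Csum D f (s1 + s2)%C.
Proof.
  intros HD Hdisj Hf Hg eps He.
  destruct (Hf (eps/2)) as (l1 & H1 & H2 & H3); [lra|].
  destruct (Hg (eps/2)) as (l2 & H4 & H5 & H6); [lra|].
  destruct (classical_nodup (l1 ++ l2)) as (l0 & Hn & Hi1 & Hi2).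
  exists l0; split; [trivial|]; split.
  { apply (Forall_incl D (l1 ++ l2)); trivial. apply Forall_app; split.
    - eapply Forall_impl; [|apply H2]. intros a Ha; apply HD; auto.
    - eapply Forall_impl; [|apply H5]. intros a Ha; apply HD; auto. }
  intros l Hnl HDl Hi.
  destruct (partition_list D D1 D2 l) as (r1 & r2 & Hp & Hr1 & Hr2); trivial.
  { intros x; apply HD. }
  assert (Hn12 : NoDup (r1 ++ r2)) by (eapply Permutation_NoDup; eauto).
  rewrite (Csum_list_perm f _ _ Hp), Csum_list_app.
  replace (_ - _)%C with ((Csum_list f r1 - s1) + (Csum_list f r2 - s2))%C by ring.
  eapply Rle_lt_trans; [apply Cmod_triangle|].
  rewrite Forall_forall in *.
  assert (forall x, In x (l1 ++ l2) -> In x r1 \/ In x r2).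
  { intros x Hx. apply in_app_or. apply (Permutation_in _ Hp); auto. }
  assert (Cmod (Csum_list f r1 - s1) < eps/2).
  { apply H3.
    - now apply NoDup_app_remove_r in Hn12.
    - now apply Forall_forall.
    - intros x Hx. destruct (H x); [apply in_or_app; auto|trivial|].
      exfalso; eapply Hdisj; eauto. }
  assert (Cmod (Csum_list f r2 - s2) < eps/2).
  { apply H6.
    - now apply NoDup_app_remove_l in Hn12.
    - now apply Forall_forall.
    - intros x Hx. destruct (H x); [apply in_or_app; auto| |trivial].
      exfalso; eapply Hdisj; eauto. }
  lra.
Qed.

(** All numerical estimates of series go through this lemma: a few main terms are
    kept exactly, and finite sums of moduli of the others are bounded. *)
Lemma has_Csum_main_terms {T} (D : T -> Prop) f s l0 M :
  has_Csum D f s -> NoDup l0 -> Forall D l0 ->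
  (forall r, NoDup r -> Forall D r -> (forall x, In x r -> ~ In x l0) ->
     Rsum_list (fun x => Cmod (f x)) r <= M) ->
  Cmod (s - Csum_list f l0) <= M.
Proof.
  intros Hs Hn0 HD0 HM. apply Rnot_lt_le; intros Hlt.
  destruct (Hs (Cmod (s - Csum_list f l0) - M)) as (l1 & H1 & H2 & H3); [lra|].
  destruct (classical_nodup (l0 ++ l1)) as (l & Hn & Hi1 & Hi2).
  assert (HD : Forall D l).
  { apply (Forall_incl D (l0 ++ l1)); trivial. now apply Forall_app. }
  assert (Hl := H3 l Hn HD (fun x Hx => Hi1 x (in_or_app _ _ _ (or_intror Hx)))).
  destruct (NoDup_incl_Permutation_app l0 l Hn0) as [r Hr].
  { intros x Hx; apply Hi1, in_or_app; auto. }
  assert (Hn' := Permutation_NoDup Hr Hn).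
  rewrite (Csum_list_perm f _ _ Hr), Csum_list_app in Hl.
  assert (Hrb : Rsum_list (fun x => Cmod (f x)) r <= M).
  { apply HM.
    - now apply NoDup_app_remove_l in Hn'.
    - rewrite Forall_forall in *. intros x Hx; apply HD.
      eapply Permutation_in; [symmetry; apply Hr|]; apply in_or_app; auto.
    - intros x Hx Hx0. destruct (in_split _ _ Hx) as (r1 & r2 & ->).
      rewrite app_assoc in Hn'. apply NoDup_remove_2 in Hn'.
      apply Hn'. apply in_or_app; left; apply in_or_app; auto. }
  assert (Hrc := Csum_list_Cmod_le f r).
  assert (Htri := Cmod_triangle (Csum_list f r)
                    (- (Csum_list f l0 + Csum_list f r - s))).
  rewrite Cmod_opp in Htri.
  replace (Csum_list f r + - (Csum_list f l0 + Csum_list f r - s))%C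
    with (s - Csum_list f l0)%C in Htri by ring.
  lra.
Qed.

Lemma has_Csum_Cmod_le {T} (D : T -> Prop) f s M :
  has_Csum D f s -> abs_bounded D f M -> Cmod s <= M.
Proof.
  intros Hs HM. replace s with (s - Csum_list f nil)%C.
  - apply (has_Csum_main_terms D f s nil M); trivial.
    + constructor.
    + intros r H1 H2 _; now apply HM.
  - unfold Csum_list; simpl; ring.
Qed.

(** * Compactness in the plane *)

Definition near (z : C) (P : C -> Prop) : Prop :=
  exists r, 0 < r /\ forall w, Cmod (w - z) < r -> P w.

Lemma near_and z (P Q : C -> Prop) :
  near z P -> near z Q -> near z (fun w => P w /\ Q w).
Proof.
  intros (r & Hr & HP) (s & Hs & HQ). exists (Rmin r s); split.
  - now apply Rmin_glb_lt.
  - intros w Hw; split; [apply HP|apply HQ]; eapply Rlt_le_trans; eauto;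
      [apply Rmin_l|apply Rmin_r].
Qed.

Lemma near_mono z (P Q : C -> Prop) : (forall w, P w -> Q w) -> near z P -> near z Q.
Proof. intros H (r & Hr & HP). exists r; split; auto. Qed.

Definition cont_at (u : C -> R) (z : C) : Prop :=
  forall e, 0 < e -> near z (fun w => Rabs (u w - u z) < e).

(** A property that holds locally with some margin [e] holds with a uniform
    margin on a square: the form of compactness from which boundedness,
    attained maxima and uniform lower bounds are all read off. *)
Lemma compact_uniform (L : R) (Q : C -> R -> Prop) :
  (forall z e e', 0 < e' <= e -> Q z e -> Q z e') ->
  (forall t, exists e, 0 < e /\ near t (fun w => Q w e)) ->
  exists e, 0 < e /\
    forall z, Rabs (Re z) <= L -> Rabs (Im z) <= L -> Q z e.
Proof.
  intros Hmono Hloc.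
  assert (Hd : forall t : C, exists d : posreal, 
             forall w, Rabs (Re w - Re t) < d -> Rabs (Im w - Im t) < d -> Q w d).
  { intros t. destruct (Hloc t) as (e & He & r & Hr & HQ).
    assert (Hm : 0 < Rmin e (r / 2)) by (apply Rmin_glb_lt; lra).
    exists (mkposreal _ Hm); simpl. intros w H1 H2.
    apply (Hmono w e); [split; [trivial|apply Rmin_l]|]. apply HQ.
    eapply Rle_lt_trans; [apply Cmod_2Rmax|].
    assert (sqrt 2 < 2).
    { rewrite <- (sqrt_square 2) at 2 by lra. apply sqrt_lt_1; lra. }
    assert (0 <= sqrt 2) by apply sqrt_pos.
    assert (Hb : Rmax (Rabs (fst (w - t)%C)) (Rabs (snd (w - t)%C)) < r / 2).
    { assert (Hmr := Rmin_r e (r/2)). unfold Re, Im in *.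
      apply Rmax_lub_lt; simpl; unfold Rminus in *; lra. }
    assert (0 <= Rmax (Rabs (fst (w - t)%C)) (Rabs (snd (w - t)%C))).
    { eapply Rle_trans; [|apply Rmax_l]; apply Rabs_pos. }
    nra. }
  pose (delta := fun u v : R =>
    proj1_sig (constructive_indefinite_description _ (Hd (u, v)))).
  destruct (compactness_value_2d (-L) L (-L) L delta) as [d Hcov].
  exists d; split; [apply cond_pos|]. intros z H1 H2.
  apply Rabs_le_between in H1. apply Rabs_le_between in H2.
  destruct (NNPP _ (Hcov (Re z) (Im z) H1 H2)) as (u & v & _ & _ & H3 & H4 & H5).
  unfold delta in *. destruct constructive_indefinite_description as [d' Hd'].
  simpl in *. apply (Hmono z d'); [split; [apply cond_pos|trivial]|]. now apply Hd'.
Qed.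

Definition closed_set (K : C -> Prop) : Prop :=
  forall z, ~ K z -> near z (fun w => ~ K w).

Definition in_box (L : R) (K : C -> Prop) : Prop :=
  forall z, K z -> Rabs (Re z) <= L /\ Rabs (Im z) <= L.

Lemma compact_uniform_on L K (Q : C -> R -> Prop) :
  closed_set K -> in_box L K ->
  (forall z e e', 0 < e' <= e -> Q z e -> Q z e') ->
  (forall t, K t -> exists e, 0 < e /\ near t (fun w => K w -> Q w e)) ->
  exists e, 0 < e /\ forall z, K z -> Q z e.
Proof.
  intros Hc Hb Hm Hl.
  destruct (compact_uniform L (fun z e => K z -> Q z e)) as (e & He & HQ).
  - intros z e e' He HQ Hz. apply (Hm z e); auto.
  - intros t. destruct (classic (K t)) as [Ht|Ht]; auto.
    exists 1; split; [lra|]. generalize (Hc t Ht). apply near_mono. tauto.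
  - exists e; split; trivial. intros z Hz. destruct (Hb z Hz). auto.
Qed.

Lemma max_attained L K (u : C -> R) :
  closed_set K -> in_box L K -> (exists z, K z) ->
  (forall z, K z -> cont_at u z) ->
  exists z, K z /\ forall w, K w -> u w <= u z.
Proof.
  intros Hc Hb [z0 Hz0] Hu.
  destruct (compact_uniform_on L K (fun z e => u z <= / e)) as (e & He & Hbd); trivial.
  { intros z e e' [H1 H2] H. eapply Rle_trans; [apply H|]. now apply Rinv_le_contravar. }
  { intros t Ht. exists (/ (Rabs (u t) + 1)). assert (Hp := Rabs_pos (u t)). split.
    - apply Rinv_0_lt_compat; lra.
    - generalize (Hu t Ht 1 Rlt_0_1). apply near_mono. intros w Hw _.
      rewrite Rinv_inv. apply Rabs_lt_between in Hw.
      assert (Hq := Rle_abs (u t)). lra. }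
  destruct (completeness (fun x => exists z, K z /\ x = u z)) as [S [HS1 HS2]].
  { exists (/ e). intros x (z & Hz & ->); auto. }
  { now exists (u z0), z0. }
  apply NNPP; intros Hno.
  assert (Hlt : forall z, K z -> u z < S).
  { intros z Hz. destruct (HS1 (u z)) as [H|H]; [now exists z|trivial|].
    exfalso; apply Hno; exists z; split; trivial. intros w Hw.
    rewrite H. apply HS1. now exists w. }
  destruct (compact_uniform_on L K (fun z e => u z <= S - e)) as (e' & He' & Hbd'); trivial.
  { intros; lra. }
  { intros t Ht. specialize (Hlt t Ht). exists ((S - u t) / 2); split; [lra|].
    assert (Hp : 0 < (S - u t) / 2) by lra.
    generalize (Hu t Ht _ Hp). apply near_mono. intros w Hw _.
    apply Rabs_lt_between in Hw. lra. }
  assert (S <= S - e') by (apply HS2; intros x (z & Hz & ->); auto). lra.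
Qed.

(** * The maximum modulus principle *)

(** Holomorphy enters only through second order Taylor expansions with a cubic
    remainder: they are what the four point averages below consume, and they
    are inherited by series from a uniform estimate of the terms. *)
Definition taylor_at (g : C -> C) (z a b : C) : Prop :=
  exists M r, 0 <= M /\ 0 < r /\ forall h, Cmod h < r ->
    Cmod (g (z + h)%C - (g z + a * h + b * h * h)) <= M * Cmod h ^ 3.

Definition taylor2 (g : C -> C) (z : C) : Prop := exists a b, taylor_at g z a b.

Lemma taylor2_const c z : taylor2 (fun _ => c) z.
Proof.
  exists 0, 0, 0, 1. repeat split; try lra. intros h _.
  replace (_ - _)%C with (RtoC 0) by ring. rewrite Cmod_0; lra.
Qed.

Lemma taylor_at_mult g k z a b a' b' :
  taylor_at g z a b -> taylor_at k z a' b' ->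
  taylor_at (fun w => g w * k w)%C z (a * k z + g z * a')%C
    (b * k z + a * a' + g z * b')%C.
Proof.
  intros (M & r & HM & Hr & Hg) (M' & r' & HM' & Hr' & Hk).
  set (A := Cmod (g z) + Cmod a + Cmod b).
  set (A' := Cmod (k z) + Cmod a' + Cmod b' + M').
  set (E := Cmod (a * b' + b * a') + Cmod (b * b')).
  assert (P0 := Cmod_ge_0 (g z)). assert (P1 := Cmod_ge_0 a). assert (P2 := Cmod_ge_0 b).
  assert (P3 := Cmod_ge_0 (k z)). assert (P4 := Cmod_ge_0 a'). assert (P5 := Cmod_ge_0 b').
  assert (P6 := Cmod_ge_0 (a * b' + b * a')). assert (P7 := Cmod_ge_0 (b * b')).
  exists (E + A * M' + M * A'), (Rmin 1 (Rmin r r')). repeat split.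
  - unfold E, A, A'; nra.
  - repeat apply Rmin_glb_lt; lra.
  - intros h Hh.
    assert (H1 : Cmod h < 1) by (eapply Rlt_le_trans; [apply Hh|apply Rmin_l]).
    assert (H2 : Cmod h < Rmin r r') by (eapply Rlt_le_trans; [apply Hh|apply Rmin_r]).
    assert (H3 : Cmod h < r) by (eapply Rlt_le_trans; [apply H2|apply Rmin_l]).
    assert (H4 : Cmod h < r') by (eapply Rlt_le_trans; [apply H2|apply Rmin_r]).
    specialize (Hg h H3). specialize (Hk h H4).
    set (G := g (z + h)%C) in *. set (X := k (z + h)%C) in *.
    set (p := (g z + a * h + b * h * h)%C) in *.
    set (q := (k z + a' * h + b' * h * h)%C) in *.
    set (t := Cmod h) in *.
    assert (P8 : 0 <= t) by apply Cmod_ge_0.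
    assert (T2 : t ^ 2 <= 1) by nra.
    assert (T3 : t ^ 3 <= 1) by (simpl in *; nra).
    assert (T30 : 0 <= t ^ 3) by (apply pow_le; trivial).
    assert (Hp : Cmod p <= A).
    { unfold p, A. eapply Rle_trans; [apply Cmod_triangle|].
      eapply Rle_trans; [apply Rplus_le_compat_r, Cmod_triangle|].
      rewrite !Cmod_mult. fold t. nra. }
    assert (HX : Cmod X <= A').
    { replace X with (k z + a' * h + b' * h * h + (X - q))%C by (unfold q; ring).
      eapply Rle_trans; [apply Cmod_triangle|].
      eapply Rle_trans; [apply Rplus_le_compat_r, Cmod_triangle|].
      eapply Rle_trans; [apply Rplus_le_compat_r, Rplus_le_compat_r, Cmod_triangle|].
      rewrite !Cmod_mult. fold t. unfold A'.
      assert (M' * t ^ 3 <= M') by nra. nra. }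
    replace (_ - _)%C with
      ((a * b' + b * a') * h * h * h + (b * b') * h * h * h * h
        + p * (X - q) + (G - p) * X)%C by (unfold p, q; ring).
    eapply Rle_trans; [apply Cmod_triangle|].
    eapply Rle_trans; [apply Rplus_le_compat_r, Cmod_triangle|].
    eapply Rle_trans; [apply Rplus_le_compat_r, Rplus_le_compat_r, Cmod_triangle|].
    rewrite (Cmod_mult p), (Cmod_mult (G - p)).
    rewrite !(Cmod_mult _ h). fold t.
    assert (Cmod p * Cmod (X - q) <= A * (M' * t ^ 3)).
    { apply Rmult_le_compat; trivial; apply Cmod_ge_0. }
    assert (Cmod (G - p) * Cmod X <= (M * t ^ 3) * A').
    { apply Rmult_le_compat; trivial; apply Cmod_ge_0. }
    assert (Cmod (b * b') * t * t * t * t <= Cmod (b * b') * t ^ 3).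
    { replace (Cmod (b * b') * t * t * t * t) with (Cmod (b * b') * t ^ 3 * t) by ring.
      assert (0 <= Cmod (b * b') * t ^ 3) by (apply Rmult_le_pos; trivial). nra. }
    unfold E. nra.
Qed.

Lemma taylor2_mult g k z : taylor2 g z -> taylor2 k z -> taylor2 (fun w => g w * k w)%C z.
Proof.
  intros (a & b & H) (a' & b' & H'). do 2 eexists. eapply taylor_at_mult; eauto.
Qed.

Lemma taylor_at_plus_const g z a b c :
  taylor_at g z a b -> taylor_at (fun w => g w + c)%C z a b.
Proof.
  intros (M & r & HM & Hr & Hg). exists M, r; repeat split; trivial.
  intros h Hh. replace (_ - _)%C with (g (z + h)%C - (g z + a * h + b * h * h))%C by ring.
  auto.
Qed.

Lemma taylor2_sub_const p z : taylor2 (fun w => w - p)%C z.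
Proof.
  exists 1, 0, 0, 1. repeat split; try lra. intros h _.
  replace (_ - _)%C with (RtoC 0) by ring. rewrite Cmod_0; lra.
Qed.

Lemma taylor_at_lipschitz g z a b :
  taylor_at g z a b -> exists L r, 0 <= L /\ 0 < r /\
    forall w, Cmod (w - z) < r -> Cmod (g w - g z) <= L * Cmod (w - z).
Proof.
  intros (M & r & HM & Hr & Hg).
  assert (P1 := Cmod_ge_0 a). assert (P2 := Cmod_ge_0 b).
  exists (Cmod a + Cmod b + M), (Rmin 1 r). repeat split.
  - lra.
  - apply Rmin_glb_lt; lra.
  - intros w Hh.
    assert (H1 : Cmod (w - z) < 1) by (eapply Rlt_le_trans; [apply Hh|apply Rmin_l]).
    assert (H2 : Cmod (w - z) < r) by (eapply Rlt_le_trans; [apply Hh|apply Rmin_r]).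
    specialize (Hg _ H2). replace (z + (w - z))%C with w in Hg by ring.
    set (h := (w - z)%C) in *. set (t := Cmod h) in *.
    assert (P8 : 0 <= t) by apply Cmod_ge_0.
    replace (g w - g z)%C with
      (a * h + b * h * h + (g w - (g z + a * h + b * h * h)))%C by ring.
    eapply Rle_trans; [apply Cmod_triangle|].
    eapply Rle_trans; [apply Rplus_le_compat_r, Cmod_triangle|].
    rewrite !Cmod_mult. fold t.
    assert (t * t <= t) by nra. assert (t ^ 3 <= t) by (simpl; nra).
    assert (Cmod b * t * t <= Cmod b * t) by nra.
    assert (M * t ^ 3 <= M * t) by nra. lra.
Qed.

Lemma taylor2_continuous g z e :
  taylor2 g z -> 0 < e -> near z (fun w => Cmod (g w - g z) < e).
Proof.
  intros (a & b & H) He. destruct (taylor_at_lipschitz _ _ _ _ H) as (L & r & HL & Hr & Hg).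
  exists (Rmin r (e / (L + 1))). split.
  - apply Rmin_glb_lt; trivial. apply Rdiv_lt_0_compat; lra.
  - intros w Hw.
    assert (H1 : Cmod (w - z) < r) by (eapply Rlt_le_trans; [apply Hw|apply Rmin_l]).
    assert (H2 : Cmod (w - z) < e / (L + 1)) by (eapply Rlt_le_trans; [apply Hw|apply Rmin_r]).
    specialize (Hg w H1). assert (P := Cmod_ge_0 (w - z)).
    apply Rmult_lt_compat_r with (r := L + 1) in H2; [|lra].
    unfold Rdiv in H2. rewrite Rmult_assoc, Rinv_l in H2 by lra. nra.
Qed.

Lemma Cmod_triangle_rev x y : Cmod x - Cmod y <= Cmod (x + y).
Proof.
  assert (H := Cmod_triangle (x + y) (- y)). rewrite Cmod_opp in H.
  replace (x + y + - y)%C with x in H by ring. lra.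
Qed.

Lemma taylor2_inv (g : C -> C) z : g z <> RtoC 0 -> taylor2 g z -> taylor2 (fun w => / g w)%C z.
Proof.
  intros H0 (a & b & Hg).
  set (i0 := (/ g z)%C). set (i1 := (- a / (g z * g z))%C).
  set (i2 := ((a * a - g z * b) / (g z * g z * g z))%C).
  exists i1, i2.
  assert (Hi : taylor_at (fun w => i0 + i1 * (w - z) + i2 * (w - z) * (w - z))%C z i1 i2).
  { exists 0, 1. repeat split; try lra. intros h _.
    match goal with |- Cmod ?x <= _ => replace x with (RtoC 0) by ring end.
    rewrite Cmod_0; lra. }
  destruct (taylor_at_mult _ _ _ _ _ _ _ Hg Hi) as (M & r & HM & Hr & Hp).
  assert (Hpos : 0 < Cmod (g z)) by (apply Cmod_gt_0; trivial).
  destruct (taylor2_continuous g z (Cmod (g z) / 2)) as (r' & Hr' & Hc).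
  { now exists a, b. } { lra. }
  exists (2 * M / Cmod (g z)), (Rmin r r'). repeat split.
  - apply Rmult_le_pos; [lra|]. left; now apply Rinv_0_lt_compat.
  - now apply Rmin_glb_lt.
  - intros h Hh.
    assert (H2 : Cmod h < r) by (eapply Rlt_le_trans; [apply Hh|apply Rmin_l]).
    assert (H3 : Cmod h < r') by (eapply Rlt_le_trans; [apply Hh|apply Rmin_r]).
    specialize (Hp h H2). simpl in Hp.
    assert (Hgz : Cmod (g z) / 2 <= Cmod (g (z + h)%C)).
    { assert (Hq := Hc (z + h)%C). replace (z + h - z)%C with h in Hq by ring.
      specialize (Hq H3). assert (Ht := Cmod_triangle_rev (g z) (g (z + h)%C - g z)).
      replace (g z + (g (z + h)%C - g z))%C with (g (z + h)%C) in Ht by ring. lra. }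
    assert (Hn : g (z + h)%C <> 0) by (apply Cmod_gt_0; lra).
    set (X := (i0 + i1 * h + i2 * h * h)%C).
    assert (E : Cmod (g (z + h)%C * X - 1) <= M * Cmod h ^ 3).
    { eapply Rle_trans; [|apply Hp]. right. f_equal. unfold X, i0, i1, i2. field. trivial. }
    replace (/ g (z + h)%C - (/ g z + i1 * h + i2 * h * h))%C
      with (- (g (z + h)%C * X - 1) / g (z + h)%C)%C.
    2:{ unfold X, i0. field. split; trivial. }
    rewrite Cmod_div, Cmod_opp by trivial.
    unfold Rdiv. rewrite Rmult_assoc, (Rmult_comm (/ Cmod (g z))), <- Rmult_assoc.
    assert (/ Cmod (g (z + h)%C) <= 2 * / Cmod (g z)).
    { replace (2 * / Cmod (g z)) with (/ (Cmod (g z) / 2)) by (field; lra).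
      apply Rinv_le_contravar; lra. }
    replace (2 * M * Cmod h ^ 3 * / Cmod (g z))
      with (M * Cmod h ^ 3 * (2 * / Cmod (g z))) by ring.
    apply Rmult_le_compat; trivial; [apply Cmod_ge_0|].
    left; apply Rinv_0_lt_compat; lra.
Qed.

Lemma taylor2_pow g z n : taylor2 g z -> taylor2 (fun w => g w ^ n)%C z.
Proof.
  intros H; induction n; simpl; [apply taylor2_const|]. now apply taylor2_mult.
Qed.

Lemma Cmod2_plus_ge p q : Cmod p ^ 2 - 2 * Cmod p * Cmod q <= Cmod (p + q) ^ 2.
Proof.
  assert (H := Cmod_triangle_rev p q). assert (H1 := Cmod_ge_0 p).
  assert (H2 := Cmod_ge_0 q). assert (H3 := Cmod_ge_0 (p + q)).
  destruct (Rle_dec (Cmod p) (Cmod q)); nra.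
Qed.

(** The four points [z + i^j rho]: first and second order terms average out, so
    [|g|^2] is subharmonic up to a cubic error. *)
Lemma taylor2_four_points g z : taylor2 g z -> exists M r, 0 <= M /\ 0 < r /\
  forall rho, 0 < rho < r ->
    4 * Cmod (g z) ^ 2 - M * rho ^ 3 <=
      Cmod (g (z + rho)%C) ^ 2 + Cmod (g (z + Ci * rho)%C) ^ 2 +
      (Cmod (g (z + - rho)%C) ^ 2 + Cmod (g (z + - (Ci * rho))%C) ^ 2).
Proof.
  intros (a & b & M & r & HM & Hr & Hg).
  assert (P0 := Cmod_ge_0 (g z)). assert (P1 := Cmod_ge_0 a). assert (P2 := Cmod_ge_0 b).
  set (A := Cmod (g z) + Cmod a + Cmod b).
  exists (8 * A * M), (Rmin 1 r). repeat split.
  - unfold A; nra.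
  - apply Rmin_glb_lt; lra.
  - intros rho [H0 H1].
    assert (H2 : rho < 1) by (eapply Rlt_le_trans; [apply H1|apply Rmin_l]).
    assert (H3 : rho < r) by (eapply Rlt_le_trans; [apply H1|apply Rmin_r]).
    pose (p := fun h => (g z + a * h + b * h * h)%C).
    assert (Hone : forall h, Cmod h = rho ->
      Cmod (p h) ^ 2 - 2 * A * M * rho ^ 3 <= Cmod (g (z + h)%C) ^ 2).
    { intros h Hh. assert (Hgh := Hg h). rewrite Hh in Hgh. specialize (Hgh H3).
      fold (p h) in Hgh.
      assert (H4 := Cmod2_plus_ge (p h) (g (z + h)%C - p h)).
      replace (p h + (g (z + h)%C - p h))%C with (g (z + h)%C) in H4 by ring.
      assert (Hp : Cmod (p h) <= A).
      { unfold p, A. eapply Rle_trans; [apply Cmod_triangle|].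
        eapply Rle_trans; [apply Rplus_le_compat_r, Cmod_triangle|].
        rewrite !Cmod_mult, Hh.
        assert (rho * rho <= 1) by nra. assert (Cmod b * rho * rho <= Cmod b) by nra.
        nra. }
      assert (Cmod (p h) * Cmod (g (z + h)%C - p h) <= A * (M * rho ^ 3)).
      { apply Rmult_le_compat; trivial; apply Cmod_ge_0. }
      lra. }
    assert (Hsum : 4 * Cmod (g z) ^ 2 <= Cmod (p rho) ^ 2 + Cmod (p (Ci * rho)%C) ^ 2
              + (Cmod (p (- rho)%C) ^ 2 + Cmod (p (- (Ci * rho))%C) ^ 2)).
    { rewrite !Cmod2_alt. unfold p.
      destruct (g z) as [g1 g2], a as [a1 a2], b as [b1 b2]. unfold Re, Im; simpl.
      match goal with |- ?x <= ?y => replace y with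
        (x + 4 * (rho ^ 2 * (a1 ^ 2 + a2 ^ 2) + rho ^ 4 * (b1 ^ 2 + b2 ^ 2))) by ring end.
      enough (0 <= rho ^ 2 * (a1 ^ 2 + a2 ^ 2) + rho ^ 4 * (b1 ^ 2 + b2 ^ 2)) by lra.
      apply Rplus_le_le_0_compat; apply Rmult_le_pos; try (apply pow_le; lra); nra. }
    assert (Cr : Cmod rho = rho) by (rewrite Cmod_R; apply Rabs_pos_eq; lra).
    assert (Ir : Cmod (Ci * rho) = rho) by (rewrite Cmod_mult, Cmod_Ci, Cr; ring).
    assert (E1 := Hone rho Cr). assert (E2 := Hone (Ci * rho)%C Ir).
    assert (E3 := Hone (- rho)%C). rewrite Cmod_opp in E3. specialize (E3 Cr).
    assert (E4 := Hone (- (Ci * rho))%C). rewrite Cmod_opp in E4. specialize (E4 Ir).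
    lra.
Qed.

Lemma cont_at_Cmod2 g z : taylor2 g z -> cont_at (fun w => Cmod (g w) ^ 2) z.
Proof.
  intros Hg e He. assert (P := Cmod_ge_0 (g z)).
  set (d := Rmin 1 (e / (2 * Cmod (g z) + 1))).
  assert (Hd : 0 < d).
  { apply Rmin_glb_lt; [lra|]. apply Rdiv_lt_0_compat; lra. }
  generalize (taylor2_continuous g z d Hg Hd). apply near_mono. intros w Hw.
  assert (H1 : d <= 1) by apply Rmin_l.
  assert (H2 : d * (2 * Cmod (g z) + 1) <= e).
  { assert (H := Rmin_r 1 (e / (2 * Cmod (g z) + 1))). fold d in H.
    apply Rmult_le_compat_r with (r := 2 * Cmod (g z) + 1) in H; [|lra].
    unfold Rdiv in H. rewrite Rmult_assoc, Rinv_l in H by lra. lra. }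
  assert (Q := Cmod_ge_0 (g w)).
  assert (Hab : Rabs (Cmod (g w) - Cmod (g z)) < d).
  { eapply Rle_lt_trans; [|apply Hw].
    assert (T1 := Cmod_triangle_rev (g w) (- (g w - g z))).
    assert (T2 := Cmod_triangle_rev (g z) (g w - g z)).
    rewrite Cmod_opp in T1.
    replace (g w + - (g w - g z))%C with (g z) in T1 by ring.
    replace (g z + (g w - g z))%C with (g w) in T2 by ring.
    assert (T3 := Cmod_triangle (g z) (g w - g z)).
    replace (g z + (g w - g z))%C with (g w) in T3 by ring.
    apply Rabs_le. lra. }
  replace (Cmod (g w) ^ 2 - Cmod (g z) ^ 2)
    with ((Cmod (g w) - Cmod (g z)) * (Cmod (g w) + Cmod (g z))) by ring.
  rewrite Rabs_mult, (Rabs_pos_eq (_ + _)) by lra.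
  apply Rabs_lt_between in Hab as Hab'.
  assert (Cmod (g w) + Cmod (g z) < 2 * Cmod (g z) + 1) by lra.
  assert (0 <= Rabs (Cmod (g w) - Cmod (g z))) by apply Rabs_pos.
  nra.
Qed.

Definition interior_or (K B : C -> Prop) : Prop :=
  forall z, K z -> B z \/ near z (fun w => K w /\ ~ B w).

(** The term [e |z|^2] makes the average over four points of
    [|g|^2 + e |z|^2] strictly larger than the value at their centre, so that no
    maximum can be interior. *)
Theorem maximum_modulus L K B g M :
  closed_set K -> in_box L K -> interior_or K B -> 0 <= M ->
  (forall z, K z -> taylor2 g z) -> (forall z, K z -> B z -> Cmod (g z) <= M) ->
  forall z, K z -> Cmod (g z) <= M.
Proof.
  intros Hc Hb Hi HM Hg HB z1 Hz1. apply Rnot_lt_le; intros Hlt.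
  assert (Hbd : forall z, K z -> Cmod z ^ 2 <= 2 * L ^ 2).
  { intros z Hz. destruct (Hb z Hz) as [H1 H2]. rewrite Cmod2_alt.
    rewrite <- (pow2_abs (Re z)), <- (pow2_abs (Im z)).
    assert (P1 := Rabs_pos (Re z)). assert (P2 := Rabs_pos (Im z)). nra. }
  set (gap := Cmod (g z1) ^ 2 - M ^ 2).
  assert (Hgap : 0 < gap) by (unfold gap; nra).
  set (e := gap / (2 * L ^ 2 + 1)).
  assert (He : 0 < e) by (apply Rdiv_lt_0_compat; nra).
  assert (HeL : e * (2 * L ^ 2) < gap).
  { assert (e * (2 * L ^ 2 + 1) = gap) by (unfold e; field; nra). lra. }
  pose (u := fun z => Cmod (g z) ^ 2 + e * Cmod z ^ 2).
  destruct (max_attained L K u) as (z & Hz & Hmax); trivial.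
  { now exists z1. }
  { intros z Hz d Hd.
    assert (Hid : taylor2 (fun w => w - 0)%C z) by apply taylor2_sub_const.
    assert (Hd1 : 0 < d / (2 * e)) by (apply Rdiv_lt_0_compat; lra).
    assert (Hd2 : 0 < d / 2) by lra.
    generalize (near_and z _ _ (cont_at_Cmod2 g z (Hg z Hz) _ Hd2)
                               (cont_at_Cmod2 _ z Hid _ Hd1)).
    apply near_mono. intros w [Hw1 Hw2]. unfold u.
    replace (w - 0)%C with w in Hw2 by ring. replace (z - 0)%C with z in Hw2 by ring.
    apply Rabs_lt_between in Hw1. apply Rabs_lt_between in Hw2.
    apply Rabs_lt_between.
    assert (Hed : e * (d / (2 * e)) = d / 2) by (field; lra).
    split; nra. }
  assert (Hu1 := Hmax z1 Hz1). unfold u in Hu1.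
  assert (Hz1p := Cmod_ge_0 z1). assert (Hgz := Cmod_ge_0 (g z)).
  destruct (Hi z Hz) as [HzB|(r & Hr & Hball)].
  - specialize (HB z Hz HzB). specialize (Hbd z Hz). unfold gap in *. nra.
  - destruct (taylor2_four_points g z (Hg z Hz)) as (M' & r' & HM' & Hr' & H4).
    set (rho := Rmin (r / 2) (Rmin (r' / 2) (e / (M' + 1)))).
    assert (Hrho : 0 < rho).
    { repeat apply Rmin_glb_lt; try lra. apply Rdiv_lt_0_compat; lra. }
    assert (Hrho1 : rho <= r / 2) by apply Rmin_l.
    assert (Hrho2 : rho <= Rmin (r' / 2) (e / (M' + 1))) by apply Rmin_r.
    assert (Hrho3 := Rmin_l (r' / 2) (e / (M' + 1))).
    assert (Hrho4 := Rmin_r (r' / 2) (e / (M' + 1))).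
    assert (Hrho5 : rho * (M' + 1) <= e).
    { apply Rle_trans with (e / (M' + 1) * (M' + 1)); [|right; field; lra].
      apply Rmult_le_compat_r; lra. }
    specialize (H4 rho ltac:(lra)).
    assert (Cr : Cmod rho = rho) by (rewrite Cmod_R; apply Rabs_pos_eq; lra).
    assert (Ir : Cmod (Ci * rho) = rho) by (rewrite Cmod_mult, Cmod_Ci, Cr; ring).
    assert (Hin : forall h, Cmod h = rho -> u (z + h)%C <= u z).
    { intros h Hh. apply Hmax, Hball. replace (z + h - z)%C with h by ring. lra. }
    assert (E1 := Hin rho Cr). assert (E2 := Hin (Ci * rho)%C Ir).
    assert (E3 := Hin (- rho)%C). rewrite Cmod_opp in E3. specialize (E3 Cr).
    assert (E4 := Hin (- (Ci * rho))%C). rewrite Cmod_opp in E4. specialize (E4 Ir).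
    assert (Hz4 : Cmod (z + rho) ^ 2 + Cmod (z + Ci * rho) ^ 2 +
       (Cmod (z + - rho) ^ 2 + Cmod (z + - (Ci * rho)) ^ 2) = 4 * Cmod z ^ 2 + 4 * rho ^ 2).
    { rewrite !Cmod2_alt. destruct z as [x y]. unfold Re, Im; simpl. ring. }
    unfold u in E1, E2, E3, E4.
    assert (4 * e * rho ^ 2 <= M' * rho ^ 3) by nra.
    assert (0 < rho ^ 2) by nra.
    assert (4 * e <= M' * rho).
    { apply Rmult_le_reg_r with (rho ^ 2); trivial. nra. }
    nra.
Qed.

Corollary minimum_modulus L K B (F : C -> C) m :
  closed_set K -> in_box L K -> interior_or K B -> 0 < m ->
  (forall z, K z -> taylor2 F z) -> (forall z, K z -> F z <> RtoC 0) ->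
  (forall z, K z -> B z -> m <= Cmod (F z)) ->
  forall z, K z -> m <= Cmod (F z).
Proof.
  intros Hc Hb Hi Hm HF H0 HB z Hz.
  assert (Hp : forall z, K z -> 0 < Cmod (F z)) by (intros; apply Cmod_gt_0; auto).
  assert (H : Cmod (/ F z) <= / m).
  { apply (maximum_modulus L K B (fun w => / F w)%C); trivial.
    - left; now apply Rinv_0_lt_compat.
    - intros w Hw; apply taylor2_inv; auto.
    - intros w Hw HwB. rewrite Cmod_inv by auto. apply Rinv_le_contravar; auto. }
  rewrite Cmod_inv in H by auto.
  apply Rinv_le_contravar in H; [|apply Rinv_0_lt_compat; auto].
  now rewrite !Rinv_inv in H.
Qed.

(** * Functions avoiding the negative real axis on the boundary *)

(** A function that stays away from the negative reals on the boundary, zeros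
    being permitted there, takes no negative real value inside: the most
    negative value [- t] would make [1 / (f + t + e)] too large. *)
Lemma avoids_negative_reals L K B f c :
  closed_set K -> in_box L K -> interior_or K B -> 0 < c ->
  (forall z, K z -> taylor2 f z) ->
  (forall z, K z -> B z -> forall d, 0 < d -> c * d <= Cmod (f z + RtoC d)) ->
  forall z d, K z -> 0 < d -> (f z + RtoC d)%C <> RtoC 0.
Proof.
  intros Hc Hb Hi Hc0 Hf HB z1 d1 Hz1 Hd1 E1.
  assert (Hval : forall z d, 0 < d -> (f z + RtoC d)%C = RtoC 0 -> Cmod (f z) = d).
  { intros z d Hd E. replace (f z) with (- RtoC d)%C.
    - rewrite Cmod_opp, Cmod_R. apply Rabs_pos_eq; lra.
    - replace (f z) with ((f z + d) - d)%C by ring. rewrite E; ring. }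
  destruct (max_attained L K (fun w => Cmod (f w) ^ 2)) as (zm & Hzm & Hmax); trivial.
  { now exists z1. }
  { intros; apply cont_at_Cmod2; auto. }
  destruct (completeness (fun d => 0 < d /\ exists z, K z /\ (f z + RtoC d)%C = RtoC 0))
    as [t [Ht1 Ht2]].
  { exists (Cmod (f zm)). intros d (Hd & z & Hz & E).
    rewrite <- (Hval z d Hd E). specialize (Hmax z Hz). simpl in Hmax.
    assert (P := Cmod_ge_0 (f z)). assert (P' := Cmod_ge_0 (f zm)). nra. }
  { exists d1; split; trivial; now exists z1. }
  assert (Ht : 0 < t).
  { apply Rlt_le_trans with d1; trivial. apply Ht1; split; trivial; now exists z1. }
  set (e := c * t / 2). assert (He : 0 < e) by (unfold e; nra).
  assert (Hmin : forall z, K z -> c * t <= Cmod (f z + RtoC (t + e))).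
  { apply (minimum_modulus L K B (fun z => f z + RtoC (t + e))%C); trivial.
    - nra.
    - intros z Hz. destruct (Hf z Hz) as (a & b & H). exists a, b.
      now apply taylor_at_plus_const.
    - intros z Hz E. assert (t + e <= t); [|lra].
      apply Ht1; split; [lra|]. now exists z.
    - intros z Hz HzB. specialize (HB z Hz HzB (t + e)). nra. }
  assert (t <= t - e); [|lra].
  apply Ht2. intros d (Hd & z & Hz & E). apply Rnot_lt_le; intros Hlt.
  specialize (Hmin z Hz).
  replace (f z + RtoC (t + e))%C with ((f z + d) + RtoC (t + e - d))%C in Hmin.
  2:{ rewrite RtoC_minus. ring. }
  rewrite E, Cplus_0_l, Cmod_R in Hmin.
  assert (d <= t) by (apply Ht1; split; trivial; now exists z).
  rewrite Rabs_pos_eq in Hmin by lra. unfold e in *; lra.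
Qed.

(** The factor [(z - p)^n] beats the constant [c]: if [f p <> 0] for some [p]
    much closer to [z0] than the boundary, then for large [n] and small [d] the
    minimum modulus principle fails at [z0] for [(f + d) (z - p)^n] outside a
    small disc around [p]. *)
Lemma interior_zero_spreads L K B f c :
  closed_set K -> in_box L K -> interior_or K B -> 0 < c ->
  (forall z, K z -> taylor2 f z) ->
  (forall z, K z -> B z -> forall d, 0 < d -> c * d <= Cmod (f z + RtoC d)) ->
  forall z0, K z0 -> ~ B z0 -> f z0 = RtoC 0 -> near z0 (fun w => f w = RtoC 0).
Proof.
  intros Hc Hb Hi Hc0 Hf HB z0 Hz0 HnB E0.
  destruct (Hi z0 Hz0) as [H|(r & Hr & Hball)]; [contradiction|].
  exists (r / 4); split; [lra|]. intros p Hp. apply NNPP; intros Hfp.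
  assert (Hfp0 : 0 < Cmod (f p)) by (apply Cmod_gt_0; trivial).
  assert (Hd : 0 < Cmod (z0 - p)).
  { apply Cmod_gt_0. intros H. apply Hfp. rewrite <- E0. f_equal.
    replace p with (z0 - (z0 - p))%C by ring. rewrite H; ring. }
  assert (Hdr : Cmod (z0 - p) < r / 4).
  { replace (z0 - p)%C with (- (p - z0))%C by ring. now rewrite Cmod_opp. }
  set (d := Cmod (z0 - p)) in *.
  assert (Hfar : forall z, K z -> B z -> 3 * d <= Cmod (z - p)).
  { intros z Hz HzB. assert (r <= Cmod (z - z0)).
    { apply Rnot_lt_le; intros Hlt. now destruct (Hball z Hlt). }
    assert (Htr := Cmod_triangle_rev (z - z0) (z0 - p)).
    replace (z - z0 + (z0 - p))%C with (z - p)%C in Htr by ring. fold d in Htr. lra. }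
  destruct (Hball p) as [HKp _]; [lra|].
  set (m := Cmod (f p) / 2) in *. assert (Hm : 0 < m) by (unfold m; lra).
  destruct (taylor2_continuous f p m (Hf p HKp) Hm) as (r0 & Hr0 & Hcont).
  set (rho := Rmin (r0 / 2) (d / 2)).
  assert (Hrho : 0 < rho) by (apply Rmin_glb_lt; lra).
  assert (Hrho1 : rho <= r0 / 2) by apply Rmin_l.
  assert (Hrho2 : rho <= d / 2) by apply Rmin_r.
  assert (Hcirc : forall w, Cmod (w - p) = rho -> m <= Cmod (f w)).
  { intros w Hw. specialize (Hcont w ltac:(lra)).
    assert (Htr := Cmod_triangle_rev (f p) (f w - f p)).
    replace (f p + (f w - f p))%C with (f w) in Htr by ring. unfold m in *; lra. }
  destruct (Pow_x_infinity 3 ltac:(rewrite Rabs_pos_eq; lra) (2 / c)) as [n Hn].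
  specialize (Hn n (le_n n)). rewrite Rabs_pos_eq in Hn by (apply pow_le; lra).
  assert (Hn' : 2 <= c * 3 ^ n).
  { apply Rge_le in Hn. apply Rmult_le_compat_l with (r := c) in Hn; [|lra].
    replace (c * (2 / c)) with 2 in Hn by (field; lra). lra. }
  assert (Hdn : 0 < d ^ n) by now apply pow_lt.
  assert (Hrn : 0 < rho ^ n) by now apply pow_lt.
  set (dl := Rmin (m / 2) (m * rho ^ n / (4 * d ^ n))).
  assert (Hdl : 0 < dl).
  { apply Rmin_glb_lt; [lra|]. apply Rdiv_lt_0_compat; nra. }
  assert (Hdl1 : dl <= m / 2) by apply Rmin_l.
  assert (Hdl2 : dl * d ^ n <= m * rho ^ n / 4).
  { assert (H := Rmin_r (m / 2) (m * rho ^ n / (4 * d ^ n))). fold dl in H.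
    apply Rmult_le_compat_r with (r := d ^ n) in H; [|lra].
    eapply Rle_trans; [apply H|]. right; field. lra. }
  set (mu := Rmin (c * dl * (3 * d) ^ n) (m / 2 * rho ^ n)).
  assert (Hmu : 0 < mu).
  { apply Rmin_glb_lt; [|nra]. apply Rmult_lt_0_compat; [nra|apply pow_lt; lra]. }
  assert (Hmin : mu <= Cmod ((f z0 + RtoC dl) * (z0 - p) ^ n)).
  { apply (minimum_modulus L (fun z => K z /\ rho <= Cmod (z - p))
             (fun z => B z \/ Cmod (z - p) = rho)
             (fun z => (f z + RtoC dl) * (z - p) ^ n)%C); trivial.
    - intros z Hz. destruct (classic (K z)) as [HK|HK].
      + assert (Hlt : Cmod (z - p) < rho) by (apply Rnot_le_lt; tauto).
        exists (rho - Cmod (z - p)); split; [lra|]. intros w Hw [_ H].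
        assert (Htr := Cmod_triangle (w - z) (z - p)).
        replace (w - z + (z - p))%C with (w - p)%C in Htr by ring. lra.
      + generalize (Hc z HK). apply near_mono. tauto.
    - intros z [HK _]. auto.
    - intros z [HK Hz]. destruct (Hi z HK) as [HzB|Hnear]; [left; now left|].
      destruct Hz as [Hz|Hz]; [|left; now right]. right.
      assert (Hn2 : near z (fun w => rho < Cmod (w - p))).
      { exists (Cmod (z - p) - rho); split; [lra|]. intros w Hw.
        assert (Htr := Cmod_triangle_rev (z - p) (w - z)).
        replace (z - p + (w - z))%C with (w - p)%C in Htr by ring. lra. }
      generalize (near_and _ _ _ Hnear Hn2). apply near_mono.
      intros w [[H1 H2] H3]. repeat split; trivial; [lra|]. intros [H|H]; [tauto|lra].
    - intros z [HK Hz]. apply taylor2_mult.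
      + destruct (Hf z HK) as (a & b & H). exists a, b. now apply taylor_at_plus_const.
      + apply (taylor2_pow (fun z => z - p)%C). apply taylor2_sub_const.
    - intros z [HK Hz]. apply Cmult_neq_0.
      + now apply (avoids_negative_reals L K B f c).
      + apply Cpow_nz, Cmod_gt_0. lra.
    - intros z [HK Hz] [HzB|HzC]; rewrite Cmod_mult, Cmod_pow.
      + apply Rle_trans with (c * dl * (3 * d) ^ n); [apply Rmin_l|].
        apply Rmult_le_compat.
        * nra.
        * apply pow_le; lra.
        * now apply HB.
        * apply pow_incr. split; [lra|]. now apply Hfar.
      + apply Rle_trans with (m / 2 * rho ^ n); [apply Rmin_r|].
        rewrite HzC. apply Rmult_le_compat_r; [lra|].
        specialize (Hcirc z HzC). assert (Htr := Cmod_triangle_rev (f z) (RtoC dl)).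
        rewrite Cmod_R, Rabs_pos_eq in Htr by lra. lra.
    - split; trivial. fold d. lra. }
  rewrite E0, Cplus_0_l, Cmod_mult, Cmod_pow, Cmod_R, Rabs_pos_eq in Hmin by lra.
  fold d in Hmin. revert Hmin. apply Rlt_not_le. apply Rmin_glb_lt.
  - rewrite Rpow_mult_distr.
    replace (c * dl * (3 ^ n * d ^ n)) with (c * 3 ^ n * (dl * d ^ n)) by ring.
    assert (0 < dl * d ^ n) by nra. nra.
  - nra.
Qed.

(** A zero that spreads along a vertical segment would reach its top. *)
Lemma zero_free_from_above f x y0 y1 :
  y0 <= y1 -> (forall y, y0 <= y <= y1 -> taylor2 f (x, y)) ->
  (forall y, y0 <= y < y1 -> f (x, y) = RtoC 0 -> near (x, y) (fun w => f w = RtoC 0)) ->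
  f (x, y1) <> RtoC 0 -> f (x, y0) <> RtoC 0.
Proof.
  intros Hy Hf Hn H1 H0.
  assert (Hdist : forall y y', Cmod ((x, y') - (x, y)) = Rabs (y' - y)).
  { intros y y'. replace ((x, y') - (x, y))%C with (Ci * RtoC (y' - y))%C.
    - rewrite Cmod_mult, Cmod_Ci, Cmod_R; ring.
    - apply injective_projections; simpl; ring. }
  destruct (completeness (fun y => y0 <= y <= y1 /\
              forall y', y0 <= y' <= y -> f (x, y') = RtoC 0)) as [s [Hs1 Hs2]].
  { exists y1; intros y [Hy' _]; lra. }
  { exists y0; split; [lra|]. intros y' Hy'. now replace y' with y0 by lra. }
  assert (Hs0 : y0 <= s).
  { apply Hs1; split; [lra|]. intros y' Hy'. now replace y' with y0 by lra. }
  assert (Hs3 : s <= y1) by (apply Hs2; intros y [Hy' _]; lra).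
  assert (Hbelow : forall y, y0 <= y < s -> f (x, y) = RtoC 0).
  { intros y Hys. apply NNPP; intros Hne. assert (s <= y); [|lra].
    apply Hs2. intros y' [Hy' Hall]. apply Rnot_lt_le; intros Hlt.
    apply Hne, Hall; lra. }
  assert (Es : f (x, s) = RtoC 0).
  { destruct (Rle_lt_or_eq_dec y0 s Hs0) as [Hlt|<-]; [|trivial].
    apply NNPP; intros Hne. assert (Hp : 0 < Cmod (f (x, s))) by (apply Cmod_gt_0; trivial).
    destruct (taylor2_continuous f (x, s) _ (Hf s ltac:(lra)) Hp) as (r & Hr & Hcont).
    set (y := Rmax y0 (s - r / 2)).
    assert (y0 <= y) by apply Rmax_l. assert (s - r / 2 <= y) by apply Rmax_r.
    assert (y < s) by (apply Rmax_lub_lt; lra).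
    specialize (Hcont (x, y)). rewrite Hdist, Hbelow in Hcont by lra.
    replace (RtoC 0 - f (x, s))%C with (- f (x, s))%C in Hcont by ring.
    rewrite Cmod_opp in Hcont. rewrite Rabs_left in Hcont by lra.
    specialize (Hcont ltac:(lra)). lra. }
  assert (Hs4 : s < y1).
  { destruct (Rle_lt_or_eq_dec s y1 Hs3) as [|E]; [trivial|]. rewrite E in Es. contradiction. }
  destruct (Hn s ltac:(lra) Es) as (r & Hr & Hz).
  set (y := Rmin y1 (s + r / 2)).
  assert (y <= y1) by apply Rmin_l. assert (y <= s + r / 2) by apply Rmin_r.
  assert (s < y) by (apply Rmin_glb_lt; lra).
  assert (y <= s); [|lra].
  apply Hs1. split; [lra|]. intros y' Hy'.
  destruct (Rlt_le_dec y' s); [apply Hbelow; lra|].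
  apply Hz. rewrite Hdist, Rabs_pos_eq; lra.
Qed.

(** * Sums over integers and pairs of integers *)

Lemma Rsum_list_telescope (w H : Z -> R) n0 l :
  (forall n, (n0 <= n)%Z -> 0 <= w n <= H n - H (n + 1)%Z /\ 0 <= H n) ->
  NoDup l -> (forall n, In n l -> (n0 <= n)%Z) -> Rsum_list w l <= H n0.
Proof.
  intros Hw Hn Hl.
  assert (Hmax : exists N : nat, forall n, In n l -> (n < n0 + Z.of_nat N)%Z).
  { clear -Hl. induction l as [|a l IH].
    - exists 0%nat; intros n [].
    - destruct IH as [N HN]; [intros; apply Hl; now right|].
      exists (Nat.max N (Z.to_nat (a - n0 + 1))). intros n [->|H].
      + specialize (Hl n (or_introl eq_refl)). lia.
      + specialize (HN n H). lia. }
  destruct Hmax as [N HN].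
  pose (rng := fun N => map (fun i => (n0 + Z.of_nat i)%Z) (seq 0 N)).
  assert (Hrng : forall N, Rsum_list w (rng N) <= H n0 - H (n0 + Z.of_nat N)%Z).
  { clear -Hw. intros N; induction N as [|N IH].
    - unfold Rsum_list; simpl. rewrite Z.add_0_r; lra.
    - unfold rng. rewrite seq_S, map_app, Rsum_list_app. fold (rng N).
      change (map (fun i => (n0 + Z.of_nat i)%Z) (0 + N :: nil)%nat)
        with ((n0 + Z.of_nat N)%Z :: nil).
      unfold Rsum_list at 2. cbn [map fold_right]. destruct (Hw (n0 + Z.of_nat N)%Z) as [H1 _]; [lia|].
      replace (n0 + Z.of_nat N + 1)%Z with (n0 + Z.of_nat (S N))%Z in H1 by lia.
      lra. }
  apply Rle_trans with (Rsum_list w (rng N)).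
  - apply Rsum_list_incl; trivial.
    + intros n Hin. unfold rng. apply in_map_iff.
      exists (Z.to_nat (n - n0)). specialize (Hl n Hin). specialize (HN n Hin).
      split; [lia|]. apply in_seq. lia.
    + intros n Hin. apply in_map_iff in Hin. destruct Hin as (i & <- & _).
      apply Hw; lia.
  - specialize (Hrng N). destruct (Hw (n0 + Z.of_nat N)%Z) as [_ H1]; [lia|]. lra.
Qed.

Lemma Rsum_list_filter {T} (w : T -> R) (p : T -> bool) l :
  Rsum_list w l = Rsum_list w (filter p l) + Rsum_list w (filter (fun x => negb (p x)) l).
Proof.
  unfold Rsum_list; induction l; simpl; [ring|]. destruct (p a); simpl; lra.
Qed.

Lemma Rsum_list_const0 {T} (w : T -> R) l : (forall x, In x l -> w x = 0) -> Rsum_list w l = 0.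
Proof.
  unfold Rsum_list; induction l; simpl; intros H; [trivial|].
  rewrite (H a), IHl; auto; lra.
Qed.

Lemma Rsum_list_half_lines (w : Z -> R) w0 P Q l :
  (forall n, 0 <= w n) -> w 0%Z <= w0 ->
  (forall l, NoDup l -> (forall n, In n l -> (1 <= n)%Z) -> Rsum_list w l <= P) ->
  (forall l, NoDup l -> (forall n, In n l -> (1 <= n)%Z) ->
     Rsum_list (fun n => w (- n)%Z) l <= Q) ->
  NoDup l -> Rsum_list w l <= w0 + P + Q.
Proof.
  intros Hw H0 HP HQ Hn.
  rewrite (Rsum_list_filter w (Z.ltb 0)).
  rewrite (Rsum_list_filter w (Z.eqb 0) (filter (fun x => negb (Z.ltb 0 x)) l)).
  assert (H1 : Rsum_list w (filter (Z.ltb 0) l) <= P).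
  { apply HP; [now apply NoDup_filter|]. intros n H. apply filter_In in H.
    destruct H as [_ H]. apply Z.ltb_lt in H. lia. }
  set (l1 := filter (fun x => negb (Z.ltb 0 x)) l).
  assert (Hn1 : NoDup l1) by (apply NoDup_filter; trivial).
  assert (H2 : Rsum_list w (filter (Z.eqb 0) l1) <= w0).
  { apply Rle_trans with (Rsum_list w (0%Z :: nil)).
    - apply Rsum_list_incl; auto. + now apply NoDup_filter.
      + intros n H. apply filter_In in H. destruct H as [_ H].
        apply Z.eqb_eq in H. left; trivial.
    - unfold Rsum_list; simpl; lra. }
  assert (H3 : Rsum_list w (filter (fun x => negb (Z.eqb 0 x)) l1) <= Q).
  { set (l2 := filter _ l1).
    replace l2 with (map Z.opp (map Z.opp l2)).
    2:{ rewrite map_map. rewrite <- (map_id l2) at 2. apply map_ext. lia. }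
    rewrite Rsum_list_map. apply HQ.
    - apply FinFun.Injective_map_NoDup; [intros a b; lia|]. now apply NoDup_filter.
    - intros n H. apply in_map_iff in H. destruct H as (m & <- & H).
      unfold l2, l1 in H. rewrite !filter_In in H.
      destruct H as [[_ Ha] Hb]. apply Bool.negb_true_iff in Ha, Hb.
      apply Z.ltb_ge in Ha. apply Z.eqb_neq in Hb. lia. }
  lra.
Qed.

Lemma Rsum_list_rows (w : Z * Z -> R) (Rw : Z -> R) M l :
  (forall p, 0 <= w p) ->
  (forall b l, NoDup l -> Rsum_list (fun m => w (m, b)) l <= Rw b) ->
  (forall l, NoDup l -> Rsum_list Rw l <= M) ->
  NoDup l -> Rsum_list w l <= M.
Proof.
  intros Hw HR HM Hn.
  set (la := nodup Z.eq_dec (map fst l)). set (lb := nodup Z.eq_dec (map snd l)).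
  set (swap := fun p : Z * Z => (snd p, fst p)).
  apply Rle_trans with (Rsum_list w (map swap (list_prod lb la))).
  { apply Rsum_list_incl; auto.
    intros [a b] Hin. apply in_map_iff. exists (b, a); split; [trivial|].
    apply in_prod; apply nodup_In; apply in_map_iff; now exists (a, b). }
  apply Rle_trans with (Rsum_list Rw lb).
  2:{ apply HM, NoDup_nodup. }
  assert (Hna : NoDup la) by apply NoDup_nodup.
  clearbody la lb. rewrite Rsum_list_map. induction lb as [|b lb IH].
  - unfold Rsum_list; simpl; lra.
  - simpl. rewrite Rsum_list_app, Rsum_list_map. unfold swap at 1. simpl.
    unfold Rsum_list at 3; simpl. specialize (HR b la Hna).
    fold (Rsum_list Rw lb). lra.
Qed.

Lemma Rsum_list_product (p q : Z -> R) P Q l :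
  (forall n, 0 <= p n) -> (forall n, 0 <= q n) -> 0 <= P ->
  (forall l, NoDup l -> Rsum_list p l <= P) ->
  (forall l, NoDup l -> Rsum_list q l <= Q) ->
  NoDup l -> Rsum_list (fun x => p (fst x) * q (snd x)) l <= P * Q.
Proof.
  intros Hp Hq HP HPs HQs Hn.
  apply (Rsum_list_rows _ (fun b => P * q b)); trivial.
  - intros x; apply Rmult_le_pos; auto.
  - intros b l' Hl'. simpl.
    replace (Rsum_list (fun m => p m * q b) l') with (q b * Rsum_list p l').
    + specialize (HPs l' Hl'). specialize (Hq b). nra.
    + rewrite <- Rsum_list_scal. unfold Rsum_list; f_equal. apply map_ext.
      intros; ring.
  - intros l' Hl'. rewrite Rsum_list_scal. specialize (HQs l' Hl'). nra.
Qed.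

Lemma IZR_ge1 n : (1 <= n)%Z -> 1 <= IZR n.
Proof. intros H; apply IZR_le in H; trivial. Qed.

Lemma Rsum_list_inv_square l :
  NoDup l -> (forall n, In n l -> (1 <= n)%Z) -> Rsum_list (fun n => / IZR n ^ 2) l <= 2.
Proof.
  intros Hn Hl. apply Rle_trans with (2 / IZR 1); [|right; field].
  apply (Rsum_list_telescope _ (fun n => 2 / IZR n)); trivial.
  intros n H. apply IZR_ge1 in H. rewrite plus_IZR. repeat split.
  - left; apply Rinv_0_lt_compat; nra.
  - replace (2 / IZR n - 2 / (IZR n + 1)) with (2 / (IZR n * (IZR n + 1))) by (field; lra).
    apply Rmult_le_reg_r with (IZR n ^ 2 * (IZR n + 1)); [nra|].
    replace (/ IZR n ^ 2 * (IZR n ^ 2 * (IZR n + 1))) with (IZR n + 1) by (field; lra).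
    replace (2 / (IZR n * (IZR n + 1)) * (IZR n ^ 2 * (IZR n + 1))) with (2 * IZR n)
      by (field; lra). lra.
  - apply Rlt_le, Rdiv_lt_0_compat; lra.
Qed.

Lemma Rsum_list_inv_fourth l :
  NoDup l -> (forall n, In n l -> (1 <= n)%Z) -> Rsum_list (fun n => / IZR n ^ 4) l <= 8 / 7.
Proof.
  intros Hn Hl. apply Rle_trans with (8 / (7 * IZR 1 ^ 3)); [|right; field].
  apply (Rsum_list_telescope _ (fun n => 8 / (7 * IZR n ^ 3))); trivial.
  intros n H. apply IZR_ge1 in H. rewrite plus_IZR. set (x := IZR n) in *.
  assert (0 < x ^ 3) by (apply pow_lt; lra).
  assert (0 < x ^ 4) by (apply pow_lt; lra).
  assert (0 < (x + 1) ^ 3) by (apply pow_lt; lra). repeat split.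
  - left; now apply Rinv_0_lt_compat.
  - replace (8 / (7 * x ^ 3) - 8 / (7 * (x + 1) ^ 3))
      with (8 * (3 * x ^ 2 + 3 * x + 1) / (7 * x ^ 3 * (x + 1) ^ 3)) by (field; lra).
    apply Rmult_le_reg_r with (7 * x ^ 4 * (x + 1) ^ 3); [nra|].
    replace (/ x ^ 4 * (7 * x ^ 4 * (x + 1) ^ 3)) with (7 * (x + 1) ^ 3) by (field; lra).
    replace (8 * (3 * x ^ 2 + 3 * x + 1) / (7 * x ^ 3 * (x + 1) ^ 3) * (7 * x ^ 4 * (x + 1) ^ 3))
      with (8 * x * (3 * x ^ 2 + 3 * x + 1)) by (field; lra).
    assert (0 <= (x - 1) * (17 * x ^ 2 + 20 * x + 7)) by (apply Rmult_le_pos; nra). nra.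
  - apply Rlt_le, Rdiv_lt_0_compat; lra.
Qed.

(** * Convergence and Taylor expansion of Eisenstein series *)

Lemma Cmod2_linear_form c d z :
  Cmod (RtoC c * z + RtoC d) ^ 2 = (c * Re z + d) ^ 2 + (c * Im z) ^ 2.
Proof.
  rewrite Cmod2_alt. destruct z as [x y]; unfold Re, Im; simpl. ring.
Qed.

Lemma im_le_Cmod z : Rabs (Im z) <= Cmod z.
Proof. eapply Rle_trans; [apply Rmax_r|apply Rmax_Cmod]. Qed.

Lemma linear_form_neq0 z c d :
  upper_half_plane z -> (c <> 0 \/ d <> 0) -> (RtoC c * z + RtoC d)%C <> RtoC 0.
Proof.
  unfold upper_half_plane. intros Hz Hcd E. destruct z as [x y].
  injection E as E1 E2. unfold Im in Hz; simpl in *. 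
  assert (Hc : c = 0).
  { destruct (Rmult_integral c y); lra. }
  subst c. destruct Hcd as [H|H]; [lra|]. apply H; lra.
Qed.

Lemma coprime_pair_neq0 p : coprime_pair p -> IZR (fst p) <> 0 \/ IZR (snd p) <> 0.
Proof.
  destruct p as [c d]; unfold coprime_pair; simpl; intros H.
  destruct (Z.eq_dec c 0) as [->|Hc].
  - right. apply not_0_IZR. intros ->. discriminate.
  - left. now apply not_0_IZR.
Qed.

Lemma Rsum_list_inv_square_plus_one l :
  NoDup l -> Rsum_list (fun n => / (1 + IZR n ^ 2)) l <= 5.
Proof.
  intros Hn.
  assert (Hpos : forall l, NoDup l -> (forall n, In n l -> (1 <= n)%Z) ->
             Rsum_list (fun n => / (1 + IZR n ^ 2)) l <= 2).
  { intros l' H1 H2. eapply Rle_trans; [|apply (Rsum_list_inv_square l'); trivial].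
    apply Rsum_list_le. intros n Hin. assert (H := IZR_ge1 _ (H2 n Hin)).
    apply Rinv_le_contravar; nra. }
  replace 5 with (1 + 2 + 2) by ring.
  apply Rsum_list_half_lines; trivial.
  - intros n; left; apply Rinv_0_lt_compat. nra.
  - simpl. right; field.
  - intros l' H1 H2. eapply Rle_trans; [|apply (Hpos l'); trivial].
    apply Rsum_list_le. intros n _. rewrite opp_IZR. right; f_equal; ring.
Qed.

Definition Eisenstein_term (k : nat) (z : C) (p : Z * Z) : C :=
  (/ (IZR (fst p) * z + IZR (snd p)) ^ k)%C.

Lemma linear_form_lower_bound z : upper_half_plane z ->
  exists e, 0 < e <= 1 /\ forall c d, e * (c ^ 2 + d ^ 2) <= Cmod (RtoC c * z + RtoC d) ^ 2.
Proof.
  unfold upper_half_plane. intros Hz.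
  exists (Im z ^ 2 / (1 + Re z ^ 2 + Im z ^ 2)). split; [split|].
  - apply Rdiv_lt_0_compat; nra.
  - apply Rmult_le_reg_r with (1 + Re z ^ 2 + Im z ^ 2); [nra|].
    replace (Im z ^ 2 / _ * _) with (Im z ^ 2) by (field; nra). nra.
  - intros c d. rewrite Cmod2_linear_form. set (x := Re z). set (y := Im z).
    apply Rmult_le_reg_r with (1 + x ^ 2 + y ^ 2); [nra|].
    replace (y ^ 2 / (1 + x ^ 2 + y ^ 2) * (c ^ 2 + d ^ 2) * (1 + x ^ 2 + y ^ 2))
      with (y ^ 2 * (c ^ 2 + d ^ 2)) by (field; nra).
    (* For the matrix S of the form |c z + d|^2, with trace 1 + |z|^2 and
       determinant y^2, Cayley-Hamilton gives trace * S - determinant = S^2 >= 0. *)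
    assert (H : 0 <= (c * (x ^ 2 + y ^ 2) + d * x) ^ 2 + (c * x + d) ^ 2).
    { apply Rplus_le_le_0_compat; apply pow2_ge_0. }
    replace (((c * x + d) ^ 2 + (c * y) ^ 2) * (1 + x ^ 2 + y ^ 2))
      with (y ^ 2 * (c ^ 2 + d ^ 2) +
            ((c * (x ^ 2 + y ^ 2) + d * x) ^ 2 + (c * x + d) ^ 2)) by ring.
    lra.
Qed.

Lemma Eisenstein_abs_bounded k z : (4 <= k)%nat -> upper_half_plane z ->
  exists M, abs_bounded coprime_pair (Eisenstein_term k z) M.
Proof.
  intros Hk Hz. destruct (linear_form_lower_bound z Hz) as (e & He & Hlow).
  exists (3 / e ^ k * (5 * 5)). intros l Hn HD.
  assert (Hek : 0 < e ^ k) by (apply pow_lt; lra).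
  eapply Rle_trans.
  2:{ apply Rmult_le_compat_l with (r1 := Rsum_list (fun p =>
        / (1 + IZR (fst p) ^ 2) * / (1 + IZR (snd p) ^ 2)) l).
      - apply Rlt_le, Rdiv_lt_0_compat; lra.
      - apply (Rsum_list_product (fun n => / (1 + IZR n ^ 2)) (fun n => / (1 + IZR n ^ 2)));
          trivial; try lra; try apply Rsum_list_inv_square_plus_one;
          intros n; left; apply Rinv_0_lt_compat; nra. }
  rewrite <- Rsum_list_scal. apply Rsum_list_le. intros [c d] Hin.
  rewrite Forall_forall in HD. specialize (HD _ Hin).
  assert (H0 := linear_form_neq0 z _ _ Hz (coprime_pair_neq0 _ HD)).
  assert (Hs : 1 <= IZR c ^ 2 + IZR d ^ 2).
  { replace (IZR c ^ 2 + IZR d ^ 2) with (IZR (c * c + d * d)) by (rewrite plus_IZR, !mult_IZR; ring).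
    apply IZR_ge1.
    destruct (coprime_pair_neq0 _ HD) as [H|H]; simpl in H.
    - assert (c <> 0%Z) by (intros ->; lra). nia.
    - assert (d <> 0%Z) by (intros ->; lra). nia. }
  unfold Eisenstein_term. simpl fst in *; simpl snd in *.
  specialize (Hlow (IZR c) (IZR d)).
  assert (Hpos := proj1 (Cmod_gt_0 _) H0).
  rewrite Cmod_inv, Cmod_pow by (now apply Cpow_nz).
  set (t := Cmod (IZR c * z + IZR d)) in *. set (s := IZR c ^ 2 + IZR d ^ 2) in *.
  assert (Ht : e ^ k * s ^ 2 <= t ^ k).
  { assert (Hte : e <= t) by nra.
    replace k with (4 + (k - 4))%nat by lia. rewrite !pow_add.
    assert (H1 : e ^ (k - 4) <= t ^ (k - 4)) by (apply pow_incr; lra).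
    assert (H2 : 0 < e ^ (k - 4)) by (apply pow_lt; lra).
    assert (H3 : e ^ 4 * s ^ 2 <= t ^ 4).
    { assert (e ^ 2 * s ^ 2 <= t ^ 4).
      { replace (e ^ 2 * s ^ 2) with ((e * s) * (e * s)) by ring.
        replace (t ^ 4) with (t ^ 2 * t ^ 2) by ring.
        apply Rmult_le_compat; nra. }
      assert (e ^ 2 <= 1) by nra.
      assert (0 <= e ^ 2 * s ^ 2) by (apply Rmult_le_pos; nra).
      replace (e ^ 4 * s ^ 2) with (e ^ 2 * (e ^ 2 * s ^ 2)) by ring. nra. }
    replace (e ^ 4 * e ^ (k - 4) * s ^ 2) with (e ^ 4 * s ^ 2 * e ^ (k - 4)) by ring.
    apply Rmult_le_compat; trivial; try lra. apply Rmult_le_pos; [|nra]. nra. }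
  assert (Hst : 0 < s ^ 2) by nra.
  assert (Hprod : (1 + IZR c ^ 2) * (1 + IZR d ^ 2) <= 3 * s ^ 2) by (unfold s in *; nra).
  apply Rle_trans with (/ (e ^ k * s ^ 2)).
  { apply Rinv_le_contravar; nra. }
  set (C1 := IZR c ^ 2) in *. set (D1 := IZR d ^ 2) in *.
  assert (0 <= C1) by (unfold C1; nra). assert (0 <= D1) by (unfold D1; nra).
  replace (3 / e ^ k * (/ (1 + C1) * / (1 + D1)))
    with (/ (e ^ k * ((1 + C1) * (1 + D1) / 3))) by (field; nra).
  apply Rinv_le_contravar; [|apply Rmult_le_compat_l; lra].
  apply Rmult_lt_0_compat; nra.
Qed.

Lemma has_Csum_Eisenstein k z : (4 <= k)%nat -> upper_half_plane z ->
  has_Csum coprime_pair (Eisenstein_term k z) (2 * Eisenstein k z)%C.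
Proof.
  intros Hk Hz. destruct (Eisenstein_abs_bounded k z Hk Hz) as [M HM].
  replace (2 * Eisenstein k z)%C with (Csum coprime_pair (Eisenstein_term k z)).
  - now apply has_Csum_of_abs_bounded with M.
  - unfold Eisenstein, Eisenstein_term. field.
Qed.

Lemma taylor_at_plus g k z a b a' b' :
  taylor_at g z a b -> taylor_at k z a' b' ->
  taylor_at (fun w => g w + k w)%C z (a + a')%C (b + b')%C.
Proof.
  intros (M & r & HM & Hr & Hg) (M' & r' & HM' & Hr' & Hk).
  exists (M + M'), (Rmin r r'). repeat split; [lra|now apply Rmin_glb_lt|].
  intros h Hh.
  assert (H3 : Cmod h < r) by (eapply Rlt_le_trans; [apply Hh|apply Rmin_l]).
  assert (H4 : Cmod h < r') by (eapply Rlt_le_trans; [apply Hh|apply Rmin_r]).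
  specialize (Hg h H3). specialize (Hk h H4).
  replace (_ - _)%C with ((g (z + h)%C - (g z + a * h + b * h * h))
     + (k (z + h)%C - (k z + a' * h + b' * h * h)))%C by ring.
  eapply Rle_trans; [apply Cmod_triangle|]. lra.
Qed.

Lemma taylor2_plus g k z : taylor2 g z -> taylor2 k z -> taylor2 (fun w => g w + k w)%C z.
Proof.
  intros (a & b & H) (a' & b' & H'). do 2 eexists. eapply taylor_at_plus; eauto.
Qed.

Lemma taylor2_scale g (s : R) z :
  0 < s -> taylor2 g (s * z)%C -> taylor2 (fun w => g (s * w)%C) z.
Proof.
  intros Hs (a & b & M & r & HM & Hr & Hg).
  exists (a * s)%C, (b * s * s)%C, (M * s ^ 3), (r / s).
  assert (0 < s ^ 3) by now apply pow_lt.
  repeat split.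
  - nra.
  - now apply Rdiv_lt_0_compat.
  - intros h Hh.
    assert (Hc : Cmod (s * h) = s * Cmod h).
    { rewrite Cmod_mult, Cmod_R, Rabs_pos_eq; lra. }
    specialize (Hg (s * h)%C). rewrite Hc in Hg.
    replace (s * z + s * h)%C with (s * (z + h))%C in Hg by ring.
    eapply Rle_trans; [|eapply Rle_trans; [apply Hg|]].
    + right; f_equal; ring.
    + apply Rmult_lt_reg_r with (/ s); [now apply Rinv_0_lt_compat|].
      replace (s * Cmod h * / s) with (Cmod h) by (field; lra). exact Hh.
    + right; ring.
Qed.

(** With [l = c z + d], each term satisfies [l(z+h)^-k = l^-k (1 + c h / l)^-k],
    and [|c / l| <= 1 / Im z]: one expansion of [w^-k] at 1 serves all terms. *)
Lemma taylor2_Eisenstein k z :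
  (4 <= k)%nat -> upper_half_plane z -> taylor2 (Eisenstein k) z.
Proof.
  intros Hk Hz.
  destruct (taylor2_inv (fun w => w ^ k)%C 1) as (a & b & M & r & HM & Hr & Hpow).
  { apply Cpow_nz. injection; lra. }
  { apply (taylor2_pow (fun w => w)).
    destruct (taylor2_sub_const 0 1) as (a & b & M & r & HM & Hr & H).
    exists a, b, M, r; repeat split; trivial. intros h Hh. specialize (H h Hh).
    eapply Rle_trans; [|apply H]. right; f_equal; ring. }
  destruct (Eisenstein_abs_bounded k z Hk Hz) as [M0 HM0].
  assert (Hy : 0 < Im z) by apply Hz. set (y := Im z) in *.
  set (rho := fun p : Z * Z => (IZR (fst p) / (IZR (fst p) * z + IZR (snd p)))%C).
  assert (Hrho : forall p, coprime_pair p -> Cmod (rho p) <= / y).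
  { intros p Hp. assert (H0 := linear_form_neq0 z _ _ Hz (coprime_pair_neq0 _ Hp)).
    unfold rho. rewrite Cmod_div by trivial. apply Cmod_gt_0 in H0.
    rewrite Cmod_R. apply Rmult_le_reg_r with (Cmod (IZR (fst p) * z + IZR (snd p)) * y).
    { nra. }
    replace (Rabs (IZR (fst p)) / Cmod (IZR (fst p) * z + IZR (snd p)) *
      (Cmod (IZR (fst p) * z + IZR (snd p)) * y)) with (Rabs (IZR (fst p)) * y)
      by (field; lra).
    replace (/ y * (Cmod (IZR (fst p) * z + IZR (snd p)) * y))
      with (Cmod (IZR (fst p) * z + IZR (snd p))) by (field; lra).
    rewrite <- (Rabs_pos_eq y) by lra. rewrite <- Rabs_mult.
    eapply Rle_trans; [|apply (im_le_Cmod (IZR (fst p) * z + IZR (snd p)))].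
    right; f_equal. destruct z; unfold y, Im; simpl; ring. }
  assert (Hy' : 0 < / y) by now apply Rinv_0_lt_compat.
  assert (Hsum : forall j, exists s,
    has_Csum coprime_pair (fun p => rho p ^ j * Eisenstein_term k z p)%C s).
  { intros j. eexists. apply has_Csum_of_abs_bounded with ((/ y) ^ j * M0).
    intros l Hn HD. eapply Rle_trans.
    2:{ apply Rmult_le_compat_l; [apply pow_le; lra|]. apply (HM0 l Hn HD). }
    rewrite <- Rsum_list_scal. apply Rsum_list_le. intros p Hp.
    rewrite Forall_forall in HD.
    rewrite Cmod_mult, Cmod_pow. apply Rmult_le_compat_r; [apply Cmod_ge_0|].
    apply pow_incr; split; [apply Cmod_ge_0|auto]. }
  destruct (Hsum 1%nat) as [s1 Hs1]. destruct (Hsum 2%nat) as [s2 Hs2].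
  assert (HM0p : 0 <= M0).
  { apply Rle_trans with (Rsum_list (fun p => Cmod (Eisenstein_term k z p)) nil).
    - unfold Rsum_list; simpl; lra.
    - apply HM0; constructor. }
  exists (a * s1 / 2)%C, (b * s2 / 2)%C, (M * (/ y) ^ 3 * M0), (Rmin y (r * y)).
  repeat split.
  - apply Rmult_le_pos; trivial. apply Rmult_le_pos; trivial. apply pow_le; lra.
  - apply Rmin_glb_lt; nra.
  - intros h Hh.
    assert (Hh1 : Cmod h < y) by (eapply Rlt_le_trans; [apply Hh|apply Rmin_l]).
    assert (Hh2 : Cmod h < r * y) by (eapply Rlt_le_trans; [apply Hh|apply Rmin_r]).
    assert (Hzh : upper_half_plane (z + h)).
    { unfold upper_half_plane. assert (Hi := im_le_Cmod h).
      apply Rabs_le_between in Hi. destruct z, h; unfold y, Im in *; simpl in *. lra. }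
    pose (rem := fun p => (Eisenstein_term k (z + h) p +
       ((- (1)) * Eisenstein_term k z p + ((- a * h) * (rho p ^ 1 * Eisenstein_term k z p)
         + (- b * h * h) * (rho p ^ 2 * Eisenstein_term k z p))))%C).
    assert (Hrem : has_Csum coprime_pair rem (2 * Eisenstein k (z + h) +
       ((- (1)) * (2 * Eisenstein k z) + ((- a * h) * s1 + (- b * h * h) * s2)))%C).
    { unfold rem. apply has_Csum_plus; [now apply has_Csum_Eisenstein|].
      apply has_Csum_plus; [apply has_Csum_scal; now apply has_Csum_Eisenstein|].
      apply has_Csum_plus; now apply has_Csum_scal. }
    assert (Hbd : abs_bounded coprime_pair rem (M * (/ y) ^ 3 * M0 * Cmod h ^ 3)).
    { intros l Hn HD. replace (M * (/ y) ^ 3 * M0 * Cmod h ^ 3)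
        with (M * ((/ y) ^ 3 * Cmod h ^ 3) * M0) by ring.
      eapply Rle_trans.
      2:{ apply Rmult_le_compat_l; [|apply (HM0 l Hn HD)].
          apply Rmult_le_pos; trivial. apply Rmult_le_pos; apply pow_le;
            [lra|apply Cmod_ge_0]. }
      rewrite <- Rsum_list_scal. apply Rsum_list_le. intros p Hp.
      rewrite Forall_forall in HD. specialize (HD p Hp).
      assert (H0 := linear_form_neq0 z _ _ Hz (coprime_pair_neq0 _ HD)).
      assert (H1 := linear_form_neq0 (z + h) _ _ Hzh (coprime_pair_neq0 _ HD)).
      specialize (Hrho p HD).
      assert (Hq : Cmod (rho p * h) <= / y * Cmod h).
      { rewrite Cmod_mult. apply Rmult_le_compat_r; trivial. apply Cmod_ge_0. }
      assert (Hqr : Cmod (rho p * h) < r).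
      { eapply Rle_lt_trans; [apply Hq|].
        apply Rmult_lt_reg_l with y; trivial.
        rewrite <- Rmult_assoc, Rinv_r, Rmult_1_l by lra. lra. }
      specialize (Hpow _ Hqr). rewrite Cpow_1_l in Hpow.
      assert (E : Eisenstein_term k (z + h) p
        = (/ (1 + rho p * h) ^ k * Eisenstein_term k z p)%C).
      { unfold Eisenstein_term. rewrite <- !Cpow_inv, <- Cpow_mult_l.
        - f_equal. unfold rho. field. split; trivial.
          intros E; apply H1. rewrite <- E; ring.
        - trivial.
        - intros E. apply H1.
          replace (IZR (fst p) * (z + h) + IZR (snd p))%C with
            ((1 + rho p * h) * (IZR (fst p) * z + IZR (snd p)))%C.
          + rewrite E; ring.
          + unfold rho; field; trivial.
        - trivial. }
      replace (rem p) with ((/ (1 + rho p * h) ^ k -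
        (/ 1 + a * (rho p * h) + b * (rho p * h) * (rho p * h))) *
          Eisenstein_term k z p)%C.
      2:{ unfold rem. rewrite E. simpl. field. apply Cpow_nz. intros E'. apply H1.
          replace (IZR (fst p) * (z + h) + IZR (snd p))%C with
            ((1 + rho p * h) * (IZR (fst p) * z + IZR (snd p)))%C.
          + rewrite E'; ring.
          + unfold rho; field; trivial. }
      rewrite Cmod_mult. apply Rmult_le_compat_r; [apply Cmod_ge_0|].
      eapply Rle_trans; [apply Hpow|]. apply Rmult_le_compat_l; trivial.
      rewrite <- Rpow_mult_distr. apply pow_incr; split; [apply Cmod_ge_0|trivial]. }
    assert (Hfin := has_Csum_Cmod_le _ _ _ _ Hrem Hbd).
    replace (Eisenstein k (z + h) - (Eisenstein k z + a * s1 / 2 * h + b * s2 / 2 * h * h))%C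
      with (/ 2 * (2 * Eisenstein k (z + h) +
       ((- (1)) * (2 * Eisenstein k z) + ((- a * h) * s1 + (- b * h * h) * s2))))%C by field.
    rewrite Cmod_mult.
    replace (Cmod (/ 2)) with (/ 2).
    2:{ rewrite Cmod_inv, Cmod_R, Rabs_pos_eq; try lra. injection; lra. }
    match type of Hfin with Cmod ?x <= _ =>
      assert (Hx := Cmod_ge_0 x) end. lra.
Qed.

(** * The Fricke Eisenstein series and its symmetries *)

(** Splitting the coprime pairs according to divisibility by 5 writes
    [Eisenstein_Fricke5] as two series over one set of indices [(a, b)], with
    terms [(5 b z + a)^-k] and [5^(-k/2) (a z + b)^-k]. *)
Definition Fricke5_index (p : Z * Z) : Prop :=
  Z.gcd (fst p) (snd p) = 1%Z /\ ~ (5 | fst p)%Z.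

Definition Fricke5_term (k : nat) (z : C) (p : Z * Z) : C :=
  Eisenstein_term k z (5 * snd p, fst p)%Z.

Lemma gcd_mul5 a b :
  Z.gcd (5 * b) a = 1%Z <-> Z.gcd a b = 1%Z /\ ~ (5 | a)%Z.
Proof.
  split.
  - intros H. split.
    + apply Z.gcd_unique; try lia; try apply Z.divide_1_l.
      intros q Ha Hb. rewrite <- H. apply Z.gcd_greatest; trivial.
      now apply Z.divide_mul_r.
    + intros H5. assert (H1 : (5 | 1)%Z).
      { rewrite <- H. apply Z.gcd_greatest; trivial. apply Z.divide_factor_l. }
      destruct H1 as [q Hq]. lia.
  - intros [H H5].
    assert (Ha : Z.gcd a 5 = 1%Z).
    { assert (Hg := Z.gcd_nonneg a 5). assert (Hr := Z.gcd_divide_r a 5).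
      assert (Hl := Z.gcd_divide_l a 5).
      assert (Hle := Z.divide_pos_le _ 5 ltac:(lia) Hr).
      revert Hg Hr Hl Hle. generalize (Z.gcd a 5). intros g Hg [q Hq] Hl Hle.
      assert (Hc : (g = 0 \/ g = 1 \/ g = 2 \/ g = 3 \/ g = 4 \/ g = 5)%Z) by lia.
      destruct Hc as [->|[->|[->|[->|[->| ->]]]]]; try lia. contradiction. }
    rewrite Z.gcd_comm. apply Z.gcd_unique; try lia; try apply Z.divide_1_l.
    intros q H1 H2. rewrite <- H. apply Z.gcd_greatest; trivial.
    apply Z.gauss with 5%Z; trivial.
    apply Z.gcd_unique; try lia; try apply Z.divide_1_l.
    intros q' H3 H4. rewrite <- Ha. apply Z.gcd_greatest; trivial.
    now apply Z.divide_trans with q.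
Qed.

Lemma Fricke5_index_coprime p : Fricke5_index p -> coprime_pair p.
Proof. now intros [H _]. Qed.

Lemma abs_bounded_reindex {T T'} (D : T -> Prop) (D' : T' -> Prop) (phi : T -> T') f M :
  (forall x, D x -> D' (phi x)) -> FinFun.Injective phi ->
  abs_bounded D' f M -> abs_bounded D (fun x => f (phi x)) M.
Proof.
  intros H Hinj HM l Hn HD. rewrite <- (Rsum_list_map phi (fun x => Cmod (f x))).
  apply HM.
  - now apply FinFun.Injective_map_NoDup.
  - rewrite Forall_map. eapply Forall_impl; [|apply HD]. auto.
Qed.

Lemma has_Csum_Fricke5_terms k z : (4 <= k)%nat -> upper_half_plane z ->
  exists A B, has_Csum Fricke5_index (Fricke5_term k z) A /\
              has_Csum Fricke5_index (Eisenstein_term k z) B.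
Proof.
  intros Hk Hz. destruct (Eisenstein_abs_bounded k z Hk Hz) as [M HM].
  do 2 eexists; split; eapply has_Csum_of_abs_bounded with M.
  - apply (abs_bounded_reindex Fricke5_index coprime_pair
             (fun p => (5 * snd p, fst p)%Z) (Eisenstein_term k z)); trivial.
    + intros [a b] H. unfold coprime_pair; cbn [fst snd]. now apply gcd_mul5.
    + intros [a b] [a' b'] E. apply pair_equal_spec in E. cbn [fst snd] in E.
      f_equal; lia.
  - intros l Hn HD. apply HM; trivial. eapply Forall_impl; [|apply HD].
    apply Fricke5_index_coprime.
Qed.

Lemma Eisenstein_split k z A B : (4 <= k)%nat -> upper_half_plane z ->
  has_Csum Fricke5_index (Fricke5_term k z) A ->
  has_Csum Fricke5_index (Eisenstein_term k z) B ->
  (2 * Eisenstein k z = A + B)%C.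
Proof.
  intros Hk Hz HA HB. eapply has_Csum_unique; [now apply has_Csum_Eisenstein|].
  apply has_Csum_union with (D1 := fun p => coprime_pair p /\ (5 | fst p)%Z)
    (D2 := Fricke5_index).
  - intros [c d]; unfold Fricke5_index, coprime_pair; simpl.
    destruct (classic (5 | c)%Z); tauto.
  - intros p [_ H] [_ H']; auto.
  - eapply has_Csum_ext;
      [|apply (has_Csum_reindex _ Fricke5_index (fun p => (snd p, fst p / 5)%Z)
               (fun p => (5 * snd p, fst p)%Z) (Fricke5_term k z) A); trivial].
    + intros [c d] [_ [q Hq]]. unfold Fricke5_term; cbn [fst snd] in *. subst c.
      rewrite Z.div_mul by lia. f_equal. f_equal. lia.
    + intros [c d] [H [q Hq]]. unfold Fricke5_index, coprime_pair in *; cbn [fst snd] in *. subst c.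
      rewrite Z.div_mul by lia. apply gcd_mul5. now rewrite Z.mul_comm.
    + intros [a b] H. unfold coprime_pair; cbn [fst snd]. split; [now apply gcd_mul5|].
      exists b; lia.
    + intros [c d] [_ [q Hq]]. cbn [fst snd] in *. subst c. rewrite Z.div_mul by lia.
      f_equal; lia.
    + intros [a b] _. cbn [fst snd]. rewrite Z.mul_comm, Z.div_mul by lia. trivial.
  - trivial.
Qed.

Lemma upper_half_plane_scale s z : 0 < s -> upper_half_plane z -> upper_half_plane (s * z)%C.
Proof. unfold upper_half_plane; destruct z; unfold Im; simpl. nra. Qed.

Lemma Eisenstein_split_5 k z A B : (4 <= k)%nat -> upper_half_plane z ->
  has_Csum Fricke5_index (Fricke5_term k z) A ->
  has_Csum Fricke5_index (Eisenstein_term k z) B ->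
  (2 * Eisenstein k (5 * z) = A + / 5 ^ k * B)%C.
Proof.
  intros Hk Hz HA HB. eapply has_Csum_unique.
  { apply has_Csum_Eisenstein; trivial. apply upper_half_plane_scale; trivial. lra. }
  apply has_Csum_union with (D1 := fun p => coprime_pair p /\ ~ (5 | snd p)%Z)
    (D2 := fun p => coprime_pair p /\ (5 | snd p)%Z).
  - intros [c d]; unfold Fricke5_index, coprime_pair; simpl.
    destruct (classic (5 | d)%Z); tauto.
  - intros p [_ H] [_ H']; auto.
  - eapply has_Csum_ext;
      [|apply (has_Csum_reindex _ Fricke5_index (fun p => (snd p, fst p)%Z)
               (fun p => (snd p, fst p)%Z) (Fricke5_term k z) A); trivial].
    + intros [c d] _. unfold Fricke5_term, Eisenstein_term; cbn [fst snd].
      rewrite mult_IZR, RtoC_mult. do 3 f_equal. ring.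
    + intros [c d] [H H']. unfold Fricke5_index, coprime_pair in *; cbn [fst snd] in *.
      now rewrite Z.gcd_comm.
    + intros [a b] [H H']. unfold coprime_pair in *; cbn [fst snd] in *.
      now rewrite Z.gcd_comm.
    + now intros [c d].
    + now intros [c d].
  - apply (has_Csum_scal _ (/ 5 ^ k)%C) in HB.
    eapply has_Csum_ext;
      [|apply (has_Csum_reindex _ Fricke5_index (fun p => (fst p, snd p / 5)%Z)
               (fun p => (fst p, 5 * snd p)%Z) 
               (fun p => / 5 ^ k * Eisenstein_term k z p)%C); [..|apply HB]].
    + intros [c d] [H [q Hq]]. unfold Eisenstein_term; cbn [fst snd] in *.
      subst d. rewrite Z.div_mul by lia.
      assert (H5 : RtoC 5 <> RtoC 0) by (injection; lra).
      assert (Hcq : coprime_pair (c, q)).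
      { unfold coprime_pair in *; cbn [fst snd] in *.
        apply gcd_mul5. now rewrite Z.mul_comm, Z.gcd_comm. }
      assert (H0 := linear_form_neq0 z _ _ Hz (coprime_pair_neq0 _ Hcq)).
      cbn [fst snd] in H0.
      replace (IZR c * (5 * z) + IZR (q * 5))%C with (5 * (IZR c * z + IZR q))%C
        by (rewrite mult_IZR, RtoC_mult; ring).
      rewrite Cpow_mult_l. field. split; now apply Cpow_nz.
    + intros [c d] [H [q Hq]]. unfold Fricke5_index, coprime_pair in *; cbn [fst snd] in *.
      subst d. rewrite Z.div_mul by lia. apply gcd_mul5. now rewrite Z.mul_comm, Z.gcd_comm.
    + intros [a b] H. unfold coprime_pair; cbn [fst snd]. split.
      * rewrite Z.gcd_comm. now apply gcd_mul5.
      * exists b; lia.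
    + intros [c d] [_ [q Hq]]. cbn [fst snd] in *. subst d. rewrite Z.div_mul by lia.
      f_equal; lia.
    + intros [a b] _. cbn [fst snd]. rewrite (Z.mul_comm 5), Z.div_mul by lia. trivial.
Qed.

Lemma Fricke5_decomposition h z A B : (2 <= h)%nat -> upper_half_plane z ->
  has_Csum Fricke5_index (Fricke5_term (2 * h) z) A ->
  has_Csum Fricke5_index (Eisenstein_term (2 * h) z) B ->
  (Eisenstein_Fricke5 (2 * h) z = (A + B / 5 ^ h) / 2)%C.
Proof.
  intros Hh Hz HA HB.
  assert (E1 := Eisenstein_split (2 * h) z A B ltac:(lia) Hz HA HB).
  assert (E2 := Eisenstein_split_5 (2 * h) z A B ltac:(lia) Hz HA HB).
  unfold Eisenstein_Fricke5. rewrite Nat.mul_comm, Nat.div_mul, Nat.mul_comm by lia.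
  replace (Eisenstein (2 * h) z) with ((A + B) / 2)%C by (rewrite <- E1; field).
  replace (Eisenstein (2 * h) (5 * z)) with ((A + / 5 ^ (2 * h) * B) / 2)%C
    by (rewrite <- E2; field).
  rewrite Nat.mul_comm, Cpow_mult_r.
  rewrite <- RtoC_pow. set (q := 5 ^ h). assert (0 < q) by (apply pow_lt; lra).
  assert (RtoC q <> RtoC 0) by (intros E; injection E; lra).
  assert ((RtoC q + 1)%C <> RtoC 0) by (intros E; injection E; lra).
  simpl. field. repeat split; trivial.
Qed.

Lemma Eisenstein_translate k z : (4 <= k)%nat -> upper_half_plane z ->
  Eisenstein k (z + 1) = Eisenstein k z.
Proof.
  intros Hk Hz. unfold Eisenstein. f_equal.
  assert (Hz1 : upper_half_plane (z + 1)%C).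
  { unfold upper_half_plane in *. destruct z; unfold Im in *; simpl in *; lra. }
  destruct (Eisenstein_abs_bounded k z Hk Hz) as [M HM].
  apply has_Csum_of_abs_bounded in HM.
  apply has_Csum_Csum.
  eapply has_Csum_ext;
    [|apply (has_Csum_reindex coprime_pair coprime_pair
        (fun p => (fst p, snd p + 1 * fst p)%Z)
        (fun p => (fst p, snd p - 1 * fst p)%Z) (Eisenstein_term k z)); [..|apply HM]].
  - intros [c d] _. unfold Eisenstein_term; cbn [fst snd].
    rewrite plus_IZR, mult_IZR, RtoC_plus, RtoC_mult. do 2 f_equal. ring.
  - intros [c d]. unfold coprime_pair. cbn [fst snd].
    now rewrite Z.gcd_add_mult_diag_r.
  - intros [c d]. unfold coprime_pair. cbn [fst snd].
    replace (d - 1 * c)%Z with (d + (-1) * c)%Z by lia.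
    now rewrite Z.gcd_add_mult_diag_r.
  - intros [c d] _; cbn [fst snd]; f_equal; lia.
  - intros [c d] _; cbn [fst snd]; f_equal; lia.
Qed.

Lemma Eisenstein_reflect k z : (4 <= k)%nat -> upper_half_plane z ->
  Eisenstein k (- Cconj z) = Cconj (Eisenstein k z).
Proof.
  intros Hk Hz. unfold Eisenstein. rewrite Cmult_conj.
  replace (Cconj (/ 2)) with (/ 2)%C by (apply injective_projections; simpl; field).
  f_equal.
  destruct (Eisenstein_abs_bounded k z Hk Hz) as [M HM].
  apply has_Csum_of_abs_bounded, has_Csum_conj in HM.
  apply has_Csum_Csum.
  eapply has_Csum_ext;
    [|apply (has_Csum_reindex coprime_pair coprime_pair
        (fun p => (- fst p, snd p)%Z) (fun p => (- fst p, snd p)%Z)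
        (fun p => Cconj (Eisenstein_term k z p))); [..|apply HM]].
  - intros [c d] Hp. unfold Eisenstein_term; cbn [fst snd].
    assert (H0 : (IZR (- c) * z + IZR d)%C <> RtoC 0).
    { apply linear_form_neq0; trivial. apply (coprime_pair_neq0 (- c, d)%Z).
      unfold coprime_pair in *; cbn [fst snd]. now rewrite Z.gcd_opp_l. }
    rewrite Cinv_conj, Cpow_conj by (now apply Cpow_nz). do 2 f_equal.
    rewrite opp_IZR. destruct z; apply injective_projections; simpl; ring.
  - intros [c d]. unfold coprime_pair. cbn [fst snd]. now rewrite Z.gcd_opp_l.
  - intros [c d]. unfold coprime_pair. cbn [fst snd]. now rewrite Z.gcd_opp_l.
  - intros [c d] _; cbn [fst snd]; f_equal; lia.
  - intros [c d] _; cbn [fst snd]; f_equal; lia.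
Qed.

Lemma Fricke5_translate k z : (4 <= k)%nat -> upper_half_plane z ->
  Eisenstein_Fricke5 k (z + 1) = Eisenstein_Fricke5 k z.
Proof.
  intros Hk Hz. unfold Eisenstein_Fricke5. rewrite Eisenstein_translate by trivial.
  do 3 f_equal.
  assert (H5 : forall c, upper_half_plane (5 * z + RtoC c)%C).
  { intros c. unfold upper_half_plane in *. destruct z; unfold Im in *; simpl in *; lra. }
  replace (5 * (z + 1))%C with (5 * z + 0 + 1 + 1 + 1 + 1 + 1)%C by ring.
  rewrite !Eisenstein_translate; trivial;
    try (rewrite <- ?Cplus_assoc, <- ?RtoC_plus; apply H5).
  f_equal; ring.
Qed.

Lemma Fricke5_reflect k z : (4 <= k)%nat -> upper_half_plane z ->
  Eisenstein_Fricke5 k (- Cconj z) = Cconj (Eisenstein_Fricke5 k z).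
Proof.
  intros Hk Hz. unfold Eisenstein_Fricke5.
  rewrite <- RtoC_pow. set (q := 5 ^ (k / 2)). assert (0 < q) by (apply pow_lt; lra).
  rewrite Eisenstein_reflect by trivial.
  replace (5 * - Cconj z)%C with (- Cconj (5 * z))%C
    by (destruct z; apply injective_projections; simpl; ring).
  rewrite Eisenstein_reflect by (trivial; apply upper_half_plane_scale; trivial; lra).
  rewrite Cmult_conj, Cplus_conj, Cmult_conj. f_equal; [|f_equal; f_equal].
  - rewrite <- RtoC_plus, <- RtoC_div by lra. apply injective_projections; simpl; ring.
  - apply injective_projections; simpl; ring.
Qed.

Lemma taylor2_Fricke5 k z : (4 <= k)%nat -> upper_half_plane z ->
  taylor2 (Eisenstein_Fricke5 k) z.
Proof.
  intros Hk Hz. unfold Eisenstein_Fricke5.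
  apply taylor2_mult; [apply taylor2_const|].
  apply taylor2_plus; [|now apply taylor2_Eisenstein].
  apply taylor2_mult; [apply taylor2_const|].
  apply (taylor2_scale (Eisenstein k) 5); [lra|].
  apply taylor2_Eisenstein; trivial. apply upper_half_plane_scale; trivial; lra.
Qed.

(** ** Reality on the arcs *)

Lemma Cconj_R (r : R) : Cconj r = r.
Proof. apply injective_projections; simpl; ring. Qed.

(** On [|z| = 1/sqrt 5] one has [conj z = 1/(5 z)], so conjugation turns
    [5 b z + a] into [(a z + b) / z]. *)
Lemma conj_sum_arc1 k z A B : (4 <= k)%nat -> upper_half_plane z ->
  (z * Cconj z = / 5)%C ->
  has_Csum Fricke5_index (Fricke5_term k z) A ->
  has_Csum Fricke5_index (Eisenstein_term k z) B ->
  Cconj A = (z ^ k * B)%C.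
Proof.
  intros Hk Hz Hzz HA HB. apply has_Csum_conj in HA.
  apply (has_Csum_scal _ (z ^ k)%C) in HB.
  eapply has_Csum_unique; [apply HA|]. eapply has_Csum_ext; [|apply HB].
  intros [a b] Hp. unfold Fricke5_term, Eisenstein_term; cbn [fst snd].
  assert (H0 := linear_form_neq0 z _ _ Hz
            (coprime_pair_neq0 _ (Fricke5_index_coprime _ Hp))). simpl in H0.
  assert (Hz0 : z <> RtoC 0).
  { intros ->. unfold upper_half_plane, Im in Hz; simpl in Hz; lra. }
  assert (H1 : (IZR (5 * b) * z + IZR a)%C <> RtoC 0).
  { apply linear_form_neq0; trivial. apply (coprime_pair_neq0 (5 * b, a)%Z).
    unfold coprime_pair; cbn [fst snd]. now apply gcd_mul5. }
  assert (E : Cconj (IZR (5 * b) * z + IZR a) = ((IZR a * z + IZR b) / z)%C).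
  { rewrite Cplus_conj, Cmult_conj, mult_IZR.
    replace (Cconj z) with (/ (5 * z))%C.
    2:{ replace (/ (5 * z))%C with (/ z * / 5)%C.
        - rewrite <- Hzz. field; trivial.
        - field; trivial. }
    rewrite !Cconj_R, RtoC_mult. field; trivial. }
  rewrite Cinv_conj, Cpow_conj, E by (now apply Cpow_nz).
  unfold Cdiv. rewrite Cpow_mult_l, Cpow_inv by trivial. field.
  split; now apply Cpow_nz.
Qed.

(** On [|z + 1/2| = 1/(2 sqrt 5)] conjugation turns [5 b z + a] into
    [- (a' z + b') / (2 z + 1)] with [(a', b') = (5 b - 2 a, 2 b - a)]. *)
Lemma conj_sum_arc2 h z A B : (2 <= h)%nat -> upper_half_plane z ->
  ((2 * z + 1) * Cconj (2 * z + 1) = / 5)%C ->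
  has_Csum Fricke5_index (Fricke5_term (2 * h) z) A ->
  has_Csum Fricke5_index (Eisenstein_term (2 * h) z) B ->
  Cconj A = ((2 * z + 1) ^ (2 * h) * B)%C.
Proof.
  intros Hk Hz Hzz HA HB. apply has_Csum_conj in HA.
  apply (has_Csum_scal _ ((2 * z + 1) ^ (2 * h))%C) in HB.
  apply (has_Csum_reindex Fricke5_index Fricke5_index
    (fun p => (5 * snd p - 2 * fst p, 2 * snd p - fst p)%Z)
    (fun p => (2 * fst p - 5 * snd p, fst p - 2 * snd p)%Z)) in HB.
  - eapply has_Csum_unique; [apply HA|]. eapply has_Csum_ext; [|apply HB].
    intros [a b] Hp. unfold Fricke5_term, Eisenstein_term; cbn [fst snd].
    set (v := (2 * z + 1)%C) in *.
    assert (Hv0 : v <> RtoC 0).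
    { intros E. rewrite E in Hzz. rewrite Cmult_0_l in Hzz.
      injection Hzz; intros; lra. }
    assert (H1 : (IZR (5 * b) * z + IZR a)%C <> RtoC 0).
    { apply linear_form_neq0; trivial. apply (coprime_pair_neq0 (5 * b, a)%Z).
      unfold coprime_pair; cbn [fst snd]. now apply gcd_mul5. }
    assert (H5 : RtoC 5 <> RtoC 0) by (intros E; injection E; lra).
    assert (H2 : RtoC 2 <> RtoC 0) by (intros E; injection E; lra).
    assert (E : Cconj (IZR (5 * b) * z + IZR a)
       = (- ((IZR (5 * b - 2 * a) * z + IZR (2 * b - a)) / v))%C).
    { rewrite Cplus_conj, Cmult_conj.
      assert (Ez : Cconj z = ((/ (5 * v) - 1) / 2)%C).
      { assert (Ev : Cconj v = (/ (5 * v))%C).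
        { replace (/ (5 * v))%C with (/ v * / 5)%C by (field; trivial).
          rewrite <- Hzz. field; trivial. }
        rewrite <- Ev. unfold v. rewrite Cplus_conj, Cmult_conj.
        destruct z; apply injective_projections; simpl; field. }
      rewrite Ez.
      rewrite !Cconj_R.
      replace z with ((v - 1) / 2)%C by (unfold v; field; trivial).
      rewrite !minus_IZR, !mult_IZR, !RtoC_minus, !RtoC_mult. field; trivial. }
    rewrite Cinv_conj, Cpow_conj, E by (now apply Cpow_nz).
    assert (H0 : (IZR (5 * b - 2 * a) * z + IZR (2 * b - a))%C <> RtoC 0).
    { intros E'. rewrite E' in E. apply H1.
      rewrite <- (Cconj_conj (_ + _)), E. apply injective_projections; simpl;
        unfold Rdiv; ring. }
    set (w := (IZR (5 * b - 2 * a) * z + IZR (2 * b - a))%C) in *.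
    rewrite !(Cpow_mult_r _ 2).
    replace ((- (w / v)) ^ 2)%C with (w ^ 2 * / v ^ 2)%C by (simpl; field; trivial).
    assert (Hw2 : (w ^ 2)%C <> RtoC 0) by now apply Cpow_nz.
    assert (Hv2 : (v ^ 2)%C <> RtoC 0) by now apply Cpow_nz.
    rewrite Cpow_mult_l, Cpow_inv by trivial. field.
    split; now apply Cpow_nz.
  - intros [a b] [H H']. unfold Fricke5_index; cbn [fst snd] in *. split.
    + apply Z.gcd_unique; try lia; try apply Z.divide_1_l.
      intros q [x Hx] [y Hy]. rewrite <- H. apply Z.gcd_greatest.
      * exists (2 * x - 5 * y)%Z. lia.
      * exists (x - 2 * y)%Z. lia.
    + intros [q Hq]. apply H'. apply Z.gauss with 2%Z; trivial. exists (b - q)%Z. lia.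
  - intros [a b] [H H']. unfold Fricke5_index; cbn [fst snd] in *. split.
    + apply Z.gcd_unique; try lia; try apply Z.divide_1_l.
      intros q [x Hx] [y Hy]. rewrite <- H. apply Z.gcd_greatest.
      * exists (- 2 * x + 5 * y)%Z. lia.
      * exists (- x + 2 * y)%Z. lia.
    + intros [q Hq]. apply H'. apply Z.gauss with 2%Z; trivial. exists (b + q)%Z. lia.
  - intros [a b] _; cbn [fst snd]; f_equal; lia.
  - intros [a b] _; cbn [fst snd]; f_equal; lia.
Qed.

(** Applied to the two halves [A] and [B'] of the series: at a point with [U = 1]
    the value is governed by [A] alone, which halves the estimates. *)
Lemma real_up_to_unit A B' U F :
  Cconj A = (U * B')%C -> Cmod U = 1 -> F = ((A + B') / 2)%C ->
  Cconj F = (U * F)%C /\ (U = RtoC 1 -> F = RtoC (Re A)).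
Proof.
  intros HA HU ->.
  assert (HUU : (U * Cconj U = 1)%C).
  { rewrite <- Cmod2_conj, HU. rewrite pow1. trivial. }
  assert (HB : Cconj B' = (U * A)%C).
  { rewrite <- (Cconj_conj A), HA, Cmult_conj.
    replace (U * (Cconj U * Cconj B'))%C with (U * Cconj U * Cconj B')%C by ring.
    rewrite HUU; ring. }
  split.
  - rewrite Cdiv_conj, Cplus_conj, HA, HB by (intros E; injection E; lra).
    rewrite Cconj_R.
    field. 
  - intros ->. rewrite Cmult_1_l in HA. rewrite <- HA.
    destruct A; apply injective_projections; simpl; field.
Qed.

(** * Estimates of the two series *)

Lemma Cmod_inv_even_pow h w : w <> RtoC 0 -> Cmod (/ w ^ (2 * h)) = / (Cmod w ^ 2) ^ h.
Proof.
  intros H. rewrite Cmod_inv, Cmod_pow, pow_mult by (now apply Cpow_nz). trivial.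
Qed.

Lemma inv_pow_le j h N : (j <= h)%nat -> 1 <= N -> / N ^ h <= / N ^ j.
Proof.
  intros Hj HN. apply Rinv_le_contravar; [apply pow_lt; lra|]. now apply Rle_pow.
Qed.

Lemma Rsum_list_inv_square_Z l : NoDup l -> Rsum_list (fun n => / IZR n ^ 2) l <= 4.
Proof.
  intros Hn. replace 4 with (0 + 2 + 2) by ring.
  apply Rsum_list_half_lines; trivial.
  - intros n. destruct (Req_dec (IZR n) 0) as [->|H].
    + rewrite pow_ne_zero, Rinv_0 by discriminate. lra.
    + left; apply Rinv_0_lt_compat. nra.
  - rewrite pow_ne_zero, Rinv_0 by discriminate. lra.
  - apply Rsum_list_inv_square.
  - intros l' H1 H2. eapply Rle_trans; [|apply (Rsum_list_inv_square l'); trivial].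
    apply Rsum_list_le. intros n _. rewrite opp_IZR. right; f_equal; ring.
Qed.

Lemma Rsum_list_inv_square_pairs l :
  NoDup l -> Rsum_list (fun p => / IZR (fst p) ^ 2 * / IZR (snd p) ^ 2) l <= 16.
Proof.
  intros Hn. replace 16 with (4 * 4) by ring.
  assert (Hpos : forall n, 0 <= / IZR n ^ 2).
  { intros n. destruct (Req_dec (IZR n) 0) as [->|H].
    + rewrite pow_ne_zero, Rinv_0 by discriminate. lra.
    + left; apply Rinv_0_lt_compat. nra. }
  apply (Rsum_list_product (fun n => / IZR n ^ 2) (fun n => / IZR n ^ 2)); trivial;
    try lra; apply Rsum_list_inv_square_Z.
Qed.

Lemma Fricke5_index_units : Forall Fricke5_index ((1, 0) :: (-1, 0) :: nil)%Z.
Proof.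
  repeat constructor; cbn [fst snd]; trivial; intros [q Hq]; lia.
Qed.

Lemma Fricke5_index_nonunits a b : Fricke5_index (a, b) ->
  ~ In (a, b) ((1, 0) :: (-1, 0) :: nil)%Z -> (a <> 0 /\ b <> 0)%Z.
Proof.
  intros [H H5] Hin; cbn [fst snd] in *. split.
  - intros ->. apply H5. now exists 0%Z.
  - intros ->. apply Hin. rewrite Z.gcd_0_r in H. simpl.
    assert (Ha : (a = 1 \/ a = -1)%Z) by lia. destruct Ha as [-> | ->]; auto.
Qed.

Lemma pair_bound h N a b kappa :
  (2 <= h)%nat -> 1 <= kappa -> (a <> 0)%Z -> (b <> 0)%Z -> 0 <= N ->
  kappa * (IZR a ^ 2 * IZR b ^ 2) <= N ^ 2 ->
  / N ^ h <= / kappa * (/ IZR a ^ 2 * / IZR b ^ 2).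
Proof.
  intros Hh Hk Ha Hb HN H.
  assert (Hsq : forall n, (n <> 0)%Z -> 1 <= IZR n ^ 2).
  { intros n Hn. replace (IZR n ^ 2) with (IZR (n * n)) by (rewrite mult_IZR; ring).
    apply IZR_ge1. nia. }
  assert (H1 := Hsq a Ha). assert (H2 := Hsq b Hb).
  assert (1 <= IZR a ^ 2 * IZR b ^ 2) by nra.
  assert (HN1 : 1 <= N) by nra.
  eapply Rle_trans; [apply (inv_pow_le 2); trivial|].
  rewrite <- !Rinv_mult. apply Rinv_le_contravar; nra.
Qed.

(** The terms [(1, 0)] and [(-1, 0)] of the two series dominate as soon as both
    quadratic forms exceed [sqrt kappa |a b|]; the inverse squares of the integers
    sum to at most 4, whence the constant 16. *)
Lemma Fricke5_main_term h z kappa : (2 <= h)%nat -> upper_half_plane z -> 1 <= kappa ->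
  (forall a b, kappa * (a ^ 2 * b ^ 2) <= (Cmod (RtoC (5 * b) * z + RtoC a) ^ 2) ^ 2) ->
  (forall a b, kappa * (a ^ 2 * b ^ 2) <= (5 * Cmod (RtoC a * z + RtoC b) ^ 2) ^ 2) ->
  Cmod (Eisenstein_Fricke5 (2 * h) z - (1 + / (5 ^ h * z ^ (2 * h)))) <= 16 / kappa.
Proof.
  intros Hh Hz Hk HkA HkB.
  destruct (has_Csum_Fricke5_terms (2 * h) z ltac:(lia) Hz) as (A & B & HA & HB).
  rewrite (Fricke5_decomposition h z A B); trivial.
  assert (Hz0 : z <> RtoC 0).
  { intros ->. unfold upper_half_plane, Im in Hz; simpl in Hz; lra. }
  assert (H5h : (5 ^ h)%C <> RtoC 0) by (apply Cpow_nz; intros E; injection E; lra).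
  assert (Hzh : (z ^ (2 * h))%C <> RtoC 0) by now apply Cpow_nz.
  assert (Hnd : NoDup ((1, 0) :: (-1, 0) :: nil)%Z).
  { repeat constructor; simpl; [intros [E|[]]; discriminate|tauto]. }
  assert (EA : Cmod (A - 2) <= 16 / kappa).
  { replace (RtoC 2) with (Csum_list (Fricke5_term (2 * h) z) ((1, 0) :: (-1, 0) :: nil)%Z).
    - apply has_Csum_main_terms with Fricke5_index; trivial;
        [apply Fricke5_index_units|].
      intros r Hn HD Hr.
      apply Rle_trans with (Rsum_list (fun p => / kappa *
        (/ IZR (fst p) ^ 2 * / IZR (snd p) ^ 2)) r).
      + apply Rsum_list_le. intros [a b] Hin. rewrite Forall_forall in HD.
        specialize (HD _ Hin).
        destruct (Fricke5_index_nonunits a b HD (Hr _ Hin)) as [Ha Hb].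
        unfold Fricke5_term, Eisenstein_term. cbn [fst snd].
        rewrite Cmod_inv_even_pow.
        * apply pair_bound; trivial; [apply pow2_ge_0|].
          rewrite mult_IZR. apply HkA.
        * apply linear_form_neq0; trivial. right. now apply not_0_IZR.
      + rewrite Rsum_list_scal. assert (H := Rsum_list_inv_square_pairs r Hn).
        assert (0 < / kappa) by (apply Rinv_0_lt_compat; lra). unfold Rdiv. nra.
    - unfold Csum_list, Fricke5_term, Eisenstein_term; cbn [map fold_right fst snd].
      replace (IZR (5 * 0) * z + IZR (-1))%C with (- RtoC 1)%C
        by (destruct z; apply injective_projections; simpl; ring).
      replace (IZR (5 * 0) * z + 1)%C with (RtoC 1)
        by (destruct z; apply injective_projections; simpl; ring).
      rewrite !Cpow_mult_r. replace ((- RtoC 1) ^ 2)%C with (RtoC 1) by (simpl; ring).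
      rewrite !Cpow_1_l. apply injective_projections; simpl; field. }
  assert (EB : Cmod (/ 5 ^ h * B - 2 / (5 ^ h * z ^ (2 * h))) <= 16 / kappa).
  { apply (has_Csum_scal _ (/ 5 ^ h)%C) in HB.
    replace (2 / (5 ^ h * z ^ (2 * h)))%C with
      (Csum_list (fun p => / 5 ^ h * Eisenstein_term (2 * h) z p)%C
         ((1, 0) :: (-1, 0) :: nil)%Z).
    - apply has_Csum_main_terms with Fricke5_index; trivial;
        [apply Fricke5_index_units|].
      intros r Hn HD Hr.
      apply Rle_trans with (Rsum_list (fun p => / kappa *
        (/ IZR (fst p) ^ 2 * / IZR (snd p) ^ 2)) r).
      + apply Rsum_list_le. intros [a b] Hin. rewrite Forall_forall in HD.
        specialize (HD _ Hin).
        destruct (Fricke5_index_nonunits a b HD (Hr _ Hin)) as [Ha Hb].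
        unfold Eisenstein_term. cbn [fst snd].
        rewrite Cmod_mult, Cmod_inv_even_pow
          by (apply linear_form_neq0; trivial; right; now apply not_0_IZR).
        rewrite Cmod_inv, Cmod_pow, Cmod_R, Rabs_pos_eq by (trivial; lra).
        rewrite <- Rinv_mult, <- Rpow_mult_distr.
        apply pair_bound; trivial.
        apply Rmult_le_pos; [lra|apply pow2_ge_0].
      + rewrite Rsum_list_scal. assert (H := Rsum_list_inv_square_pairs r Hn).
        assert (0 < / kappa) by (apply Rinv_0_lt_compat; lra). unfold Rdiv. nra.
    - unfold Csum_list, Eisenstein_term; cbn [map fold_right fst snd].
      replace (IZR (-1) * z + 0)%C with (- z)%C
        by (destruct z; apply injective_projections; simpl; ring).
      replace (1 * z + 0)%C with z by ring.
      replace ((- z) ^ (2 * h))%C with (z ^ (2 * h))%C.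
      + field. now split.
      + rewrite !Cpow_mult_r. f_equal. simpl; ring. }
  replace ((A + B / 5 ^ h) / 2 - (1 + / (5 ^ h * z ^ (2 * h))))%C
    with (/ 2 * ((A - 2) + (/ 5 ^ h * B - 2 / (5 ^ h * z ^ (2 * h)))))%C
    by (field; now split).
  rewrite Cmod_mult. replace (Cmod (/ 2)) with (/ 2).
  2:{ rewrite Cmod_inv, Cmod_R, Rabs_pos_eq; try lra. injection; lra. }
  assert (Htr := Cmod_triangle (A - 2) (/ 5 ^ h * B - 2 / (5 ^ h * z ^ (2 * h)))).
  lra.
Qed.

Lemma Re_ge_of_Cmod w v e : Cmod (w - v) <= e -> Re v - e <= Re w.
Proof.
  intros H. assert (Hr := re_le_Cmod (w - v)). apply Rabs_le_between in Hr.
  destruct w, v; unfold Re in *; simpl in *. lra.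
Qed.

(** For [z = i y] with [y^2 >= 1/5] both forms are at least [a^2 + 5 b^2], hence at
    least [sqrt 20 |a b|], and [z^(2 h) > 0] because [h] is even. *)
Lemma Fricke5_pos_imaginary_axis h y : (2 <= h)%nat -> Nat.Even h -> 0 < y -> / 5 <= y ^ 2 ->
  0 < Re (Eisenstein_Fricke5 (2 * h) (0, y)).
Proof.
  intros Hh [j Hj] Hy0 Hy.
  assert (Hz : upper_half_plane (0, y)) by exact Hy0.
  assert (H : Cmod (Eisenstein_Fricke5 (2 * h) (0, y) -
            (1 + / (5 ^ h * (0, y) ^ (2 * h)))) <= 16 / 20).
  { apply Fricke5_main_term; trivial; try lra; intros a b; rewrite Cmod2_linear_form;
      unfold Re, Im; simpl fst; simpl snd.
    - assert (a ^ 2 + 5 * b ^ 2 <= (5 * b * 0 + a) ^ 2 + (5 * b * y) ^ 2).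
      { assert (0 <= b ^ 2 * (y ^ 2 - / 5)) by (apply Rmult_le_pos; [apply pow2_ge_0|lra]).
        nra. }
      assert (0 <= a ^ 2 + 5 * b ^ 2) by nra.
      apply Rle_trans with ((a ^ 2 + 5 * b ^ 2) ^ 2); [|apply pow_incr; lra].
      assert (0 <= (a ^ 2 - 5 * b ^ 2) ^ 2) by apply pow2_ge_0. nra.
    - assert (a ^ 2 + 5 * b ^ 2 <= 5 * ((a * 0 + b) ^ 2 + (a * y) ^ 2)).
      { assert (0 <= a ^ 2 * (y ^ 2 - / 5)) by (apply Rmult_le_pos; [apply pow2_ge_0|lra]).
        nra. }
      assert (0 <= a ^ 2 + 5 * b ^ 2) by nra.
      apply Rle_trans with ((a ^ 2 + 5 * b ^ 2) ^ 2); [|apply pow_incr; lra].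
      assert (0 <= (a ^ 2 - 5 * b ^ 2) ^ 2) by apply pow2_ge_0. nra. }
  apply Re_ge_of_Cmod in H.
  assert (E : ((0, y) ^ (2 * h))%C = RtoC (y ^ (2 * h))).
  { rewrite Cpow_mult_r. replace ((0, y) ^ 2)%C with (RtoC (- y ^ 2))
      by (apply injective_projections; simpl; ring).
    rewrite <- RtoC_pow, pow_mult. f_equal. subst h. rewrite !pow_mult. f_equal. ring. }
  rewrite E, <- RtoC_pow, <- RtoC_mult, <- RtoC_inv, <- RtoC_plus in H.
  2:{ apply Rgt_not_eq, Rmult_gt_0_compat; apply pow_lt; lra. }
  match type of H with Re (RtoC ?r) - _ <= _ => change (Re (RtoC r)) with r in H end.
  assert (0 < / (5 ^ h * y ^ (2 * h))).
  { apply Rinv_0_lt_compat, Rmult_lt_0_compat; apply pow_lt; lra. }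
  lra.
Qed.

Lemma AM_GM_linear_form c d z : Rabs (Re z) <= 1 -> 2 <= Im z ->
  4 * (c ^ 2 * d ^ 2) <= (Cmod (RtoC c * z + RtoC d) ^ 2) ^ 2.
Proof.
  intros Hx Hy. rewrite Cmod2_linear_form. apply Rabs_le_between in Hx.
  set (x := Re z) in *. set (y := Im z) in *.
  set (Q := (c * x + d) ^ 2 + (c * y) ^ 2).
  assert (H1 : 0 <= Q - 2 * (c * d)).
  { replace (Q - 2 * (c * d)) with ((d + c * (x - 1)) ^ 2 + c ^ 2 * (y ^ 2 + 2 * x - 1))
      by (unfold Q; ring).
    apply Rplus_le_le_0_compat; [apply pow2_ge_0|].
    apply Rmult_le_pos; [apply pow2_ge_0|nra]. }
  assert (H2 : 0 <= Q + 2 * (c * d)).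
  { replace (Q + 2 * (c * d)) with ((d + c * (x + 1)) ^ 2 + c ^ 2 * (y ^ 2 - 2 * x - 1))
      by (unfold Q; ring).
    apply Rplus_le_le_0_compat; [apply pow2_ge_0|].
    apply Rmult_le_pos; [apply pow2_ge_0|nra]. }
  assert (0 <= (Q - 2 * (c * d)) * (Q + 2 * (c * d))) by now apply Rmult_le_pos. nra.
Qed.

Lemma Fricke5_near_cusp h z : (2 <= h)%nat -> Rabs (Re z) <= 1 -> 2 <= Im z ->
  / 2 <= Re (Eisenstein_Fricke5 (2 * h) z).
Proof.
  intros Hh Hx Hy. assert (Hz : upper_half_plane z) by (unfold upper_half_plane; lra).
  assert (H : Cmod (Eisenstein_Fricke5 (2 * h) z -
            (1 + / (5 ^ h * z ^ (2 * h)))) <= 16 / 100).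
  { apply Fricke5_main_term; trivial; try lra; intros a b.
    - assert (Ha := AM_GM_linear_form (5 * b) a z Hx Hy). nra.
    - assert (Ha := AM_GM_linear_form a b z Hx Hy). nra. }
  apply Re_ge_of_Cmod in H.
  assert (Hz0 : z <> RtoC 0).
  { intros ->. unfold upper_half_plane, Im in Hz; simpl in Hz; lra. }
  assert (Hc : Cmod (/ (5 ^ h * z ^ (2 * h))) <= / 5).
  { rewrite Cmod_inv, Cmod_mult, !Cmod_pow, Cmod_R, Rabs_pos_eq, pow_mult, <- Rpow_mult_distr.
    - assert (Hm : 4 <= Cmod z ^ 2) by (rewrite Cmod2_alt; nra).
      eapply Rle_trans; [apply (inv_pow_le 1); [lia|lra]|].
      apply Rinv_le_contravar; lra.
    - lra.
    - apply Cmod_gt_0. rewrite Cmod_mult, !Cmod_pow, Cmod_R, Rabs_pos_eq by lra.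
      apply Cmod_gt_0 in Hz0. apply Rmult_lt_0_compat; apply pow_lt; lra. }
  assert (Hr := re_le_Cmod (/ (5 ^ h * z ^ (2 * h)))). apply Rabs_le_between in Hr.
  set (u := (/ (5 ^ h * z ^ (2 * h)))%C) in *.
  replace (Re (1 + u)) with (1 + Re u) in H by (destruct u; unfold Re; simpl; ring).
  lra.
Qed.

(** ** The series of the terms [(5 b z + a)^-k] on the arcs *)

(** While [n |x| <= sqrt 2] the argument of [(1 + i x)^n] stays in a quadrant. *)
Lemma Re_pow_one_plus_ix x n : (INR n * x) ^ 2 <= 2 ->
  exists J, Im ((1, x) ^ n)%C = x * J /\ 0 <= J <= INR n /\
            1 - (INR n * x) ^ 2 / 2 <= Re ((1, x) ^ n)%C <= 1.
Proof.
  induction n as [|n IH]; intros H.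
  - exists 0. unfold Im, Re; simpl. split; [ring|]. split; [lra|nra].
  - rewrite S_INR in *. assert (Hn := pos_INR n).
    assert (Hle : (INR n * x) ^ 2 <= 2) by nra.
    destruct (IH Hle) as (J & HJ & HJ1 & HR).
    rewrite Cpow_S. set (w := ((1, x) ^ n)%C) in *. destruct w as [u v].
    unfold Im, Re in *; simpl in *. exists (J + u).
    assert (0 <= u) by nra. assert (0 <= x * x) by nra.
    subst v. split; [ring|]. split; [lra|]. split; nra.
Qed.

Lemma Re_inv w : w <> RtoC 0 -> Re (/ w)%C = Re w / Cmod w ^ 2.
Proof.
  intros H. rewrite Cmod2_alt. destruct w as [u v]; unfold Re, Im; simpl.
  field. intros E. apply H. apply injective_projections; simpl; nra.
Qed.

(** With [n = 2 h]: if [n |b| <= sqrt 2] the argument of [(a + i b)^n] is too small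
    for the real part to be negative; otherwise Bernoulli's inequality gives
    [|a + i b|^n >= 1 + n |b| / 2 >= 17/10]. *)
Lemma Re_inv_pow_ge h (a b : R) : 1 <= a -> 1 + Rabs b <= a ^ 2 + b ^ 2 ->
  - (10 / 17) <= Re (/ (a, b) ^ (2 * h))%C.
Proof.
  intros Ha Hab.
  assert (Hq : ((a, b) : C) <> RtoC 0) by (intros E; injection E; lra).
  set (n := (2 * h)%nat).
  assert (Hqn : ((a, b) ^ n)%C <> RtoC 0) by now apply Cpow_nz.
  destruct (Rle_dec ((INR n * (b / a)) ^ 2) 2) as [Hs|Hs].
  - destruct (Re_pow_one_plus_ix (b / a) n Hs) as (J & _ & _ & HR).
    assert (0 <= Re (/ (a, b) ^ n)%C); [|lra].
    rewrite Re_inv by trivial.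
    set (q1 := (1, b / a) : C) in *.
    replace ((a, b) ^ n)%C with (RtoC (a ^ n) * q1 ^ n)%C.
    2:{ rewrite RtoC_pow, <- Cpow_mult_l. f_equal.
        unfold q1; apply injective_projections; simpl; field; lra. }
    assert (0 < a ^ n) by (apply pow_lt; lra).
    apply Rmult_le_pos.
    + set (w := (q1 ^ n)%C) in *. destruct w as [u v]; unfold Re in *; simpl in *. nra.
    + left. apply Rinv_0_lt_compat, pow_lt, Cmod_gt_0.
      apply Cmult_neq_0; [intros E; injection E; lra|].
      apply Cpow_nz. unfold q1; intros E; injection E; lra.
  - apply Rnot_le_lt in Hs.
    assert (Hn : 14 / 10 <= INR n * Rabs b).
    { apply Rnot_lt_le; intros Hlt. apply (Rlt_irrefl 2).
      eapply Rlt_trans; [apply Hs|].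
      assert (Hn := pos_INR n). assert (Hb := Rabs_pos b).
      assert (Hba : (b / a) ^ 2 <= Rabs b ^ 2).
      { rewrite pow2_abs. unfold Rdiv. rewrite Rpow_mult_distr.
        assert (0 < / a <= 1).
        { split; [apply Rinv_0_lt_compat; lra|]. rewrite <- Rinv_1.
          apply Rinv_le_contravar; lra. }
        assert (0 <= b ^ 2) by nra. assert ((/ a) ^ 2 <= 1) by nra. nra. }
      rewrite (Rpow_mult_distr (INR n)).
      assert (INR n ^ 2 * (b / a) ^ 2 <= INR n ^ 2 * Rabs b ^ 2).
      { apply Rmult_le_compat_l; trivial. nra. }
      assert (0 <= INR n * Rabs b) by nra. nra. }
    assert (Hc := re_le_Cmod (/ (a, b) ^ n)). apply Rabs_le_between in Hc.
    unfold n in *. rewrite Cmod_inv_even_pow in Hc by trivial.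
    assert (Hmod : Cmod (a, b) ^ 2 = a ^ 2 + b ^ 2) by (rewrite Cmod2_alt; trivial).
    rewrite Hmod in Hc.
    assert (Hber : 1 + INR h * Rabs b <= (a ^ 2 + b ^ 2) ^ h).
    { assert (Hb := Rabs_pos b). destruct (Req_dec (Rabs b) 0) as [E|E].
      - rewrite E in *. rewrite Rmult_0_r in Hn. lra.
      - apply Rle_trans with ((1 + Rabs b) ^ h); [apply poly; lra|].
        apply pow_incr; lra. }
    rewrite mult_INR in Hn. simpl (INR 2) in Hn.
    assert (/ (a ^ 2 + b ^ 2) ^ h <= / (17 / 10)) by (apply Rinv_le_contravar; lra).
    lra.
Qed.

(** Up to sign the terms are [1], [(5 z + 2)^(-k)], of modulus 1 at the corner
    [-2/5 + i/5], and [(5 z + 3)^(-k)], of the same modulus as the second one at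
    [-1/2 + i/(2 sqrt 5)]. *)
Definition Fricke5_main_indices : list (Z * Z) :=
  ((1, 0) :: (-1, 0) :: (2, 1) :: (-2, -1) :: (3, 1) :: (-3, -1) :: nil)%Z.

Lemma Fricke5_main_indices_spec :
  NoDup Fricke5_main_indices /\ Forall Fricke5_index Fricke5_main_indices.
Proof.
  split.
  - unfold Fricke5_main_indices.
    repeat constructor; simpl; intuition discriminate.
  - unfold Fricke5_main_indices. repeat constructor; cbn [fst snd]; trivial;
      intros [q Hq]; lia.
Qed.

(** The coordinates are [(m, b) = (a - 2 b, b)], in which [|5 b z + a|^2] becomes
    [m^2 + b^2] at the corner [-2/5 + i/5]. The condition [2 m <> b] is what is
    retained of [a] being prime to 5. *)
Definition Fricke5_rest (p : Z * Z) : Prop :=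
  (fst p <> 0 /\ snd p <> 0 /\ 2 * fst p <> snd p /\
   p <> (1, 1) /\ p <> (-1, -1))%Z.

Lemma Fricke5_rest_of_index a b : Fricke5_index (a, b) ->
  ~ In (a, b) Fricke5_main_indices -> Fricke5_rest (a - 2 * b, b)%Z.
Proof.
  intros Hi Hin. destruct Hi as [H H5]; cbn [fst snd] in *.
  unfold Fricke5_main_indices in Hin. simpl in Hin.
  unfold Fricke5_rest; cbn [fst snd].
  assert (Hb : b <> 0%Z).
  { intros ->. rewrite Z.gcd_0_r in H.
    assert (Ha : (a = 1 \/ a = -1)%Z) by lia. destruct Ha as [-> | ->]; tauto. }
  repeat split; trivial.
  - intros E. replace a with (2 * b)%Z in * by lia.
    assert (Hg : Z.gcd (2 * b) b = Z.abs b).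
    { rewrite Z.gcd_comm. rewrite <- (Z.gcd_0_r b).
      replace (2 * b)%Z with (0 + 2 * b)%Z by lia. apply Z.gcd_add_mult_diag_r. }
    rewrite Hg in H. assert (Hb1 : (b = 1 \/ b = -1)%Z) by lia.
    destruct Hb1 as [-> | ->]; simpl in Hin; tauto.
  - intros E. apply H5. exists (a - 2 * b)%Z. lia.
  - intros E. apply pair_equal_spec in E. destruct E as [E1 E2].
    assert (a = 3%Z) by lia. subst. tauto.
  - intros E. apply pair_equal_spec in E. destruct E as [E1 E2].
    assert (a = (-3)%Z) by lia. subst. tauto.
Qed.

Lemma Fricke5_main_terms h z A w M : upper_half_plane z ->
  has_Csum Fricke5_index (Fricke5_term (2 * h) z) A ->
  (forall m b, Fricke5_rest (m, b) ->
     / (Cmod (RtoC (5 * IZR b) * z + RtoC (IZR m + 2 * IZR b)) ^ 2) ^ h <= w (m, b)) ->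
  (forall l, NoDup l -> Forall Fricke5_rest l -> Rsum_list w l <= M) ->
  Cmod (A - 2 * (1 + / (5 * z + 2) ^ (2 * h) + / (5 * z + 3) ^ (2 * h))) <= M.
Proof.
  intros Hz HA Hw HM. destruct Fricke5_main_indices_spec as [H1 H2].
  assert (Hlin : forall c : R, (5 * z + c)%C <> RtoC 0).
  { intros c. replace (RtoC 5) with (RtoC (IZR 5)) by trivial.
    apply linear_form_neq0; trivial. left; lra. }
  replace (2 * (1 + / (5 * z + 2) ^ (2 * h) + / (5 * z + 3) ^ (2 * h)))%C
    with (Csum_list (Fricke5_term (2 * h) z) Fricke5_main_indices).
  - apply has_Csum_main_terms with Fricke5_index; trivial.
    intros r Hn HD Hr.
    set (g := fun p : Z * Z => (fst p - 2 * snd p, snd p)%Z).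
    apply Rle_trans with (Rsum_list w (map g r)).
    + rewrite Rsum_list_map. apply Rsum_list_le. intros [a b] Hin.
      rewrite Forall_forall in HD. specialize (HD _ Hin). specialize (Hr _ Hin).
      unfold Fricke5_term, Eisenstein_term, g. cbn [fst snd].
      rewrite Cmod_inv_even_pow.
      * eapply Rle_trans; [|apply Hw; now apply Fricke5_rest_of_index].
        right. do 4 f_equal. rewrite mult_IZR, minus_IZR, mult_IZR. f_equal. f_equal. ring.
      * apply linear_form_neq0; trivial.
        apply (coprime_pair_neq0 (5 * b, a)%Z). unfold coprime_pair; cbn [fst snd].
        now apply gcd_mul5.
    + apply HM.
      * apply FinFun.Injective_map_NoDup; trivial. intros [a b] [a' b'] E.
        unfold g in E. apply pair_equal_spec in E; cbn [fst snd] in E. f_equal; lia.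
      * rewrite Forall_map. rewrite Forall_forall in *. intros [a b] Hin.
        apply Fricke5_rest_of_index; auto.
  - unfold Csum_list, Fricke5_main_indices, Fricke5_term, Eisenstein_term.
    cbn [map fold_right fst snd].
    replace (IZR (5 * 0) * z + 1)%C with (RtoC 1)
      by (destruct z; apply injective_projections; simpl; ring).
    replace (IZR (5 * 0) * z + IZR (-1))%C with (- RtoC 1)%C
      by (destruct z; apply injective_projections; simpl; ring).
    change (IZR (5 * 1)) with 5.
    replace (IZR (5 * -1) * z + IZR (-2))%C with (- (5 * z + 2))%C
      by (destruct z; apply injective_projections; simpl; ring).
    replace (IZR (5 * -1) * z + IZR (-3))%C with (- (5 * z + 3))%C
      by (destruct z; apply injective_projections; simpl; ring).
    assert (Hopp : forall u, ((- u) ^ (2 * h) = u ^ (2 * h))%C).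
    { intros u. rewrite !Cpow_mult_r. f_equal. simpl; ring. }
    rewrite !Hopp, Cpow_1_l. field.
    split; apply Cpow_nz; apply Hlin.
Qed.

(** In these halves of the two arcs the equation of the circle is written as a
    formula for [|z|^2], affine in [Re z]. *)
Definition on_arc1 (z : C) : Prop :=
  upper_half_plane z /\ Cmod z ^ 2 = / 5 /\ - (2 / 5) <= Re z <= 0.
Definition on_arc2 (z : C) : Prop :=
  upper_half_plane z /\ Cmod z ^ 2 = - Re z - / 5 /\ - (1 / 2) <= Re z <= - (2 / 5).

(** The form is a convex combination of its values at the two ends of the arc:
    [a^2 + 5 b^2], [m^2 + b^2] and [m^2 - m b + 3/2 b^2] at [i/sqrt 5], at the corner
    and at [-1/2 + i/(2 sqrt 5)]. *)
Lemma arc_quadratic_form z (m b : R) : on_arc1 z \/ on_arc2 z ->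
  (m * b <= 0 -> - 2 * (m * b) <= Cmod (RtoC (5 * b) * z + RtoC (m + 2 * b)) ^ 2) /\
  (0 <= m * b -> 7 / 5 * (m * b) <= Cmod (RtoC (5 * b) * z + RtoC (m + 2 * b)) ^ 2).
Proof.
  intros Hz. rewrite Cmod2_linear_form.
  unfold on_arc1, on_arc2 in Hz. rewrite !Cmod2_alt in Hz.
  set (x := Re z) in *. set (y := Im z) in *.
  set (N := (5 * b * x + (m + 2 * b)) ^ 2 + (5 * b * y) ^ 2).
  destruct Hz as [(_ & E & Hx)|(_ & E & Hx)].
  - assert (HN : N = (1 + 5 / 2 * x) * (m ^ 2 + 4 * m * b + 9 * b ^ 2)
                     + (- (5 / 2) * x) * (m ^ 2 + b ^ 2)).
    { unfold N. replace ((5 * b * y) ^ 2) with (25 * b ^ 2 * y ^ 2) by ring.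
      replace (y ^ 2) with (/ 5 - x ^ 2) by lra. field. }
    assert (H1 : 0 <= 1 + 5 / 2 * x) by lra. assert (H2 : 0 <= - (5 / 2) * x) by lra.
    rewrite HN. split; intros Hmb.
    + assert (P1 := Rmult_le_pos _ _ H1 (pow2_ge_0 (m + 3 * b))).
      assert (P2 := Rmult_le_pos _ _ H2 (pow2_ge_0 (m + b))). lra.
    + assert (P1 := Rmult_le_pos _ _ H1 (pow2_ge_0 (m - 3 * b))).
      assert (P2 := Rmult_le_pos _ _ H2 (pow2_ge_0 (m - b))).
      assert (P3 := Rmult_le_pos _ _ H1 Hmb). lra.
  - assert (HN : N = (5 + 10 * x) * (m ^ 2 + b ^ 2)
                     + (- 4 - 10 * x) * (m ^ 2 - m * b + 3 / 2 * b ^ 2)).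
    { unfold N. replace ((5 * b * y) ^ 2) with (25 * b ^ 2 * y ^ 2) by ring.
      replace (y ^ 2) with (- x - / 5 - x ^ 2) by lra. field. }
    assert (H1 : 0 <= 5 + 10 * x) by lra. assert (H2 : 0 <= - 4 - 10 * x) by lra.
    rewrite HN. split; intros Hmb.
    + assert (P1 := Rmult_le_pos _ _ H1 (pow2_ge_0 (m + b))).
      assert (P2 := Rmult_le_pos _ _ H2 (pow2_ge_0 (m + b))).
      assert (P3 := Rmult_le_pos _ _ H2 (pow2_ge_0 b)).
      assert (P4 : 0 <= (- 4 - 10 * x) * - (m * b)) by (apply Rmult_le_pos; lra). lra.
    + assert (P1 := Rmult_le_pos _ _ H1 (pow2_ge_0 (m - b))).
      assert (P2 := Rmult_le_pos _ _ H2 (pow2_ge_0 (m - 6 / 5 * b))).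
      assert (P3 := Rmult_le_pos _ _ H2 (pow2_ge_0 b)).
      assert (P4 := Rmult_le_pos _ _ H1 Hmb). lra.
Qed.

(** With [5 z + 2 = i (p - i q)], [p = 5 Im z] and [q = 5 Re z + 2], the first two
    claims are the hypotheses of [Re_inv_pow_ge]. *)
Lemma arc_first_terms z : on_arc1 z \/ on_arc2 z ->
  1 <= 5 * Im z /\ 1 + Rabs (5 * Re z + 2) <= (5 * Im z) ^ 2 + (5 * Re z + 2) ^ 2 /\
  3 / 2 <= Cmod (5 * z + 3) ^ 2.
Proof.
  intros Hz. rewrite Cmod2_linear_form.
  unfold on_arc1, on_arc2, upper_half_plane in Hz. rewrite !Cmod2_alt in Hz.
  set (x := Re z) in *. set (y := Im z) in *.
  assert (Hy : 0 < y -> 1 <= (5 * y) ^ 2 -> 1 <= 5 * y) by (intros; nra).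
  destruct Hz as [(H & E & Hx)|(H & E & Hx)].
  - rewrite Rabs_pos_eq by lra. repeat split; [apply Hy; trivial|nra|nra]. nra.
  - rewrite Rabs_left1 by lra. repeat split; [apply Hy; trivial|nra|nra]. nra.
Qed.

(** ** Positivity of the real part of the first series *)

Definition inv_fourth_pos (n : Z) : R := if (0 <? n)%Z then / IZR n ^ 4 else 0.

Lemma inv_fourth_pos_ge0 n : 0 <= inv_fourth_pos n.
Proof.
  unfold inv_fourth_pos. destruct (Z.ltb_spec 0 n); [|lra].
  left. apply Rinv_0_lt_compat, pow_lt. assert (1 <= IZR n) by (apply IZR_ge1; lia). lra.
Qed.

Lemma Rsum_list_inv_fourth_pos l : NoDup l -> Rsum_list inv_fourth_pos l <= 8 / 7.
Proof.
  intros Hn. replace (8 / 7) with (0 + 8 / 7 + 0) by ring.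
  apply Rsum_list_half_lines; trivial.
  - apply inv_fourth_pos_ge0.
  - unfold inv_fourth_pos; simpl; lra.
  - intros l' H1 H2. eapply Rle_trans; [|apply (Rsum_list_inv_fourth l'); trivial].
    apply Rsum_list_le. intros n Hin. unfold inv_fourth_pos.
    destruct (Z.ltb_spec 0 n); [lra|]. specialize (H2 n Hin). lia.
  - intros l' H1 H2. rewrite Rsum_list_const0; [lra|].
    intros n Hin. specialize (H2 n Hin). unfold inv_fourth_pos.
    destruct (Z.ltb_spec 0 (- n)); [lia|trivial].
Qed.

Lemma Rsum_list_inv_fourth_pairs l : NoDup l ->
  Rsum_list (fun p => inv_fourth_pos (fst p) * inv_fourth_pos (snd p)) l <= 64 / 49.
Proof.
  intros Hn. replace (64 / 49) with (8 / 7 * (8 / 7)) by field.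
  apply Rsum_list_product; trivial; try lra; try apply inv_fourth_pos_ge0;
    apply Rsum_list_inv_fourth_pos.
Qed.

Lemma Rsum_list_inv_fourth_pairs_but_1 l : NoDup l -> ~ In (1, 1)%Z l ->
  Rsum_list (fun p => inv_fourth_pos (fst p) * inv_fourth_pos (snd p)) l <= 15 / 49.
Proof.
  intros Hn H1.
  assert (H := Rsum_list_inv_fourth_pairs ((1, 1)%Z :: l) ltac:(now constructor)).
  unfold Rsum_list in *; simpl in *. unfold inv_fourth_pos at 1 2 in H; simpl in H. lra.
Qed.

(** Majorant, in the coordinates [(m, b)], of the terms of exponent 8 or more on
    the arcs; the two signs of [m b] are those of [arc_quadratic_form]. *)
Definition arc_majorant (p : Z * Z) : R :=
  let q := inv_fourth_pos in let (m, b) := p in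
  625 / 2401 * (q m * q b + q (- m)%Z * q (- b)%Z) +
  / 16 * (q m * q (- b)%Z + q (- m)%Z * q b).

Lemma Rsum_list_arc_majorant l : NoDup l -> Forall Fricke5_rest l ->
  Rsum_list arc_majorant l <= 2 * (625 / 2401 * (15 / 49)) + 2 * (/ 16 * (64 / 49)).
Proof.
  intros Hn HD. rewrite Forall_forall in HD.
  set (q := inv_fourth_pos).
  assert (Hmap : forall (g : Z * Z -> Z * Z),
     (forall p p', g p = g p' -> p = p') -> NoDup (map g l)).
  { intros g Hg. now apply FinFun.Injective_map_NoDup. }
  assert (E1 : Rsum_list (fun p => q (fst p) * q (snd p)) l <= 15 / 49).
  { apply Rsum_list_inv_fourth_pairs_but_1; trivial.
    intros Hin. destruct (HD _ Hin) as (_ & _ & _ & H & _). auto. }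
  assert (E2 : Rsum_list (fun p => q (- fst p)%Z * q (- snd p)%Z) l <= 15 / 49).
  { rewrite <- (Rsum_list_map (fun p => (- fst p, - snd p)%Z)
                 (fun p => q (fst p) * q (snd p))).
    apply Rsum_list_inv_fourth_pairs_but_1.
    - apply Hmap. intros [a b] [a' b'] E. apply pair_equal_spec in E.
      cbn [fst snd] in E. f_equal; lia.
    - intros Hin. apply in_map_iff in Hin. destruct Hin as ([a b] & E & Hin).
      apply pair_equal_spec in E. cbn [fst snd] in E.
      destruct (HD _ Hin) as (_ & _ & _ & _ & H). apply H. f_equal; lia. }
  assert (E3 : Rsum_list (fun p => q (fst p) * q (- snd p)%Z) l <= 64 / 49).
  { rewrite <- (Rsum_list_map (fun p => (fst p, - snd p)%Z)
                 (fun p => q (fst p) * q (snd p))).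
    apply Rsum_list_inv_fourth_pairs.
    apply Hmap. intros [a b] [a' b'] E. apply pair_equal_spec in E.
    cbn [fst snd] in E. f_equal; lia. }
  assert (E4 : Rsum_list (fun p => q (- fst p)%Z * q (snd p)) l <= 64 / 49).
  { rewrite <- (Rsum_list_map (fun p => (- fst p, snd p)%Z)
                 (fun p => q (fst p) * q (snd p))).
    apply Rsum_list_inv_fourth_pairs.
    apply Hmap. intros [a b] [a' b'] E. apply pair_equal_spec in E.
    cbn [fst snd] in E. f_equal; lia. }
  replace (Rsum_list arc_majorant l) with
    (625 / 2401 * (Rsum_list (fun p => q (fst p) * q (snd p)) l +
                   Rsum_list (fun p => q (- fst p)%Z * q (- snd p)%Z) l) +
     / 16 * (Rsum_list (fun p => q (fst p) * q (- snd p)%Z) l +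
             Rsum_list (fun p => q (- fst p)%Z * q (snd p)) l)).
  - lra.
  - rewrite <- !Rsum_list_plus, <- !Rsum_list_scal, <- Rsum_list_plus.
    unfold Rsum_list; f_equal. apply map_ext. intros [a b]; reflexivity.
Qed.

Lemma inv_pow_majorant (h : nat) N (c m b : R) :
  (4 <= h)%nat -> 1 <= m -> 1 <= b -> 1 <= c -> c * (m * b) <= N ->
  / N ^ h <= / c ^ 4 * (/ m ^ 4 * / b ^ 4).
Proof.
  intros Hh Hm Hb Hc HN.
  assert (1 <= m * b) by nra. assert (1 <= c * (m * b)) by nra.
  eapply Rle_trans; [apply (inv_pow_le 4); trivial; lra|].
  rewrite <- !Rinv_mult, <- !Rpow_mult_distr.
  apply Rinv_le_contravar; [apply pow_lt; lra|]. apply pow_incr; lra.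
Qed.

Lemma arc_majorant_bounds h z m b : (4 <= h)%nat -> on_arc1 z \/ on_arc2 z ->
  Fricke5_rest (m, b) ->
  / (Cmod (RtoC (5 * IZR b) * z + RtoC (IZR m + 2 * IZR b)) ^ 2) ^ h <= arc_majorant (m, b).
Proof.
  intros Hh Hz (Hm & Hb & _); cbn [fst snd] in *.
  destruct (arc_quadratic_form z (IZR m) (IZR b) Hz) as [Hneg Hpos].
  set (N := Cmod _ ^ 2) in *. unfold arc_majorant, inv_fourth_pos.
  assert (S : forall n, (0 < n)%Z -> 1 <= IZR n) by (intros; apply IZR_ge1; lia).
  assert (S' : forall n, (n < 0)%Z -> 1 <= IZR (- n)) by (intros; apply IZR_ge1; lia).
  assert (C1 : 625 / 2401 = / (7 / 5) ^ 4) by field.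
  assert (C2 : / 16 = / 2 ^ 4) by (f_equal; ring).
  destruct (Z.ltb_spec 0 m), (Z.ltb_spec 0 b), (Z.ltb_spec 0 (- m)), (Z.ltb_spec 0 (- b));
    try lia; rewrite C1, C2.
  - assert (A1 := S m ltac:(lia)). assert (A2 := S b ltac:(lia)).
    assert (H3 := inv_pow_majorant h N (7/5) (IZR m) (IZR b) Hh A1 A2 ltac:(lra)).
    specialize (Hpos ltac:(nra)). specialize (H3 ltac:(lra)). lra.
  - assert (A1 := S m ltac:(lia)). assert (A2 := S' b ltac:(lia)).
    assert (H3 := inv_pow_majorant h N 2 (IZR m) (IZR (- b)) Hh A1 A2 ltac:(lra)).
    rewrite opp_IZR in *. specialize (Hneg ltac:(nra)). specialize (H3 ltac:(lra)). lra.
  - assert (A1 := S' m ltac:(lia)). assert (A2 := S b ltac:(lia)).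
    assert (H3 := inv_pow_majorant h N 2 (IZR (- m)) (IZR b) Hh A1 A2 ltac:(lra)).
    rewrite opp_IZR in *. specialize (Hneg ltac:(nra)). specialize (H3 ltac:(lra)). lra.
  - assert (A1 := S' m ltac:(lia)). assert (A2 := S' b ltac:(lia)).
    assert (H3 := inv_pow_majorant h N (7/5) (IZR (- m)) (IZR (- b)) Hh A1 A2 ltac:(lra)).
    rewrite !opp_IZR in *. specialize (Hpos ltac:(nra)). specialize (H3 ltac:(lra)). lra.
Qed.

Lemma Re_plus u v : Re (u + v)%C = Re u + Re v.
Proof. destruct u, v; reflexivity. Qed.

Lemma Re_double u : Re (2 * u)%C = 2 * Re u.
Proof. destruct u; unfold Re; simpl; ring. Qed.

(** The three bounds leave
    [2 (1 - 10/17 - 16/81) - 2 (625/2401 * 15/49 + 1/16 * 64/49) > 0]. *)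
Lemma Re_first_series_pos h z A : (4 <= h)%nat -> Nat.Even h -> on_arc1 z \/ on_arc2 z ->
  has_Csum Fricke5_index (Fricke5_term (2 * h) z) A -> 0 < Re A.
Proof.
  intros Hh [j Hj] Hz HA.
  assert (Huhp : upper_half_plane z) by (destruct Hz as [[H _]|[H _]]; trivial).
  assert (Hmain := Fricke5_main_terms h z A arc_majorant _ Huhp HA
     (fun m b => arc_majorant_bounds h z m b Hh Hz) Rsum_list_arc_majorant).
  apply Re_ge_of_Cmod in Hmain. rewrite Re_double, !Re_plus in Hmain.
  destruct (arc_first_terms z Hz) as (H1 & H2 & H3).
  assert (Ht : - (10 / 17) <= Re (/ (5 * z + 2) ^ (2 * h))%C).
  { replace ((5 * z + 2) ^ (2 * h))%C
      with (((5 * Im z, - (5 * Re z + 2))%R : C) ^ (2 * h))%C.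
    - apply Re_inv_pow_ge; trivial. rewrite Rabs_Ropp. lra.
    - rewrite !Cpow_mult_r. subst h. rewrite !Cpow_mult_r. f_equal.
      destruct z; unfold Re, Im; apply injective_projections; simpl; ring. }
  assert (Hs : - (16 / 81) <= Re (/ (5 * z + 3) ^ (2 * h))%C).
  { assert (H0 : (5 * z + 3)%C <> RtoC 0).
    { apply linear_form_neq0; trivial. left; lra. }
    assert (Hr := re_le_Cmod (/ (5 * z + 3) ^ (2 * h))). apply Rabs_le_between in Hr.
    rewrite Cmod_inv_even_pow in Hr by trivial.
    assert (/ (Cmod (5 * z + 3) ^ 2) ^ h <= 16 / 81); [|lra].
    eapply Rle_trans; [apply (inv_pow_le 4); trivial; lra|].
    replace (16 / 81) with (/ (3 / 2) ^ 4) by field.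
    apply Rinv_le_contravar; [apply pow_lt; lra|]. apply pow_incr; lra. }
  change (Re 1) with 1 in Hmain. lra.
Qed.

(** ** The case of weight 4 *)

Lemma Rsum_list_symmetric (w : Z -> R) c P l :
  (forall m, w (c - m)%Z = w m) -> (forall m, (2 * m = c)%Z -> w m = 0) ->
  (forall l, NoDup l -> (forall m, In m l -> (c < 2 * m)%Z) -> Rsum_list w l <= P) ->
  NoDup l -> Rsum_list w l <= 2 * P.
Proof.
  intros Hsym H0 HP Hn.
  rewrite (Rsum_list_filter w (fun m => c <? 2 * m)%Z).
  set (l1 := filter (fun m => negb _) l).
  rewrite (Rsum_list_filter w (fun m => 2 * m <? c)%Z l1).
  assert (H1 : Rsum_list w (filter (fun m => c <? 2 * m)%Z l) <= P).
  { apply HP; [now apply NoDup_filter|]. intros m H. apply filter_In in H.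
    destruct H as [_ H]. apply Z.ltb_lt in H. lia. }
  assert (H2 : Rsum_list w (filter (fun m => 2 * m <? c)%Z l1) <= P).
  { set (l2 := filter _ l1).
    apply Rle_trans with (Rsum_list w (map (fun m => c - m)%Z l2)).
    - rewrite Rsum_list_map. apply Rsum_list_le. intros; rewrite Hsym; lra.
    - apply HP.
      + apply FinFun.Injective_map_NoDup; [intros a b; lia|].
        unfold l2, l1; now repeat apply NoDup_filter.
      + intros m H. apply in_map_iff in H. destruct H as (m' & <- & H).
        apply filter_In in H. destruct H as [_ H]. apply Z.ltb_lt in H. lia. }
  assert (H3 : Rsum_list w (filter (fun x => negb (2 * x <? c)%Z) l1) = 0).
  { apply Rsum_list_const0. intros m H. apply filter_In in H. destruct H as [H H'].
    apply filter_In in H. destruct H as [_ H]. apply H0.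
    apply Bool.negb_true_iff in H, H'. apply Z.ltb_ge in H, H'. lia. }
  lra.
Qed.

(** The inverse square of [|5 b z + a|^2 = ((2 m - b)^2 + 5 b^2) / 4], which is the
    form at [z = -1/2 + i/(2 sqrt 5)], and 0 at the indices outside
    [Fricke5_rest] where it would be too large. *)
Definition row_term (p : Z * Z) : R :=
  let (m, b) := p in
  if ((b =? 0) || (2 * m =? b) || ((Z.abs b =? 1) && (Z.abs (2 * m - b) =? 1)))%Z
  then 0 else 16 / ((2 * IZR m - IZR b) ^ 2 + 5 * IZR b ^ 2) ^ 2.

Lemma square_pos x : x <> 0 -> 0 < x ^ 2.
Proof. intros H. destruct (Rdichotomy _ _ H); nra. Qed.

Lemma row_term_ge0 p : 0 <= row_term p.
Proof.
  destruct p as [m b]. unfold row_term.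
  destruct (Z.eqb_spec b 0); cbn [orb]; [lra|].
  destruct (_ || _)%bool; [lra|].
  assert (IZR b <> 0) by now apply not_0_IZR.
  apply Rlt_le, Rdiv_lt_0_compat; [lra|]. apply pow_lt.
  assert (Hq := square_pos _ H). assert (Hp := pow2_ge_0 (2 * IZR m - IZR b)). lra.
Qed.

Lemma row_term_opp m b : row_term (- m, - b)%Z = row_term (m, b).
Proof.
  unfold row_term.
  replace (- b =? 0)%Z with (b =? 0)%Z by (destruct (Z.eqb_spec b 0), (Z.eqb_spec (- b) 0); lia).
  replace (2 * - m =? - b)%Z with (2 * m =? b)%Z
    by (destruct (Z.eqb_spec (2 * m) b), (Z.eqb_spec (2 * - m) (- b)); lia).
  replace (Z.abs (- b)) with (Z.abs b) by lia.
  replace (Z.abs (2 * - m - - b)) with (Z.abs (2 * m - b)) by lia.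
  destruct (_ || _)%bool; trivial. rewrite !opp_IZR. f_equal. f_equal. ring.
Qed.

Lemma row_term_reflect m b : row_term (b - m, b)%Z = row_term (m, b).
Proof.
  unfold row_term.
  replace (2 * (b - m) =? b)%Z with (2 * m =? b)%Z
    by (destruct (Z.eqb_spec (2 * m) b), (Z.eqb_spec (2 * (b - m)) b); lia).
  replace (Z.abs (2 * (b - m) - b)) with (Z.abs (2 * m - b)) by lia.
  destruct (_ || _)%bool; trivial. rewrite minus_IZR. f_equal. f_equal. ring.
Qed.

Definition row_bound (b : Z) : R :=
  if (b =? 0)%Z then 0 else if (Z.abs b =? 1)%Z then 1 / 3
  else 512 / (275 * IZR (Z.abs b) ^ 3).

Lemma telescoping_step c X : 1 / 2 < X -> 0 <= c ->
  c / X ^ 2 <= c / (X - / 2) - c / (X + 1 - / 2).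
Proof.
  intros HX Hc.
  replace (c / (X - / 2) - c / (X + 1 - / 2)) with (c / (X ^ 2 - / 4)) by (field; nra).
  apply Rmult_le_compat_l; trivial. apply Rinv_le_contravar; nra.
Qed.

(** The tangent line bound [X^2 + 5 b^2 / 4 >= b (5 X / 4 + 55 b / 64)] for
    [X = m - b / 2] makes the row telescope; for [b = 1], where the two central
    terms are left out, [X^2 + 5 / 4 >= 3 X - 1] is better. *)
Lemma Rsum_list_row b l : NoDup l -> Rsum_list (fun m => row_term (m, b)) l <= row_bound b.
Proof.
  assert (Hpos : forall b, (0 < b)%Z -> forall l, NoDup l ->
            Rsum_list (fun m => row_term (m, b)) l <= row_bound b).
  { clear b l. intros b Hb l Hn.
    replace (row_bound b) with (2 * (row_bound b / 2)) by field.
    apply Rsum_list_symmetric with b; trivial.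
    { intros m; apply row_term_reflect. }
    { intros m Hm. unfold row_term. rewrite (proj2 (Z.eqb_eq _ _) Hm).
      now rewrite Bool.orb_true_r. }
    clear l Hn. intros l Hn Hl.
    destruct (Z.eq_dec b 1) as [->|Hb1].
    - replace (row_bound 1 / 2) with (1 / 6) by (unfold row_bound; simpl; field).
      pose (H := fun m => if (m =? 1)%Z then 1 / 6 else 1 / 9 / (IZR m - 4 / 3)).
      apply Rle_trans with (H 1%Z); [|unfold H; simpl; lra].
      apply (Rsum_list_telescope _ H); trivial.
      2:{ intros m Hm; specialize (Hl m Hm); lia. }
      intros m Hm. destruct (Z.eq_dec m 1) as [->|Hm1].
      { unfold row_term, H; simpl. lra. }
      assert (Hm2 : 2 <= IZR m) by (apply IZR_le; lia).
      unfold H. replace (m =? 1)%Z with false by (symmetry; apply Z.eqb_neq; lia).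
      replace (m + 1 =? 1)%Z with false by (symmetry; apply Z.eqb_neq; lia).
      repeat split; [apply row_term_ge0| |].
      + eapply Rle_trans.
        2:{ eapply Rle_trans; [apply (telescoping_step (1 / 9) (IZR m - 5 / 6)); lra|].
            right. rewrite plus_IZR. f_equal; f_equal; field. }
        unfold row_term.
        replace (_ || _)%bool with false.
        2:{ symmetry. repeat (apply orb_false_iff; split); apply Z.eqb_neq; lia. }
        replace (1 / 9 / (IZR m - 5 / 6) ^ 2) with (16 / (12 * (IZR m - 5 / 6)) ^ 2)
          by (field; lra).
        apply Rmult_le_compat_l; [lra|]. apply Rinv_le_contravar; [apply pow_lt; lra|].
        apply pow_incr. split; [lra|]. nra.
      + apply Rlt_le, Rdiv_lt_0_compat; lra.
    - assert (Hb2 : 2 <= IZR b) by (apply IZR_le; lia).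
      set (B := IZR b) in *.
      pose (c := 16 / (25 * B ^ 2)). assert (Hc : 0 < c) by (apply Rdiv_lt_0_compat; nra).
      pose (H := fun m => c / (IZR m - B / 2 + 11 / 16 * B - / 2)).
      assert (Hn0 : forall m, (b / 2 + 1 <= m)%Z -> B + 1 <= 2 * IZR m).
      { intros m Hm. unfold B. rewrite <- plus_IZR, <- mult_IZR. apply IZR_le.
        assert (Hd := Z.div_mod b 2 ltac:(lia)). assert (Hmd := Z.mod_pos_bound b 2 ltac:(lia)).
        lia. }
      apply Rle_trans with (H (b / 2 + 1)%Z).
      + apply (Rsum_list_telescope _ H); trivial.
        2:{ intros m Hm; specialize (Hl m Hm).
            assert (Hd := Z.div_mod b 2 ltac:(lia)).
            assert (Hmd := Z.mod_pos_bound b 2 ltac:(lia)). lia. }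
        intros m Hm. specialize (Hn0 m Hm).
        repeat split; [apply row_term_ge0| |].
        * unfold H. rewrite plus_IZR. eapply Rle_trans.
          2:{ eapply Rle_trans;
                [apply (telescoping_step c (IZR m - B / 2 + 11 / 16 * B)); lra|].
              right. f_equal; f_equal; ring. }
          unfold row_term. replace (_ || _)%bool with false.
          2:{ symmetry. repeat (apply Bool.orb_false_iff; split).
              - apply Z.eqb_neq; lia.
              - apply Z.eqb_neq. intros E. apply (f_equal IZR) in E.
                rewrite mult_IZR in E. fold B in E. lra.
              - apply Bool.andb_false_iff. left. apply Z.eqb_neq. lia. }
          fold B. set (X := IZR m) in *.
          unfold c. replace (16 / (25 * B ^ 2) / (X - B / 2 + 11 / 16 * B) ^ 2)
            with (16 / (5 * B * (X - B / 2 + 11 / 16 * B)) ^ 2) by (field; lra).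
          apply Rmult_le_compat_l; [lra|]. apply Rinv_le_contravar.
          { apply pow_lt. apply Rmult_lt_0_compat; lra. }
          apply pow_incr. split; [apply Rmult_le_pos; lra|].
          assert (0 <= (2 * X - B - 5 / 4 * B) ^ 2) by apply pow2_ge_0. nra.
        * unfold H. apply Rlt_le, Rdiv_lt_0_compat; lra.
      + unfold H, row_bound. replace (b =? 0)%Z with false by (symmetry; apply Z.eqb_neq; lia).
        replace (Z.abs b =? 1)%Z with false by (symmetry; apply Z.eqb_neq; lia).
        replace (Z.abs b) with b by lia. fold B.
        specialize (Hn0 (b / 2 + 1)%Z ltac:(lia)).
        replace (512 / (275 * B ^ 3) / 2) with (c / (11 / 16 * B)) by (unfold c; field; lra).
        apply Rmult_le_compat_l; [lra|]. apply Rinv_le_contravar; lra. }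
  intros Hn. destruct (Z.lt_trichotomy b 0) as [Hb|[->|Hb]].
  - specialize (Hpos (- b)%Z ltac:(lia) (map Z.opp l)).
    rewrite Rsum_list_map in Hpos. unfold row_bound in *.
    replace (- b =? 0)%Z with (b =? 0)%Z in Hpos
      by (destruct (Z.eqb_spec b 0), (Z.eqb_spec (- b) 0); lia).
    rewrite Z.abs_opp in Hpos. eapply Rle_trans; [|apply Hpos].
    + apply Rsum_list_le. intros m _. rewrite row_term_opp. lra.
    + apply FinFun.Injective_map_NoDup; trivial. intros x y; lia.
  - rewrite Rsum_list_const0; [unfold row_bound; simpl; lra|]. reflexivity.
  - now apply Hpos.
Qed.

Lemma Rsum_list_row_bound l : NoDup l -> Rsum_list row_bound l <= 2 * (1 / 3 + 128 / 275).
Proof.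
  intros Hn. set (P := 1 / 3 + 128 / 275). replace (2 * P) with (0 + P + P) by ring.
  assert (Hge : forall n, 0 <= row_bound n).
  { intros n. unfold row_bound. destruct (Z.eqb_spec n 0); [lra|].
    destruct (Z.abs n =? 1)%Z; [lra|].
    apply Rlt_le, Rdiv_lt_0_compat; [lra|].
    assert (1 <= IZR (Z.abs n)) by (apply IZR_ge1; lia).
    apply Rmult_lt_0_compat; [lra|]. apply pow_lt; lra. }
  assert (Hhalf : forall l, NoDup l -> (forall n, In n l -> (1 <= n)%Z) ->
            Rsum_list row_bound l <= P).
  { clear l Hn. intros l Hn Hl.
    pose (H := fun n => if (n =? 1)%Z then P else 256 / 275 / (IZR n * (IZR n - 1))).
    apply Rle_trans with (H 1%Z); [|unfold H; simpl; lra].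
    apply (Rsum_list_telescope _ H); trivial. intros n Hn1.
    destruct (Z.eq_dec n 1) as [->|Hne].
    { unfold H, row_bound, P; simpl. lra. }
    assert (Hn2 : 2 <= IZR n) by (apply IZR_le; lia).
    unfold H. replace (n =? 1)%Z with false by (symmetry; apply Z.eqb_neq; lia).
    replace (n + 1 =? 1)%Z with false by (symmetry; apply Z.eqb_neq; lia).
    rewrite plus_IZR. set (x := IZR n) in *. repeat split; [apply Hge| |].
    - unfold row_bound. replace (n =? 0)%Z with false by (symmetry; apply Z.eqb_neq; lia).
      replace (Z.abs n =? 1)%Z with false by (symmetry; apply Z.eqb_neq; lia).
      replace (Z.abs n) with n by lia. fold x.
      replace (256 / 275 / (x * (x - 1)) - 256 / 275 / ((x + 1) * (x + 1 - 1)))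
        with (512 / (275 * (x * (x - 1) * (x + 1)))) by (field; lra).
      apply Rmult_le_compat_l; [lra|]. apply Rinv_le_contravar; [|nra].
      apply Rmult_lt_0_compat; [lra|]. repeat apply Rmult_lt_0_compat; lra.
    - apply Rlt_le, Rdiv_lt_0_compat; [lra|]. apply Rmult_lt_0_compat; lra. }
  apply Rsum_list_half_lines; trivial.
  - unfold row_bound; simpl; lra.
  - intros l' H1 H2. eapply Rle_trans; [|apply (Hhalf l'); trivial].
    apply Rsum_list_le. intros n _. unfold row_bound. rewrite Z.abs_opp.
    destruct (Z.eqb_spec (- n) 0), (Z.eqb_spec n 0); try lia; lra.
Qed.

(** The two terms with [b = 1] nearest to the centre contribute [-4/81] each. The
    others are summed along the rows of constant [b], since a majorant of the form
    [c / (m b)^2] would be too large for exponent 4. *)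
Lemma Re_first_series_pos_weight4 z A : upper_half_plane z ->
  Re z = - (1 / 2) -> Im z ^ 2 = / 20 ->
  has_Csum Fricke5_index (Fricke5_term 4 z) A -> 0 < Re A.
Proof.
  intros Hz Hx Hy HA.
  assert (Hmain : Cmod (A - 2 * (1 + / (5 * z + 2) ^ (2 * 2) + / (5 * z + 3) ^ (2 * 2)))
            <= 2 * (1 / 3 + 128 / 275)).
  { apply (Fricke5_main_terms 2 z A row_term); trivial.
    - intros m b (Hm & Hb & Hmb & H1 & H2); cbn [fst snd] in *.
      unfold row_term. replace (_ || _)%bool with false.
      + rewrite Cmod2_linear_form, Hx.
        replace ((5 * IZR b * Im z) ^ 2) with (25 * IZR b ^ 2 * Im z ^ 2) by ring. rewrite Hy.
        right. assert (IZR b <> 0) by now apply not_0_IZR.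
        assert (Hq := square_pos _ H). assert (Hp := pow2_ge_0 (2 * IZR m - IZR b)).
        field. split; nra.
      + symmetry. repeat (apply Bool.orb_false_iff; split).
        * now apply Z.eqb_neq.
        * now apply Z.eqb_neq.
        * apply Bool.andb_false_iff.
          destruct (Z.eqb_spec (Z.abs b) 1); [|now left]. right.
          apply Z.eqb_neq. intros E.
          assert (Hc : (b = 1 /\ m = 1 \/ b = -1 /\ m = -1)%Z) by lia.
          destruct Hc as [[-> ->]|[-> ->]]; auto.
    - intros l Hn _. apply (Rsum_list_rows row_term row_bound); trivial.
      + apply row_term_ge0.
      + apply Rsum_list_row.
      + apply Rsum_list_row_bound. }
  apply Re_ge_of_Cmod in Hmain. rewrite Re_double, !Re_plus in Hmain.
  assert (Hterm : forall e : R, e ^ 2 = / 4 -> 5 * Re z + (5 / 2 + e) = e ->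
            Re (/ (5 * z + RtoC (5 / 2 + e)) ^ (2 * 2))%C = - (4 / 81)).
  { intros e He Hre.
    assert (H0 : (5 * z + RtoC (5 / 2 + e))%C <> RtoC 0).
    { apply linear_form_neq0; trivial. left; lra. }
    rewrite Re_inv by now apply Cpow_nz.
    rewrite Cmod_pow, pow_mult.
    rewrite Cmod2_linear_form, Hre.
    replace ((5 * Im z) ^ 2) with (25 * Im z ^ 2) by ring. rewrite He, Hy.
    replace (Re ((5 * z + RtoC (5 / 2 + e)) ^ (2 * 2))%C) with
      ((5 * Re z + (5 / 2 + e)) ^ 4
       - 6 * (5 * Re z + (5 / 2 + e)) ^ 2 * (25 * Im z ^ 2) + (25 * Im z ^ 2) ^ 2).
    - rewrite Hre, Hy. replace (e ^ 4) with (e ^ 2 * e ^ 2) by ring. rewrite He. field.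
    - destruct z as [x y]; unfold Re, Im; simpl. field. }
  assert (Ht := Hterm (- (1 / 2)) ltac:(field) ltac:(lra)).
  assert (Hs := Hterm (1 / 2) ltac:(field) ltac:(lra)).
  replace (5 / 2 + - (1 / 2)) with 2 in Ht by field.
  replace (5 / 2 + 1 / 2) with 3 in Hs by field.
  rewrite Ht, Hs in Hmain. change (Re 1) with 1 in Hmain. lra.
Qed.

(** * The fundamental region and its boundary *)

Definition dist2 (p : R) (z : C) : R := (Re z - p) ^ 2 + Im z ^ 2.

(** The left half of the fundamental domain, up to height 2, together with its
    mirror image in [Re z = -1/2]: on that line there is no easy estimate, while the
    sides [Re z = 0] and [Re z = -1] are translates of each other. The arcs force
    [Im z >= 1/5], so that the bound [1/10] only makes the set closed. *)
Definition region (z : C) : Prop :=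
  - 1 <= Re z /\ Re z <= 0 /\ / 10 <= Im z /\ Im z <= 2 /\
  / 5 <= dist2 0 z /\ / 5 <= dist2 (- 1) z /\ / 20 <= dist2 (- (1 / 2)) z.

Definition region_boundary (z : C) : Prop :=
  Re z = - 1 \/ Re z = 0 \/ Im z = 2 \/
  dist2 0 z = / 5 \/ dist2 (- 1) z = / 5 \/ dist2 (- (1 / 2)) z = / 20.

Lemma cont_at_Re z : cont_at Re z.
Proof.
  intros e He. exists e; split; trivial. intros w Hw.
  assert (H := re_le_Cmod (w - z)).
  destruct w, z; unfold Re, Cminus, Cplus, Copp in *; cbn [fst snd] in *.
  unfold Rminus; lra.
Qed.

Lemma cont_at_Im z : cont_at Im z.
Proof.
  intros e He. exists e; split; trivial. intros w Hw.
  assert (H := im_le_Cmod (w - z)).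
  destruct w, z; unfold Im, Cminus, Cplus, Copp in *; cbn [fst snd] in *.
  unfold Rminus; lra.
Qed.

Lemma dist2_Cmod p z : dist2 p z = Cmod (z - p) ^ 2.
Proof. rewrite Cmod2_alt. destruct z; unfold dist2, Re, Im; simpl; ring. Qed.

Lemma cont_at_dist2 p z : cont_at (dist2 p) z.
Proof.
  intros e He. generalize (cont_at_Cmod2 _ z (taylor2_sub_const p z) e He).
  apply near_mono. intros w. now rewrite !dist2_Cmod.
Qed.

Lemma near_lt u z c : cont_at u z -> u z < c -> near z (fun w => u w < c).
Proof.
  intros H Hc. generalize (H (c - u z) ltac:(lra)). apply near_mono.
  intros w Hw. apply Rabs_lt_between in Hw. lra.
Qed.

Lemma near_gt u z c : cont_at u z -> c < u z -> near z (fun w => c < u w).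
Proof.
  intros H Hc. generalize (H (u z - c) ltac:(lra)). apply near_mono.
  intros w Hw. apply Rabs_lt_between in Hw. lra.
Qed.

Lemma closed_set_and K K' : closed_set K -> closed_set K' -> closed_set (fun z => K z /\ K' z).
Proof.
  intros H H' z Hz. destruct (classic (K z)) as [HK|HK].
  - assert (HK' : ~ K' z) by tauto. generalize (H' z HK'). apply near_mono; tauto.
  - generalize (H z HK). apply near_mono; tauto.
Qed.

Lemma closed_set_le u c : (forall z, cont_at u z) -> closed_set (fun z => u z <= c).
Proof.
  intros H z Hz. generalize (near_gt u z c (H z) ltac:(lra)). apply near_mono. intros; lra.
Qed.

Lemma closed_set_ge u c : (forall z, cont_at u z) -> closed_set (fun z => c <= u z).
Proof.
  intros H z Hz. generalize (near_lt u z c (H z) ltac:(lra)). apply near_mono. intros; lra.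
Qed.

Lemma region_closed : closed_set region.
Proof.
  unfold region. repeat apply closed_set_and;
    first [apply (closed_set_ge Re) | apply (closed_set_le Re)
          | apply (closed_set_ge Im) | apply (closed_set_le Im)
          | apply (closed_set_ge (dist2 _))];
    first [apply cont_at_Re | apply cont_at_Im | apply cont_at_dist2].
Qed.

Lemma region_in_box : in_box 2 region.
Proof. intros z H. unfold region in H. split; apply Rabs_le; lra. Qed.

Lemma above_arcs_Im_lower_bound z : - 1 <= Re z <= 0 -> 0 <= Im z ->
  / 5 <= dist2 0 z -> / 5 <= dist2 (- 1) z -> / 20 <= dist2 (- (1 / 2)) z -> / 5 <= Im z.
Proof.
  unfold dist2. intros Hx Hy H1 H2 H3. set (x := Re z) in *. set (y := Im z) in *.
  assert (/ 25 <= y ^ 2); [|nra].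
  destruct (Rle_dec x (- (3 / 5))); [nra|]. destruct (Rle_dec x (- (2 / 5))); nra.
Qed.

Lemma region_interior_or : interior_or region region_boundary.
Proof.
  intros z H. unfold region_boundary. destruct H as (H1 & H2 & H3 & H4 & H5 & H6 & H7).
  assert (Hy := above_arcs_Im_lower_bound z ltac:(lra) ltac:(lra) H5 H6 H7).
  destruct (Req_dec (Re z) (- 1)); [tauto|]. destruct (Req_dec (Re z) 0); [tauto|].
  destruct (Req_dec (Im z) 2); [tauto|]. destruct (Req_dec (dist2 0 z) (/ 5)); [tauto|].
  destruct (Req_dec (dist2 (- 1) z) (/ 5)); [tauto|].
  destruct (Req_dec (dist2 (- (1 / 2)) z) (/ 20)); [tauto|]. right.
  generalize (near_and _ _ _ (near_gt Re z (- 1) (cont_at_Re z) ltac:(lra))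
    (near_and _ _ _ (near_lt Re z 0 (cont_at_Re z) ltac:(lra))
    (near_and _ _ _ (near_gt Im z (/ 10) (cont_at_Im z) ltac:(lra))
    (near_and _ _ _ (near_lt Im z 2 (cont_at_Im z) ltac:(lra))
    (near_and _ _ _ (near_gt (dist2 0) z (/ 5) (cont_at_dist2 _ z) ltac:(lra))
    (near_and _ _ _ (near_gt (dist2 (- 1)) z (/ 5) (cont_at_dist2 _ z) ltac:(lra))
      (near_gt (dist2 (- (1 / 2))) z (/ 20) (cont_at_dist2 _ z) ltac:(lra)))))))).
  apply near_mono. intros w (Q1 & Q2 & Q3 & Q4 & Q5 & Q6 & Q7).
  unfold region. split; [lra|]. intros [E|[E|[E|[E|[E|E]]]]]; lra.
Qed.

Lemma nonneg_Re_bound w d : 0 <= Re w -> 0 < d -> d <= Cmod (w + RtoC d).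
Proof.
  intros Hw Hd. assert (H := re_le_Cmod (w + RtoC d)). apply Rabs_le_between in H.
  rewrite Re_plus in H. change (Re (RtoC d)) with d in H. lra.
Qed.

(** Where [conj f = U f], the values of [f] lie on the real line of the
    directions [v] with [conj v = U v]; this is the real axis only if [U = 1],
    and there the sign is prescribed. *)
Lemma real_line_bound L A f U :
  closed_set A -> in_box L A ->
  (forall z, A z -> taylor2 f z) -> (forall z, taylor2 U z) ->
  (forall z, A z -> Cmod (U z) = 1) -> (forall z, A z -> Cconj (f z) = (U z * f z)%C) ->
  (forall z, A z -> U z = RtoC 1 -> 0 < Re (f z)) ->
  exists c, 0 < c /\ forall z, A z -> forall d, 0 < d -> c * d <= Cmod (f z + RtoC d).
Proof.
  intros Hc Hb Hf HU HU1 Hconj Hpos.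
  apply (compact_uniform_on L A (fun z c => forall d, 0 < d -> c * d <= Cmod (f z + RtoC d)));
    trivial.
  - intros z e e' He H d Hd. specialize (H d Hd). nra.
  - intros t Ht. destruct (classic (U t = RtoC 1)) as [E|E].
    + exists 1; split; [lra|]. specialize (Hpos t Ht E).
      generalize (taylor2_continuous f t _ (Hf t Ht) Hpos). apply near_mono.
      intros w Hw _ d Hd. rewrite Rmult_1_l. apply nonneg_Re_bound; trivial.
      assert (H := re_le_Cmod (f w - f t)). apply Rabs_le_between in H.
      unfold Cminus in H at 2. rewrite Re_plus in H.
      replace (Re (- f t)%C) with (- Re (f t)) in H by (destruct (f t); reflexivity). lra.
    + assert (Hm : 0 < Cmod (U t - 1)).
      { apply Cmod_gt_0. intros E'. apply E.
        replace (U t) with (U t - 1 + 1)%C by ring. rewrite E'; ring. }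
      set (m := Cmod (U t - 1)) in *. exists (m / 4); split; [lra|].
      generalize (taylor2_continuous U t (m / 2) (HU t) ltac:(lra)). apply near_mono.
      intros w Hw HA d Hd.
      assert (H1 : m / 2 <= Cmod (1 - U w)).
      { assert (H := Cmod_triangle_rev (U t - 1) (U w - U t)).
        replace (U t - 1 + (U w - U t))%C with (- (1 - U w))%C in H by ring.
        rewrite Cmod_opp in H. fold m in H. lra. }
      assert (H2 : (RtoC d * (1 - U w))%C
         = (Cconj (f w + RtoC d) + - (U w * (f w + RtoC d)))%C).
      { rewrite Cplus_conj, Cconj_R, Hconj by trivial. ring. }
      assert (H3 := Cmod_triangle (Cconj (f w + RtoC d)) (- (U w * (f w + RtoC d)))).
      rewrite <- H2, Cmod_opp, Cmod_conj, !Cmod_mult, HU1, Cmod_R, Rabs_pos_eq in H3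
        by (trivial; lra).
      nra.
Qed.

(** ** The arcs *)

(** The powers [(sqrt 5 z)^(2 h)] and [(sqrt 5 (2 z + 1))^(2 h)], of modulus 1 on the
    respective arcs. *)
Definition arc1_unit (h : nat) (z : C) : C := ((5 * (z * z)) ^ h)%C.
Definition arc2_unit (h : nat) (z : C) : C := ((5 * ((2 * z + 1) * (2 * z + 1))) ^ h)%C.

Lemma taylor2_id z : taylor2 (fun w => w) z.
Proof.
  exists 1, 0, 0, 1. repeat split; try lra. intros h _.
  replace (_ - _)%C with (RtoC 0) by ring. rewrite Cmod_0; lra.
Qed.

Lemma taylor2_arc1_unit h z : taylor2 (arc1_unit h) z.
Proof.
  apply (taylor2_pow (fun w => 5 * (w * w))%C).
  apply taylor2_mult; [apply taylor2_const|]. apply taylor2_mult; apply taylor2_id.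
Qed.

Lemma taylor2_arc2_unit h z : taylor2 (arc2_unit h) z.
Proof.
  apply (taylor2_pow (fun w => 5 * ((2 * w + 1) * (2 * w + 1)))%C).
  apply taylor2_mult; [apply taylor2_const|].
  assert (H : taylor2 (fun w => 2 * w + 1)%C z).
  { apply taylor2_plus; [|apply taylor2_const].
    apply taylor2_mult; [apply taylor2_const|apply taylor2_id]. }
  now apply taylor2_mult.
Qed.

Lemma Cmod_pow_one u h : Cmod u ^ 2 = 1 -> Cmod (u ^ h) = 1.
Proof.
  intros H. assert (Cmod u = 1) by (assert (P := Cmod_ge_0 u); nra).
  now rewrite Cmod_pow, H0, pow1.
Qed.

Lemma Cmod2_eq_mult_conj u r : Cmod u ^ 2 = r -> (u * Cconj u)%C = RtoC r.
Proof. intros <-. now rewrite <- Cmod2_conj. Qed.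

Lemma five_times_square_unit u : Cmod u ^ 2 = / 5 -> Cmod (5 * (u * u)) ^ 2 = 1.
Proof.
  intros H. rewrite !Cmod_mult, Cmod_R, Rabs_pos_eq by lra.
  replace ((5 * (Cmod u * Cmod u)) ^ 2) with (25 * (Cmod u ^ 2) ^ 2) by ring.
  rewrite H. field.
Qed.

Lemma Fricke5_real_line h z (u : C) : (2 <= h)%nat -> upper_half_plane z ->
  Cmod u ^ 2 = / 5 ->
  (forall A B, has_Csum Fricke5_index (Fricke5_term (2 * h) z) A ->
     has_Csum Fricke5_index (Eisenstein_term (2 * h) z) B ->
     Cconj A = (u ^ (2 * h) * B)%C) ->
  let U := ((5 * (u * u)) ^ h)%C in let f := Eisenstein_Fricke5 (2 * h) z in
  Cmod U = 1 /\ Cconj f = (U * f)%C /\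
  (U = RtoC 1 -> exists A, has_Csum Fricke5_index (Fricke5_term (2 * h) z) A /\
                           f = RtoC (Re A)).
Proof.
  intros Hh Hz Hu HAB U f.
  destruct (has_Csum_Fricke5_terms (2 * h) z ltac:(lia) Hz) as (A & B & HA & HB).
  assert (HU : Cmod U = 1) by now apply Cmod_pow_one, five_times_square_unit.
  assert (H5h : (5 ^ h)%C <> RtoC 0) by (apply Cpow_nz; intros E; injection E; lra).
  destruct (real_up_to_unit A (B / 5 ^ h)%C U f) as [H1 H2]; trivial.
  - rewrite (HAB A B HA HB). unfold U. rewrite Cpow_mult_l, Cpow_mult_r.
    replace (u ^ 2)%C with (u * u)%C by (simpl; ring). field. trivial.
  - now apply Fricke5_decomposition.
  - repeat split; trivial. intros E. exists A; auto.
Qed.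

Lemma even_ge2 h : (2 <= h)%nat -> Nat.Even h -> h = 2%nat \/ (4 <= h)%nat.
Proof. intros H [j Hj]. lia. Qed.

Lemma square_one_Im u : (u ^ 2)%C = RtoC 1 -> Im u = 0.
Proof.
  destruct u as [x y]; unfold Im; simpl. intros E. injection E as E1 E2.
  destruct (Req_dec y 0); trivial. assert (x = 0) by nra. subst x. nra.
Qed.

Lemma arc1_real_line h z : (2 <= h)%nat -> Nat.Even h -> on_arc1 z ->
  let f := Eisenstein_Fricke5 (2 * h) z in
  Cmod (arc1_unit h z) = 1 /\ Cconj f = (arc1_unit h z * f)%C /\
  (arc1_unit h z = RtoC 1 -> 0 < Re f).
Proof.
  intros Hh He Hz f. assert (Hz' := Hz). destruct Hz' as (Huhp & Hm & Hx).
  destruct (Fricke5_real_line h z z Hh Huhp Hm) as (H1 & H2 & H3).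
  { intros A B. apply conj_sum_arc1; trivial; [lia|].
    rewrite <- RtoC_inv by lra. now apply Cmod2_eq_mult_conj. }
  repeat split; trivial. intros E. destruct (even_ge2 h Hh He) as [->|Hh4].
  (* weight 4: (5 z^2)^2 = 1 forces z onto the imaginary axis *)
  - assert (Him := square_one_Im _ E). rewrite Cmod2_alt in Hm.
    destruct z as [x y]. unfold upper_half_plane, Re, Im in *; simpl in Him; simpl in Huhp, Hm.
    assert (x = 0) by nra. subst x. apply Fricke5_pos_imaginary_axis; trivial. nra.
  - destruct (H3 E) as (A & HA & Ef). unfold f. rewrite Ef.
    change (0 < Re A). eapply Re_first_series_pos; eauto.
Qed.

Lemma arc2_real_line h z : (2 <= h)%nat -> Nat.Even h -> on_arc2 z ->
  let f := Eisenstein_Fricke5 (2 * h) z in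
  Cmod (arc2_unit h z) = 1 /\ Cconj f = (arc2_unit h z * f)%C /\
  (arc2_unit h z = RtoC 1 -> 0 < Re f).
Proof.
  intros Hh He Hz f. assert (Hz' := Hz). destruct Hz' as (Huhp & Hm & Hx).
  assert (Hv : Cmod (2 * z + 1) ^ 2 = / 5).
  { rewrite Cmod2_alt in *. destruct z as [x y]; unfold Re, Im in *; simpl in *. lra. }
  destruct (Fricke5_real_line h z (2 * z + 1)%C Hh Huhp Hv) as (H1 & H2 & H3).
  { intros A B. apply conj_sum_arc2; trivial.
    rewrite <- RtoC_inv by lra. now apply Cmod2_eq_mult_conj. }
  repeat split; trivial. intros E. destruct (H3 E) as (A & HA & Ef). unfold f. rewrite Ef.
  change (0 < Re A). destruct (even_ge2 h Hh He) as [->|Hh4].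
  (* weight 4: (2 z + 1)^2 is real, so Re z = -1/2 *)
  - assert (Him := square_one_Im _ E). rewrite Cmod2_alt in Hm.
    assert (Hx2 : Re z = - (1 / 2)).
    { destruct z as [x y]. unfold upper_half_plane, Re, Im in *; simpl in Him; simpl in Huhp.
      simpl. nra. }
    apply (Re_first_series_pos_weight4 z); trivial. rewrite Hx2 in Hm. lra.
  - eapply Re_first_series_pos; eauto.
Qed.

(** ** The boundary bound *)

Lemma region_upper_half_plane z : region z -> upper_half_plane z.
Proof. unfold region, upper_half_plane. lra. Qed.

Lemma arcs_bound h : (2 <= h)%nat -> Nat.Even h ->
  exists c, 0 < c <= 1 /\ forall z, region z -> - (1 / 2) <= Re z ->
    dist2 0 z = / 5 \/ dist2 (- (1 / 2)) z = / 20 ->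
    forall d, 0 < d -> c * d <= Cmod (Eisenstein_Fricke5 (2 * h) z + RtoC d).
Proof.
  intros Hh He. set (f := Eisenstein_Fricke5 (2 * h)).
  set (A1 := fun z => region z /\ - (1 / 2) <= Re z /\ dist2 0 z <= / 5).
  set (A2 := fun z => region z /\ - (1 / 2) <= Re z /\ dist2 (- (1 / 2)) z <= / 20).
  assert (Hbox : forall (P : C -> Prop), in_box 2 (fun z => region z /\ P z)).
  { intros P z [Hz _]. now apply region_in_box. }
  assert (HA1 : forall z, A1 z -> on_arc1 z).
  { intros z (Hr & Hx & Hd). assert (Hu := region_upper_half_plane z Hr).
    unfold region, dist2, on_arc1 in *. rewrite Cmod2_alt. repeat split; trivial; nra. }
  assert (HA2 : forall z, A2 z -> on_arc2 z).
  { intros z (Hr & Hx & Hd). assert (Hu := region_upper_half_plane z Hr).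
    unfold region, dist2, on_arc2 in *. rewrite Cmod2_alt. repeat split; trivial; nra. }
  assert (Hf : forall z, region z -> taylor2 f z).
  { intros z Hz. apply taylor2_Fricke5; [lia|]. now apply region_upper_half_plane. }
  destruct (real_line_bound 2 A1 f (arc1_unit h)) as (c1 & Hc1 & Hb1).
  - apply closed_set_and; [apply region_closed|].
    apply closed_set_and; [apply (closed_set_ge Re), cont_at_Re|].
    apply closed_set_le, cont_at_dist2.
  - apply Hbox.
  - intros z [Hz _]; auto.
  - apply taylor2_arc1_unit.
  - intros z Hz. now apply arc1_real_line, HA1.
  - intros z Hz. now apply arc1_real_line, HA1.
  - intros z Hz. now apply arc1_real_line, HA1.
  - destruct (real_line_bound 2 A2 f (arc2_unit h)) as (c2 & Hc2 & Hb2).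
    + apply closed_set_and; [apply region_closed|].
      apply closed_set_and; [apply (closed_set_ge Re), cont_at_Re|].
      apply closed_set_le, cont_at_dist2.
    + apply Hbox.
    + intros z [Hz _]; auto.
    + apply taylor2_arc2_unit.
    + intros z Hz. now apply arc2_real_line, HA2.
    + intros z Hz. now apply arc2_real_line, HA2.
    + intros z Hz. now apply arc2_real_line, HA2.
    + exists (Rmin 1 (Rmin c1 c2)). assert (M1 := Rmin_l 1 (Rmin c1 c2)).
      assert (M2 := Rmin_r 1 (Rmin c1 c2)).
      assert (M3 := Rmin_l c1 c2). assert (M4 := Rmin_r c1 c2).
      split; [split; trivial; repeat apply Rmin_glb_lt; lra|].
      intros z Hz Hx [Hd|Hd] d Hd0.
      * apply Rle_trans with (c1 * d); [nra|]. apply Hb1; trivial. split; [trivial|lra].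
      * apply Rle_trans with (c2 * d); [nra|]. apply Hb2; trivial. split; [trivial|lra].
Qed.

Lemma Fricke5_pos_vertical_lines h z : (2 <= h)%nat -> Nat.Even h -> region z ->
  Re z = 0 \/ Re z = - 1 -> 0 < Re (Eisenstein_Fricke5 (2 * h) z).
Proof.
  intros Hh He Hz Hx. assert (Hu := region_upper_half_plane z Hz).
  assert (Ez : Eisenstein_Fricke5 (2 * h) z = Eisenstein_Fricke5 (2 * h) (0, Im z)).
  { destruct Hx as [Hx|Hx].
    - f_equal. destruct z; unfold Re, Im in *; simpl in *. now subst.
    - rewrite <- (Fricke5_translate (2 * h) z) by (trivial; lia). f_equal.
      destruct z; unfold Re, Im in *; simpl in *. subst. apply injective_projections; simpl; ring. }
  rewrite Ez. unfold region, dist2 in Hz. apply Fricke5_pos_imaginary_axis; trivial.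
  destruct Hx as [Hx|Hx]; rewrite Hx in Hz; lra.
Qed.

Lemma boundary_bound h : (2 <= h)%nat -> Nat.Even h ->
  exists c, 0 < c /\ forall z, region z -> region_boundary z ->
    forall d, 0 < d -> c * d <= Cmod (Eisenstein_Fricke5 (2 * h) z + RtoC d).
Proof.
  intros Hh He. destruct (arcs_bound h Hh He) as (c & Hc & Harc).
  exists c; split; [lra|]. intros z Hz HB d Hd.
  assert (Hu := region_upper_half_plane z Hz).
  assert (Hpos : 0 <= Re (Eisenstein_Fricke5 (2 * h) z) ->
            c * d <= Cmod (Eisenstein_Fricke5 (2 * h) z + RtoC d)).
  { intros H. assert (H' := nonneg_Re_bound _ d H Hd). nra. }
  destruct (classic (Re z = 0 \/ Re z = - 1)) as [Hx|Hx].
  { apply Hpos. left. now apply Fricke5_pos_vertical_lines. }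
  destruct (Req_dec (Im z) 2) as [Hy|Hy].
  { apply Hpos. assert (H := Fricke5_near_cusp h z Hh). unfold region in Hz.
    specialize (H ltac:(apply Rabs_le; lra) ltac:(lra)). lra. }
  destruct (Rle_dec (- (1 / 2)) (Re z)) as [Hh1|Hh1].
  - apply Harc; trivial. unfold region_boundary in HB.
    destruct HB as [HB|[HB|[HB|[HB|[HB|HB]]]]]; try tauto.
    left. unfold region, dist2 in *. nra.
  (* the left half is the mirror image of the right half in Re z = -1/2 *)
  - set (z' := (- Cconj z - 1)%C).
    assert (Ex : Re z' = - 1 - Re z) by (destruct z; unfold z', Re; simpl; ring).
    assert (Ey : Im z' = Im z) by (destruct z; unfold z', Im; simpl; ring).
    assert (Hz' : region z').
    { unfold region, dist2 in *. rewrite Ex, Ey. repeat split; try lra. }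
    assert (Ef : Eisenstein_Fricke5 (2 * h) z' = Cconj (Eisenstein_Fricke5 (2 * h) z)).
    { rewrite <- Fricke5_reflect by (trivial; lia).
      rewrite <- Fricke5_translate by (try lia; now apply region_upper_half_plane).
      f_equal. unfold z'; ring. }
    replace (Cmod (Eisenstein_Fricke5 (2 * h) z + RtoC d))
      with (Cmod (Eisenstein_Fricke5 (2 * h) z' + RtoC d)).
    2:{ rewrite Ef. rewrite <- (Cconj_R d) at 1. rewrite <- Cplus_conj. apply Cmod_conj. }
    apply Harc; trivial; [lra|]. unfold region_boundary, region, dist2 in *. rewrite Ex, Ey.
    destruct HB as [HB|[HB|[HB|[HB|[HB|HB]]]]]; try tauto.
    + left. nra.
    + left. lra.
    + right. lra.
Qed.

(** * The zeros *)

Lemma Fricke5_nonzero_off_arcs h z : (2 <= h)%nat -> Nat.Even h -> upper_half_plane z ->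
  - 1 < Re z < 0 -> / 5 < dist2 0 z -> / 5 < dist2 (- 1) z -> / 20 < dist2 (- (1 / 2)) z ->
  Eisenstein_Fricke5 (2 * h) z <> RtoC 0.
Proof.
  intros Hh He Hz Hx H0 H1 H2.
  assert (Htop : forall w, Rabs (Re w) <= 1 -> 2 <= Im w ->
            Eisenstein_Fricke5 (2 * h) w <> RtoC 0).
  { intros w Hw1 Hw2 E. assert (H := Fricke5_near_cusp h w Hh Hw1 Hw2).
    rewrite E in H. unfold Re in H; simpl in H. lra. }
  destruct (Rle_dec 2 (Im z)) as [Hy|Hy].
  { apply Htop; trivial. apply Rabs_le; lra. }
  destruct (boundary_bound h Hh He) as (c & Hc & HB).
  assert (Hf : forall z, region z -> taylor2 (Eisenstein_Fricke5 (2 * h)) z).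
  { intros w Hw. apply taylor2_Fricke5; [lia|]. now apply region_upper_half_plane. }
  destruct z as [x y]. unfold upper_half_plane, dist2, Re, Im in *; simpl fst in *; simpl snd in *.
  assert (Hyl := above_arcs_Im_lower_bound (x, y)).
  unfold dist2, Re, Im in Hyl; simpl fst in Hyl; simpl snd in Hyl.
  specialize (Hyl ltac:(lra) ltac:(lra) ltac:(lra) ltac:(lra) ltac:(lra)).
  assert (Hreg : forall t, y <= t <= 2 -> region (x, t)).
  { intros t Ht. unfold region, dist2, Re, Im; simpl fst; simpl snd.
    repeat split; try lra; nra. }
  apply (zero_free_from_above _ x y 2); [lra|auto| |].
  - intros t Ht E0.
    apply (interior_zero_spreads 2 region region_boundary _ c); trivial.
    + apply region_closed.
    + apply region_in_box.
    + apply region_interior_or.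
    + apply Hreg; lra.
    + unfold region_boundary, dist2, Re, Im; simpl fst; simpl snd.
      assert (y ^ 2 <= t ^ 2) by nra.
      intros [E|[E|[E|[E|[E|E]]]]]; lra.
  - apply Htop; unfold Re, Im; simpl; [apply Rabs_le; lra|lra].
Qed.

Lemma inv_sqrt5_bounds : (1 / sqrt 5) ^ 2 = / 5 /\ (1 / (2 * sqrt 5)) ^ 2 = / 20 /\
  0 < 1 / sqrt 5 /\ 0 < 1 / (2 * sqrt 5).
Proof.
  assert (H5 : sqrt 5 ^ 2 = 5) by (apply pow2_sqrt; lra).
  assert (Hp : 0 < sqrt 5) by (apply sqrt_lt_R0; lra).
  repeat split.
  - replace ((1 / sqrt 5) ^ 2) with (/ sqrt 5 ^ 2) by (field; lra). now rewrite H5.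
  - replace ((1 / (2 * sqrt 5)) ^ 2) with (/ (4 * sqrt 5 ^ 2)) by (field; lra).
    rewrite H5. field.
  - apply Rdiv_lt_0_compat; lra.
  - apply Rdiv_lt_0_compat; lra.
Qed.

Lemma Fricke5_nonzero_left_half h z : (2 <= h)%nat -> Nat.Even h -> upper_half_plane z ->
  - (1 / 2) <= Re z <= 0 -> 1 / sqrt 5 < Cmod z -> 1 / (2 * sqrt 5) < Cmod (z + 1 / 2) ->
  Eisenstein_Fricke5 (2 * h) z <> RtoC 0.
Proof.
  intros Hh He Hz Hx H1 H2. destruct inv_sqrt5_bounds as (E1 & E2 & P1 & P2).
  assert (Q1 : / 5 < dist2 0 z).
  { rewrite dist2_Cmod. replace (z - 0)%C with z by ring. rewrite <- E1. nra. }
  assert (Q2 : / 20 < dist2 (- (1 / 2)) z).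
  { rewrite dist2_Cmod. replace (z - RtoC (- (1 / 2)))%C with (z + 1 / 2)%C.
    - rewrite <- E2. nra.
    - rewrite RtoC_opp, RtoC_div by lra. ring. }
  destruct (Req_dec (Re z) 0) as [Hx0|Hx0].
  - intros E. assert (H := Fricke5_pos_imaginary_axis h (Im z) Hh He Hz).
    unfold dist2 in Q1. rewrite Hx0 in Q1. specialize (H ltac:(lra)).
    replace (0, Im z) with z in H by (destruct z; unfold Re, Im in *; simpl in *; now subst).
    rewrite E in H. unfold Re in H; simpl in H. lra.
  - apply Fricke5_nonzero_off_arcs; trivial; [lra|]. unfold dist2 in *. lra.
Qed.

Theorem proposition4p3 :
  forall k : nat, (4 <= k)%nat -> Nat.divide 4 k ->
  forall z : C, Fricke5_domain z -> Eisenstein_Fricke5 k z = RtoC 0 ->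
  Fricke5_arc z.
Proof.
  intros k Hk [j Hj] z Hz E. split; trivial.
  set (h := (2 * j)%nat). replace k with (2 * h)%nat in E by (unfold h; lia).
  assert (Hh : (2 <= h)%nat) by (unfold h; lia).
  assert (He : Nat.Even h) by now exists j.
  destruct Hz as [Hz [(H1 & H2 & Hx)|(H1 & H2 & Hx)]].
  - apply NNPP; intros Hno. apply (Fricke5_nonzero_left_half h z) in E; trivial.
    + destruct (Rge_gt_or_eq_dec _ _ H1); [trivial|tauto].
    + destruct (Rge_gt_or_eq_dec _ _ H2); [trivial|tauto].
  - exfalso. apply (Fricke5_nonzero_left_half h (- Cconj z)%C); trivial.
    + unfold upper_half_plane in *. destruct z; unfold Im in *; simpl in *; lra.
    + destruct z; unfold Re in *; simpl in *; lra.
    + now rewrite Cmod_opp, Cmod_conj.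
    + replace (- Cconj z + 1 / 2)%C with (- Cconj (z - 1 / 2))%C.
      * now rewrite Cmod_opp, Cmod_conj.
      * destruct z; apply injective_projections; simpl; field.
    + rewrite Fricke5_reflect, E by (trivial; lia). apply Cconj_R.
Qed.
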